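(* Let $p$ be a prime, let $\zeta=e^{2\pi i/p}$, and let $(c_{ij})_{i,j\ge 1}$ be a skew-symmetric infinite matrix over the field $\mathbb{Z}_p$. Let $u_1,u_2,\dots$ be a universal sequence of unitary operators satisfying $u_k^p=\mathbf 1$ for all $k$ and $$u_iu_j=\zeta^{c_{ij}}u_ju_i,\qquad i,j=1,2,\dots.$$ Let $\omega:\Gamma\times\Gamma\to\mathbb{Z}_p$ be the skew-symmetric bilinear form $$\omega(x,y)=\sum_{i,j=1}^\infty c_{ij}x_jy_i,\qquad x,y\in\Gamma,$$ and let $n=2r$ be its rank, $r\in\{1,2,\dots,\infty\}$. Then $C^*(u_1,u_2,\dots)$ is isomorphic to $C(X)\otimes\mathcal B$, where $X$ is a totally disconnected compact metrizable space, and where $\mathcal B=M_{p^r}(\mathbb C)$ if $r$ is finite and $\mathcal B$ is a UHF algebra of type $p^\infty$ if $r=\infty$. The center $C(X)\otimes\mathbf 1$ is the closed linear span of the set of words $\{w_x:x\in\ker\omega\}$. Moreover, $C^*(u_1,u_2,\dots)$ is simple if and only if its center is trivial (i.e. equal to $\mathbb C\cdot\mathbf 1$), if and only if $\omega$ is a symplectic form.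
   Context: $\mathbb{Z}_p=\{0,1,\dots,p-1\}$ is the field with $p$ elements. A matrix $(c_{ij})$ over $\mathbb{Z}_p$ is skew-symmetric if $c_{ij}=-c_{ji}$ and $c_{ii}=0$ for all $i,j$ (the latter is automatic for $p$ odd). $\Gamma=\mathbb{Z}_p\oplus\mathbb{Z}_p\oplus\cdots$ is the vector space over $\mathbb{Z}_p$ of all sequences $x=(x_1,x_2,\dots)$ in $\mathbb{Z}_p$ with $x_k=0$ for all but finitely many $k$. The kernel of $\omega$ is $\ker\omega=\{x\in\Gamma:\omega(x,\Gamma)=\{0\}\}$; the rank of $\omega$ is $\dim_{\mathbb{Z}_p}(\Gamma/\ker\omega)$ (a nonnegative even integer or $\infty$); $\omega$ is symplectic if $\ker\omega=\{0\}$. For $x\in\Gamma$, the word $w_x$ is $w_x=u_1^{x_1}u_2^{x_2}\cdots$ (a finite product, with $x_k\in\{0,\dots,p-1\}$). A sequence $u_1,u_2,\dots$ of unitaries (elements of a unital $C^*$-algebra) satisfying the given relations is universal if for every sequence $U_1,U_2,\dots\in\mathcal B(H)$ of unitary operators on a Hilbert space satisfying the same relations there is a representation $\pi:C^*(u_1,u_2,\dots)\to\mathcal B(H)$ with $\pi(u_k)=U_k$ for all $k$. Here $C^*(u_1,u_2,\dots)$ is the $C^*$-algebra generated by the $u_k$; it is determined up to canonical isomorphism by the relations. A UHF algebra of type $p^\infty$ is the ($C^*$-algebraic) infinite tensor product of copies of $M_p(\mathbb C)$. *)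

(* Defs.v *)
From HB Require Import structures.
From mathcomp Require Import all_boot all_order all_algebra.
From mathcomp Require Import complex.
From mathcomp Require Import all_classical all_reals all_analysis.

Set Implicit Arguments.
Unset Strict Implicit.
Unset Printing Implicit Defensive.

Import Order.TTheory GRing.Theory Num.Theory.
Import numFieldNormedType.Exports.

Local Open Scope classical_set_scope.
Local Open Scope ring_scope.

HB.mixin Record Algebra_isStarAlgebra (R : realType) A of GRing.Algebra R[i] A := {
  star : A -> A;
  starK : involutive star;
  starD : {morph star : x y / x + y};
  starM : forall x y, star (x * y) = star y * star x;
  starZ : forall (a : R[i]) x, star (a *: x) = a^* *: star x
}.

#[short(type="starAlgType")]
HB.structure Definition StarAlgebra (R : realType) :=
  {A of GRing.Algebra R[i] A & Algebra_isStarAlgebra R A}.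

(* Rings and normed modules have no join in the library besides numDomainType,
   so the norm is a separate field here, and the induced topology lives on the
   alias [topo A]. *)
HB.mixin Record StarAlgebra_hasCStarNorm (R : realType) A of StarAlgebra R A := {
  cnorm : A -> R[i];
  cnormD : forall x y, cnorm (x + y) <= cnorm x + cnorm y;
  cnormZ : forall (a : R[i]) x, cnorm (a *: x) = `|a| * cnorm x;
  cnorm0_eq0 : forall x, cnorm x = 0 -> x = 0;
  cnormM : forall x y, cnorm (x * y) <= cnorm x * cnorm y;
  cnorm_star : forall x, cnorm (star x * x) = cnorm x ^+ 2
}.

#[short(type="preCStarAlgType")]
HB.structure Definition PreCStarAlgebra (R : realType) :=
  {A of StarAlgebra R A & StarAlgebra_hasCStarNorm R A}.

Definition topo (R : realType) (A : preCStarAlgType R) : Type := A.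
HB.instance Definition _ (R : realType) (A : preCStarAlgType R) :=
  GRing.Lmodule.on (topo A).
HB.instance Definition _ (R : realType) (A : preCStarAlgType R) :=
  Lmodule_isNormed.Build R[i] (topo A) (@cnormD R A) (@cnormZ R A)
    (@cnorm0_eq0 R A).

HB.mixin Record PreCStarAlgebra_isComplete (R : realType) A
    of PreCStarAlgebra R A := {
  cstar_complete : forall F : set_system (topo A),
    ProperFilter F -> cauchy F -> cvg F
}.

(* Unital C*-algebras, with 1 != 0. *)
#[short(type="cstarAlgType")]
HB.structure Definition CStarAlgebra (R : realType) :=
  {A of PreCStarAlgebra R A & PreCStarAlgebra_isComplete R A}.

(* Inner products are linear in the first and conjugate-linear in the second
   variable. *)
HB.mixin Record hasInner (R : realType) H of CompleteNormedModule R[i] H := {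
  inner : {dot H for (@Num.conj R[i])};
  inner_normE : forall x : H, `|x| ^+ 2 = inner x x
}.

#[short(type="hilbertType")]
HB.structure Definition Hilbert (R : realType) :=
  {H of CompleteNormedModule R[i] H & hasInner R H}.

Section MatrixStar.
Variables (R : realType) (n : nat).
Local Notation M := 'M[R[i]]_n.+1.

Definition mxstar (A : M) : M := map_mx Num.conj A^T.

Fact mxstarK : involutive mxstar.
Proof. by move=> A; apply/matrixP => i j; rewrite !mxE conjCK. Qed.

Fact mxstarD : {morph mxstar : A B / A + B}.
Proof. by move=> A B; apply/matrixP => i j; rewrite !mxE rmorphD. Qed.

Fact mxstarM (A B : M) : mxstar (A * B) = mxstar B * mxstar A.
Proof.
apply/matrixP => i j; rewrite !mxE rmorph_sum; apply: eq_bigr => k _.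
by rewrite !mxE rmorphM mulrC.
Qed.

Fact mxstarZ (a : R[i]) (A : M) : mxstar (a *: A) = a^* *: mxstar A.
Proof. by apply/matrixP => i j; rewrite !mxE rmorphM. Qed.

HB.instance Definition _ :=
  Algebra_isStarAlgebra.Build R M mxstarK mxstarD mxstarM mxstarZ.
End MatrixStar.

(* The star-algebra of n x n complex matrices for 0 < n: the ring structure on
   matrices requires a size of the form _.+1. *)
Definition Mat (R : realType) (n : nat) : starAlgType R :=
  StarAlgebra.clone R 'M[R[i]]_n.-1.+1 _.

(* C(X) as a star-algebra, for X nonempty: its C*-norm (the sup norm, when X is
   compact) is determined by the star-algebra structure. *)
Section ContinuousFunctions.
Variables (R : realType) (X : ptopologicalType).

Definition Cfun := continuousType X R[i]^o.
Identity Coercion Cfun_continuous : Cfun >-> continuousType.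
HB.instance Definition _ := Choice.on Cfun.

Implicit Types f g h : Cfun.

Let contM f g : continuous (fun x => f x * g x : R[i]^o).
Proof. by move=> x; apply: cvgM; apply: cts_fun. Qed.

Let contD f g : continuous (fun x => f x + g x : R[i]^o).
Proof. by move=> x; apply: cvgD; apply: cts_fun. Qed.

Let contN f : continuous (fun x => - f x : R[i]^o).
Proof. by move=> x; apply: cvgN; apply: cts_fun. Qed.

Let contC (a : R[i]) : continuous (fun _ : X => a : R[i]^o).
Proof. by move=> x; apply: cvg_cst. Qed.

Let contS f : continuous (fun x => (f x)^* : R[i]^o).
Proof.
move=> x; apply/cvgrPdist_lt => e e0.
have /cvgrPdist_lt/(_ e e0) := @cts_fun _ _ f x.
by apply: filterS => y; rewrite -rmorphB norm_conjC.
Qed.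

Definition Cadd f g : Cfun :=
  (mkcts (@contD f g) : continuousType X R[i]^o).
Definition Copp f : Cfun :=
  (mkcts (@contN f) : continuousType X R[i]^o).
Definition Cmul f g : Cfun :=
  (mkcts (@contM f g) : continuousType X R[i]^o).
Definition Ccst a : Cfun :=
  (mkcts (@contC a) : continuousType X R[i]^o).
Definition Cstar_fun f : Cfun :=
  (mkcts (@contS f) : continuousType X R[i]^o).

Fact CaddA : associative Cadd.
Proof. by move=> f g h; apply/continuousEP => x; exact: addrA. Qed.
Fact CaddC : commutative Cadd.
Proof. by move=> f g; apply/continuousEP => x; exact: addrC. Qed.
Fact Cadd0 : left_id (Ccst 0) Cadd.
Proof. by move=> f; apply/continuousEP => x; exact: add0r. Qed.
Fact CaddN : left_inverse (Ccst 0) Copp Cadd.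
Proof. by move=> f; apply/continuousEP => x; exact: addNr. Qed.

HB.instance Definition _ := GRing.isZmodule.Build Cfun CaddA CaddC Cadd0 CaddN.

Fact CmulA : associative Cmul.
Proof. by move=> f g h; apply/continuousEP => x; exact: mulrA. Qed.
Fact CmulC : commutative Cmul.
Proof. by move=> f g; apply/continuousEP => x; exact: mulrC. Qed.
Fact Cmul1 : left_id (Ccst 1) Cmul.
Proof. by move=> f; apply/continuousEP => x; exact: mul1r. Qed.
Fact CmulD : left_distributive Cmul +%R.
Proof. by move=> f g h; apply/continuousEP => x; exact: mulrDl. Qed.
Fact C1_neq0 : Ccst 1 != 0.
Proof.
apply/eqP => /continuousEP/(_ point) /= /eqP.
by rewrite (oner_eq0 R[i]).
Qed.

HB.instance Definition _ :=
  GRing.Zmodule_isComNzRing.Build Cfun CmulA CmulC Cmul1 CmulD C1_neq0.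

Definition Cscale (a : R[i]) f : Cfun := Cmul (Ccst a) f.

Fact CscaleA a b f : Cscale a (Cscale b f) = Cscale (a * b) f.
Proof. by apply/continuousEP => x; exact: mulrA. Qed.
Fact Cscale1 : left_id 1 Cscale.
Proof. by move=> f; apply/continuousEP => x; exact: mul1r. Qed.
Fact CscaleDr : right_distributive Cscale +%R.
Proof. by move=> a f g; apply/continuousEP => x; exact: mulrDr. Qed.
Fact CscaleDl f : {morph Cscale^~ f : a b / a + b}.
Proof. by move=> a b; apply/continuousEP => x; exact: mulrDl. Qed.

HB.instance Definition _ := GRing.Zmodule_isLmodule.Build R[i] Cfun
  CscaleA Cscale1 CscaleDr CscaleDl.

Fact CscaleAl (a : R[i]) (f g : Cfun) : a *: (f * g) = (a *: f) * g.
Proof. by apply/continuousEP => x; exact: mulrA. Qed.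

HB.instance Definition _ := GRing.Lmodule_isLalgebra.Build R[i] Cfun CscaleAl.

Fact CscaleAr (a : R[i]) (f g : Cfun) : a *: (f * g) = f * (a *: g).
Proof. by apply/continuousEP => x; exact: mulrCA. Qed.

HB.instance Definition _ := GRing.Lalgebra_isAlgebra.Build R[i] Cfun CscaleAr.

Fact CstarK : involutive Cstar_fun.
Proof. by move=> f; apply/continuousEP => x; exact: conjCK. Qed.
Fact CstarD : {morph Cstar_fun : f g / f + g}.
Proof. by move=> f g; apply/continuousEP => x; exact: rmorphD. Qed.
Fact CstarM (f g : Cfun) : Cstar_fun (f * g) = Cstar_fun g * Cstar_fun f.
Proof.
apply/continuousEP => x; rewrite [in RHS]mulrC; exact: rmorphM.
Qed.
Fact CstarZ (a : R[i]) (f : Cfun) : Cstar_fun (a *: f) = a^* *: Cstar_fun f.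
Proof. by apply/continuousEP => x; exact: rmorphM. Qed.

HB.instance Definition _ :=
  Algebra_isStarAlgebra.Build R Cfun CstarK CstarD CstarM CstarZ.
End ContinuousFunctions.

Record star_hom (R : realType) (A B : starAlgType R) (f : A -> B) : Prop := {
  star_hom_linear : forall (a : R[i]) x y, f (a *: x + y) = a *: f x + f y;
  star_hom_mul : forall x y, f (x * y) = f x * f y;
  star_hom_one : f 1 = 1;
  star_hom_star : forall x, f (star x) = star (f x)
}.

(* A bijective star-homomorphism of C*-algebras is automatically isometric. *)
Definition star_iso (R : realType) (A B : starAlgType R) (f : A -> B) : Prop :=
  star_hom f /\ bijective f.

Definition bounded_op (R : realType) (H : hilbertType R) (T : H -> H) : Prop :=
  linear T /\ continuous T.

Definition adjoint_op (R : realType) (H : hilbertType R) (S T : H -> H) : Prop :=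
  forall x y, inner (S x) y = inner x (T y).

Definition unitary_op (R : realType) (H : hilbertType R) (U : H -> H) : Prop :=
  bounded_op U /\
  exists V, [/\ bounded_op V, adjoint_op U V, cancel U V & cancel V U].

Record representation (R : realType) (A : cstarAlgType R) (H : hilbertType R)
    (pi : A -> H -> H) : Prop := {
  rep_bounded : forall x, bounded_op (pi x);
  rep_linear : forall (a : R[i]) x y h, pi (a *: x + y) h = a *: pi x h + pi y h;
  rep_mul : forall x y h, pi (x * y) h = pi x (pi y h);
  rep_star : forall x, adjoint_op (pi x) (pi (star x))
}.

Definition closed_star_subalgebra (R : realType) (A : cstarAlgType R)
    (S : set A) : Prop :=
  [/\ closed (S : set (topo A)), S 1,
      forall (a : R[i]) x y, S x -> S y -> S (a *: x + y),
      forall x y, S x -> S y -> S (x * y) &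
      forall x, S x -> S (star x)].

Definition generated (R : realType) (A : cstarAlgType R) (G : set A) : set A :=
  [set x | forall S, closed_star_subalgebra S -> G `<=` S -> S x].

Section GeneratedCStar.
Variables (R : realType) (E : cstarAlgType R) (G : set E).

Lemma generated_closed_star_subalgebra : closed_star_subalgebra (generated G).
Proof.
split.
- have -> : generated G =
      \bigcap_(S in [set S | closed_star_subalgebra S /\ G `<=` S]) S.
    apply/seteqP; split=> [x Gx S [] /Gx/[apply]//|x Gx S cS GS].
    exact: (Gx S).
  by apply: closed_bigI => S [[]].
- by move=> S [].
- move=> a x y Gx Gy S cS GS; have [_ _ lS _ _] := cS.
  by apply: lS; [exact: Gx|exact: Gy].
- move=> x y Gx Gy S cS GS; have [_ _ _ mS _] := cS.
  by apply: mS; [exact: Gx|exact: Gy].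
- move=> x Gx S cS GS; have [_ _ _ _ sS] := cS.
  by apply: sS; exact: Gx.
Qed.

Lemma sub_generated : G `<=` generated G.
Proof. by move=> x Gx S _; exact. Qed.

Definition generated_pred : {pred E} := fun x => `[< generated G x >].

Fact generated_predP x : reflect (generated G x) (x \in generated_pred).
Proof. exact: asboolP. Qed.

Fact generated_subalg_closed : GRing.subsemialg_closed generated_pred.
Proof.
have [_ g1 gl gm _] := generated_closed_star_subalgebra.
have g0 : generated G 0 by rewrite -[0](addNr 1) -scaleN1r; exact: gl.
split.
- exact/generated_predP.
- split=> [|x y /generated_predP Gx /generated_predP Gy].
    exact/generated_predP.
  by apply/generated_predP; rewrite -[x]scale1r; exact: gl.
- move=> a x /generated_predP Gx; apply/generated_predP.
  by rewrite -[_ *: _]addr0; exact: gl.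
- move=> x y /generated_predP Gx /generated_predP Gy; apply/generated_predP.
  exact: gm.
Qed.

Fact generated_oppr_closed : GRing.oppr_closed generated_pred.
Proof.
have [_ _ sZ _] := generated_subalg_closed.
by move=> x Gx; rewrite -scaleN1r; exact: sZ.
Qed.

HB.instance Definition _ :=
  GRing.isSubalgClosed.Build R[i] E generated_pred generated_subalg_closed.
HB.instance Definition _ :=
  GRing.isOppClosed.Build E generated_pred generated_oppr_closed.

Record Cstar : Type := MkCstar {Cstar_val : E; _ : Cstar_val \in generated_pred}.

HB.instance Definition _ := [isSub for Cstar_val].
HB.instance Definition _ := [Choice of Cstar by <:].
HB.instance Definition _ := [SubChoice_isSubZmodule of Cstar by <:].
HB.instance Definition _ := [SubZmodule_isSubNzRing of Cstar by <:].
HB.instance Definition _ := [SubZmodule_isSubLmodule of Cstar by <:].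
HB.instance Definition _ := [SubNzRing_SubLmodule_isSubLalgebra of Cstar by <:].
HB.instance Definition _ := [SubLalgebra_isSubAlgebra of Cstar by <:].

Lemma Cstar_valP (x : Cstar) : generated G (Cstar_val x).
Proof. exact/generated_predP/(valP x). Qed.

Lemma Cstar_val_inj : injective Cstar_val.
Proof. exact: val_inj. Qed.

Fact generated_star (x : Cstar) : star (Cstar_val x) \in generated_pred.
Proof.
have [_ _ _ _ gs] := generated_closed_star_subalgebra.
by apply/generated_predP; apply: gs; exact: Cstar_valP.
Qed.

Definition Cstar_star (x : Cstar) : Cstar := MkCstar (generated_star x).

Fact Cstar_starK : involutive Cstar_star.
Proof. by move=> x; apply: Cstar_val_inj; exact: starK. Qed.
Fact Cstar_starD : {morph Cstar_star : x y / x + y}.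
Proof. by move=> x y; apply: Cstar_val_inj; exact: starD. Qed.
Fact Cstar_starM x y : Cstar_star (x * y) = Cstar_star y * Cstar_star x.
Proof. by apply: Cstar_val_inj; exact: starM. Qed.
Fact Cstar_starZ (a : R[i]) x : Cstar_star (a *: x) = a^* *: Cstar_star x.
Proof. by apply: Cstar_val_inj; exact: starZ. Qed.

HB.instance Definition _ := Algebra_isStarAlgebra.Build R Cstar
  Cstar_starK Cstar_starD Cstar_starM Cstar_starZ.

Definition Cstar_norm (x : Cstar) : R[i] := cnorm (Cstar_val x).

Fact Cstar_normD x y : Cstar_norm (x + y) <= Cstar_norm x + Cstar_norm y.
Proof. exact: cnormD. Qed.
Fact Cstar_normZ (a : R[i]) x : Cstar_norm (a *: x) = `|a| * Cstar_norm x.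
Proof. exact: cnormZ. Qed.
Fact Cstar_norm0_eq0 x : Cstar_norm x = 0 -> x = 0.
Proof. by move=> /cnorm0_eq0 x0; apply: Cstar_val_inj. Qed.
Fact Cstar_normM x y : Cstar_norm (x * y) <= Cstar_norm x * Cstar_norm y.
Proof. exact: cnormM. Qed.
Fact Cstar_norm_star x : Cstar_norm (star x * x) = Cstar_norm x ^+ 2.
Proof. exact: cnorm_star. Qed.

HB.instance Definition _ := StarAlgebra_hasCStarNorm.Build R Cstar
  Cstar_normD Cstar_normZ Cstar_norm0_eq0 Cstar_normM Cstar_norm_star.

Fact Cstar_complete (F : set_system (topo Cstar)) :
  ProperFilter F -> cauchy F -> cvg F.
Proof.
move=> FF /cauchy_ballP Fc.
pose F' : set_system (topo E) := Cstar_val @ F.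
have F'F : ProperFilter F' by exact: fmap_proper_filter.
have /(@cstar_complete R E F' F'F) /cvg_ex [l F'l] : cauchy F'.
  apply/cauchy_ballP => e e0; have [[A B] /= [FA FB] AB] := Fc e e0.
  exists (Cstar_val @` A, Cstar_val @` B) => /=.
    by split; [apply: filterS FA|apply: filterS FB] => x Ax; exists x.
  by move=> [_ _] /= [[x Ax <-] [y By <-]]; exact: (AB (x, y)).
have Gl : generated G l.
  have [cG _ _ _ _] := generated_closed_star_subalgebra.
  apply: (@closed_cvg (topo Cstar) (topo E) F FF Cstar_val (generated G) cG _ l) => //.
  by apply: filterE => x; exact: Cstar_valP.
apply/cvg_ex; exists (MkCstar (introT (generated_predP l) Gl)).
apply/cvgrPdist_lt => e e0.
by move/cvgrPdist_lt : F'l => /(_ e e0).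
Qed.

HB.instance Definition _ :=
  PreCStarAlgebra_isComplete.Build R Cstar Cstar_complete.
End GeneratedCStar.

Definition lin_indep (F : fieldType) (V : lmodType F) (I : finType)
    (v : I -> V) : Prop :=
  forall a : I -> F, \sum_i a i *: v i = 0 -> forall i, a i = 0.

Definition lin_span (F : fieldType) (V : lmodType F) (S : set V) : set V :=
  [set x | exists n (a : 'I_n -> F) (v : 'I_n -> V),
     (forall i, S (v i)) /\ x = \sum_i a i *: v i].

Definition closed_span (R : realType) (A : cstarAlgType R) (S : set A) : set A :=
  closure (lin_span S : set (topo A)).

(* T is a C*-algebraic tensor product of A and B, with a (x) b = i1 a * i2 b:
   [tensor_inj] says that the algebraic tensor product of A and B embeds in T,
   so that T is its completion for a C*-norm.  When A or B is nuclear, in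
   particular commutative, there is only one such norm. *)
Record is_tensor (R : realType) (A B : starAlgType R) (T : cstarAlgType R)
    (i1 : A -> T) (i2 : B -> T) : Prop := {
  tensor_homl : star_hom i1;
  tensor_homr : star_hom i2;
  tensor_comm : forall a b, i1 a * i2 b = i2 b * i1 a;
  tensor_inj : forall (I J : finType) (a : I -> A) (b : J -> B),
    lin_indep a -> lin_indep b ->
    lin_indep (fun ij : I * J => i1 (a ij.1) * i2 (b ij.2));
  tensor_dense :
    closed_span [set t | exists a b, t = i1 a * i2 b] = [set: T]
}.

(* T is the C*-algebraic infinite tensor product of copies of the algebra M,
   the k-th copy being embedded by j k; again, the C*-norm is unique for the
   matrix algebras considered here. *)
Record is_infinite_tensor (R : realType) (M : starAlgType R)
    (T : cstarAlgType R) (j : nat -> M -> T) : Prop := {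
  inftensor_hom : forall k, star_hom (j k);
  inftensor_comm : forall k l, k <> l -> forall a b, j k a * j l b = j l b * j k a;
  inftensor_inj : forall (n : nat) (I : finType) (a : 'I_n -> I -> M),
    (forall k, lin_indep (a k)) ->
    lin_indep (fun f : {ffun 'I_n -> I} => \prod_(k < n) j k (a k (f k)));
  inftensor_dense :
    closed_span [set t | exists n (a : 'I_n -> M), t = \prod_(k < n) j k (a k)]
      = [set: T]
}.

Definition uhf_type (R : realType) (p : nat) (B : cstarAlgType R) : Prop :=
  exists j : nat -> Mat R p -> B, is_infinite_tensor j.

Definition cstar_center (R : realType) (A : cstarAlgType R) : set A :=
  [set x | forall y, x * y = y * x].
Arguments cstar_center {R} A _.

Definition trivial_center (R : realType) (A : cstarAlgType R) : Prop :=
  cstar_center A = [set a *: 1 | a in [set: R[i]]].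

Definition closed_ideal (R : realType) (A : cstarAlgType R) (J : set A) : Prop :=
  [/\ closed (J : set (topo A)), J 0,
      forall (a : R[i]) x y, J x -> J y -> J (a *: x + y) &
      forall x y, J x -> J (y * x) /\ J (x * y)].

Definition simple_cstar (R : realType) (A : cstarAlgType R) : Prop :=
  forall J : set A, closed_ideal J -> J = [set 0] \/ J = [set: A].

(* Finitely supported sequences in Z_p, represented by polynomials: the k-th
   term (k >= 0) of x is the coefficient x`_k; only the vector space structure
   of polynomials is used.  Indices start at 0 instead of 1 throughout. *)
Definition Gamma (p : nat) : lmodType 'F_p :=
  GRing.Lmodule.clone 'F_p {poly 'F_p} _.

Definition skew_symmetric (p : nat) (c : nat -> nat -> 'F_p) : Prop :=
  forall i j, c i j = - c j i /\ c i i = 0.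

Definition omega (p : nat) (c : nat -> nat -> 'F_p) (x y : {poly 'F_p}) : 'F_p :=
  \sum_(i < size y) \sum_(j < size x) c i j * x`_j * y`_i.

Definition ker_omega (p : nat) (c : nat -> nat -> 'F_p) : set (Gamma p) :=
  [set x | forall y, omega c x y = 0].

Definition symplectic (p : nat) (c : nat -> nat -> 'F_p) : Prop :=
  ker_omega c = [set 0].

(* dim (V / W) = n: the classes of b_0, ..., b_(n-1) form a basis of V / W. *)
Definition quotient_dim (F : fieldType) (V : lmodType F) (W : set V) (n : nat)
    : Prop :=
  exists b : 'I_n -> V,
    (forall a : 'I_n -> F, W (\sum_i a i *: b i) -> forall i, a i = 0) /\
    (forall x, exists a : 'I_n -> F, W (x - \sum_i a i *: b i)).

(* The rank of omega is 2r, where r = None stands for infinity. *)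
Definition half_rank (p : nat) (c : nat -> nat -> 'F_p) (r : option nat) : Prop :=
  match r with
  | Some m => quotient_dim (ker_omega c) (2 * m)%N
  | None => forall n, ~ quotient_dim (ker_omega c) n
  end.

(* exp (2 pi i / p) *)
Definition zeta (R : realType) (p : nat) : R[i] :=
  Complex (cos (2 * pi / p%:R)) (sin (2 * pi / p%:R)).

Definition word (R : realType) (p : nat) (A : starAlgType R) (u : nat -> A)
    (x : {poly 'F_p}) : A :=
  \prod_(k < size x) u k ^+ nat_of_ord (x`_k).

Section Universal.
Variables (R : realType) (p : nat) (c : nat -> nat -> 'F_p).

Definition relations (E : starAlgType R) (u : nat -> E) : Prop :=
  [/\ forall k, star (u k) * u k = 1 /\ u k * star (u k) = 1,
      forall k, u k ^+ p = 1 &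
      forall i j, u i * u j = zeta R p ^+ nat_of_ord (c i j) *: (u j * u i)].

Definition op_relations (H : hilbertType R) (U : nat -> H -> H) : Prop :=
  [/\ forall k, unitary_op (U k),
      forall k h, iter p (U k) h = h &
      forall i j h,
        U i (U j h) = zeta R p ^+ nat_of_ord (c i j) *: U j (U i h)].

Variable E : cstarAlgType R.

Definition cstar_seq (u : nat -> E) : cstarAlgType R :=
  CStarAlgebra.clone R (Cstar (range u)) _.

Definition generator (u : nat -> E) (k : nat) : cstar_seq u :=
  MkCstar (introT (generated_predP _ _)
    (sub_generated (imageT u k))).

Definition universal (u : nat -> E) : Prop :=
  relations u /\
  forall (H : hilbertType R) (U : nat -> H -> H), op_relations U ->
    exists pi : cstar_seq u -> H -> H,
      representation pi /\ forall k h, pi (generator u k) h = U k h.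
End Universal.

(* Main.v *)
(* Conjugation by the word [w_y] multiplies [w_x] by the root of unity with
   exponent [omega x y], so averaging over the powers of [w_y] is a contraction
   which fixes [w_x] if [omega x y = 0] and kills it otherwise.  Applied to the
   generators, such averages push finite sums of words into the span of the
   words of [ker omega] while fixing every central element, which computes the
   center.  Let (e_k, f_k) be a symplectic basis of a complement of [ker omega].
   Averaging over all the pairs (e_k, f_k) yields the trace of the subalgebra B
   generated by the words of that complement; averaging only over the pairs with
   k >= N yields the conditional expectation onto the span of the finitely many
   words of the first N pairs.  An element of B all of whose coefficients
   trace(b w_x) vanish is therefore 0.  This gives the simplicity of the algebra
   in the symplectic case (an ideal contains all these coefficients) and the
   injectivity of C(X) (x) B -> A.  Each pair (e_k, f_k) spans a copy of the
   p x p matrices, the spectral projections of w_{f_k} being permuted by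
   w_{e_k}, and these copies commute.  The center is generated by commuting
   unitaries of order p, hence is C(X) for X the set of the sequences of p-th
   roots of unity all of whose finite prefixes have a nonzero joint spectral
   projection.  Universality enters only to show that [w_x] is not a scalar for
   x <> 0 in [ker omega]: on l^2(Gamma) the relations are realized by weighted
   shifts, and multiplying the shifts by p-th roots of unity changes the value of
   [w_x]. *)

Require Import Defs.
From HB Require Import structures.
From mathcomp Require Import all_boot all_order all_algebra.
From mathcomp Require Import complex.
From mathcomp Require Import all_classical all_reals all_analysis.
From mathcomp Require Import ring lra zify.

Set Implicit Arguments.
Unset Strict Implicit.
Unset Printing Implicit Defensive.

Import Order.TTheory GRing.Theory Num.Theory.
Import numFieldNormedType.Exports.

Local Open Scope classical_set_scope.
Local Open Scope ring_scope.

Import Normc.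

(** The obstacle is that an element of the closure has no convergent expansion in words: the norm is
    not controlled by the coefficients. Averages restore control because the words over the first N
    pairs are finitely many, [F_p] being finite. A first approximation by a finite sum fixes N; a
    second one is then chosen finer by a factor exceeding the number of words over these N pairs, so
    that small coefficients give a small compression. The trace is only a limit of averages and is
    never built as a state. A second difficulty is that the p-th power of a word is only a
    unimodular scalar, -1 being possible for p = 2; words serving as clocks, shifts or central
    unitaries are therefore rescaled by a p-th root. No spectral theory is presupposed: spectral
    projections are finite Fourier sums, and the norm of a combination of orthogonal projections is
    obtained from high powers. The tensor product is found inside A, where the commuting subalgebras
    C(X) and B are shown to be linearly disjoint. *)

(** * Norms and limits *)

Section Modulus.
Variable R : realType.
Implicit Types x y : R[i].

Lemma normr_normc x : `|x| = (normc x)%:C%C. Proof. by []. Qed.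

Lemma normc_ge0 x : 0 <= normc x.
Proof. by rewrite -ler0c -normr_normc. Qed.

Lemma normcB x y : normc (x - y) = normc (y - x).
Proof. by rewrite -normcN opprB. Qed.

Lemma normc_conj x : normc x^* = normc x.
Proof. by apply: complexI; rewrite -!normr_normc norm_conjC. Qed.

Lemma conj_unit x : normc x = 1 -> x^* * x = 1.
Proof. by move=> x1; rewrite mulrC -normCK normr_normc x1 expr1n. Qed.

Lemma normcX x n : normc (x ^+ n) = normc x ^+ n.
Proof.
elim: n => [|n IH]; first by rewrite !expr0 normc1.
by rewrite !exprS normcM IH.
Qed.

Lemma normc_real (t : R) : 0 <= t -> normc t%:C%C = t.
Proof. by move=> t0; apply: complexI; rewrite -normr_normc ger0_norm // ler0c. Qed.

Lemma normc_real_nat n : normc (n%:R : R[i]) = n%:R.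
Proof. by rewrite -(rmorph_nat (real_complex R)) normc_real // ler0n. Qed.

Lemma normc_sum (I : Type) (s : seq I) (P : pred I) (F : I -> R[i]) :
  normc (\sum_(i <- s | P i) F i) <= \sum_(i <- s | P i) normc (F i).
Proof.
elim/big_rec2: _ => [|i y x _ IH]; first by rewrite normc0.
by apply: le_trans (le_normcD _ _) _; rewrite lerD2l.
Qed.

Lemma normc_Re x : `|complex.Re x| <= normc x.
Proof. by rewrite -lecR -normr_normc; exact: normc_ge_Re. Qed.

Lemma normc_Im x : `|complex.Im x| <= normc x.
Proof.
have := normc_Re (x * 'i%C); rewrite ReiNIm normrN normcM.
suff -> : normc ('i%C : R[i]) = 1 by rewrite mulr1.
by rewrite /= expr0n expr1n add0r sqrtr1.
Qed.

Lemma normc_ReIm x : normc x <= `|complex.Re x| + `|complex.Im x|.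
Proof.
have {1}-> : x = (complex.Re x)%:C%C + ('i%C * (complex.Im x)%:C%C).
  exact: complexE.
apply: le_trans (le_normcD _ _) _; rewrite normcM.
have -> : normc ('i%C : R[i]) = 1 by rewrite /= expr0n expr1n add0r sqrtr1.
rewrite mul1r lerD // -lecR -normr_normc.
  by rewrite normc_def /= expr0n addr0 sqrtr_sqr.
by rewrite normc_def /= expr0n addr0 sqrtr_sqr.
Qed.

End Modulus.

Section Norm.
Variables (R : realType) (A : preCStarAlgType R).
Implicit Types (a b : A) (t : R[i]).

(** The abstract norm lies in [R[i]], whose order is only partial. Being nonnegative it equals its
    real part, so that estimates can be carried out in the ordered field [R]. *)
Definition nm a : R := complex.Re (cnorm a).

Lemma cnormE a : cnorm a = (nm a)%:C%C.
Proof.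
have : 0 <= cnorm a := normr_ge0 (a : topo A).
rewrite /nm; case: (cnorm a) => x y; rewrite lecE /= => /andP[/eqP -> _] //.
Qed.

Lemma topo_normE a : `|a : topo A| = (nm a)%:C%C.
Proof. exact: cnormE. Qed.

Lemma nm_ge0 a : 0 <= nm a.
Proof. by rewrite -ler0c -cnormE; exact: normr_ge0 (a : topo A). Qed.

Lemma nmD a b : nm (a + b) <= nm a + nm b.
Proof. by rewrite -lecR rmorphD /= -!cnormE; exact: cnormD. Qed.

Lemma nmZ t a : nm (t *: a) = normc t * nm a.
Proof. by apply: complexI; rewrite rmorphM /= -!cnormE cnormZ. Qed.

Lemma nmN a : nm (- a) = nm a.
Proof. by rewrite -scaleN1r nmZ normcN normc1 mul1r. Qed.

Lemma nmB a b : nm (a - b) = nm (b - a).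
Proof. by rewrite -nmN opprB. Qed.

Lemma nm0 : nm (0 : A) = 0.
Proof. by rewrite -(scale0r (0 : A)) nmZ normc0 mul0r. Qed.

Lemma nm_eq0 a : nm a = 0 -> a = 0.
Proof. by move=> a0; apply: cnorm0_eq0; rewrite cnormE a0. Qed.

Lemma nm_eps a : (forall e, 0 < e -> nm a <= e) -> a = 0.
Proof.
move=> h; apply: nm_eq0; apply/eqP; rewrite eq_le nm_ge0 andbT.
by apply/ler_addgt0Pr => e e0; rewrite add0r; exact: h.
Qed.

Lemma nm_triangle b a c : nm (a - c) <= nm (a - b) + nm (b - c).
Proof. by have := nmD (a - b) (b - c); rewrite addrA subrK. Qed.

Lemma nmM a b : nm (a * b) <= nm a * nm b.
Proof. by rewrite -lecR rmorphM /= -!cnormE; exact: cnormM. Qed.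

Lemma nm_star_mul a : nm (star a * a) = nm a ^+ 2.
Proof. by apply: complexI; rewrite rmorphXn /= -!cnormE cnorm_star. Qed.

Lemma nm_sum (I : Type) (s : seq I) (P : pred I) (F : I -> A) :
  nm (\sum_(i <- s | P i) F i) <= \sum_(i <- s | P i) nm (F i).
Proof.
elim/big_rec2: _ => [|i y x _ IH]; first by rewrite nm0.
by apply: le_trans (nmD _ _) _; rewrite lerD2l.
Qed.

Lemma star1 : star (1 : A) = 1.
Proof. by rewrite -[LHS]mul1r -{1}(starK 1) -starM mul1r starK. Qed.

Lemma star0 : star (0 : A) = 0.
Proof. by rewrite -(scale0r (0 : A)) starZ rmorph0 !scale0r. Qed.

Lemma starN a : star (- a) = - star a.
Proof. by rewrite -scaleN1r starZ rmorphN rmorph1 scaleN1r. Qed.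

Lemma star_sum (I : Type) (s : seq I) (P : pred I) (F : I -> A) :
  star (\sum_(i <- s | P i) F i) = \sum_(i <- s | P i) star (F i).
Proof. by elim/big_rec2: _ => [|i y x _ IH]; rewrite ?star0 // starD IH. Qed.

Lemma nm1 : nm (1 : A) = 1.
Proof.
have n0 : nm (1 : A) != 0.
  by apply/eqP => /nm_eq0 /eqP; rewrite oner_eq0.
apply: (mulfI n0); rewrite mulr1 -expr2 -nm_star_mul.
by rewrite star1 mulr1.
Qed.

(** In [nm b ^+ 2 = nm (star b * b) <= nm (star b) * nm b] one factor cancels; this is applied to
    [a] and to [star a]. *)
Lemma nm_star a : nm (star a) = nm a.
Proof.
suff le b : nm b <= nm (star b).
  by apply/eqP; rewrite eq_le le andbT -{2}(starK a) le.
have [b0|b0] := eqVneq (nm b) 0; first by rewrite b0 nm_ge0.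
have bp : 0 < nm b by rewrite lt_neqAle eq_sym b0 nm_ge0.
by rewrite -(ler_pM2r bp) -expr2 -nm_star_mul nmM.
Qed.

Definition unitary_elt a := star a * a = 1 /\ a * star a = 1.

Lemma nm_unitary a : unitary_elt a -> nm a = 1.
Proof.
move=> [h _]; have := nm_star_mul a; rewrite h nm1 => /esym/eqP.
rewrite sqrf_eq1 => /orP[/eqP //|/eqP h']; have := nm_ge0 a.
by rewrite h' lerNr oppr0 ler10.
Qed.

Lemma unitary1 : unitary_elt 1.
Proof. by split; rewrite star1 mulr1. Qed.

Lemma unitaryM a b : unitary_elt a -> unitary_elt b -> unitary_elt (a * b).
Proof.
move=> [a1 a2] [b1 b2]; split; rewrite starM.
  by rewrite mulrA -(mulrA _ _ a) a1 mulr1.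
by rewrite mulrA -(mulrA a) b2 mulr1.
Qed.

Lemma unitaryX a n : unitary_elt a -> unitary_elt (a ^+ n).
Proof.
move=> ua; elim: n => [|n IH]; first by rewrite expr0; exact: unitary1.
by rewrite exprS; exact: unitaryM.
Qed.

Lemma unitaryZ t a : normc t = 1 -> unitary_elt a -> unitary_elt (t *: a).
Proof.
move=> t1 [a1 a2]; rewrite /unitary_elt starZ -!scalerAl -!scalerAr !scalerA.
by rewrite a1 a2 (mulrC t) conj_unit // scale1r.
Qed.

Lemma unitary_neq0 a : unitary_elt a -> a != 0.
Proof.
by move=> [h _]; apply/eqP => a0; move: h; rewrite a0 mulr0 => /esym/eqP; rewrite oner_eq0.
Qed.

Lemma nm_scalar t : nm (t *: (1 : A)) = normc t.
Proof. by rewrite nmZ nm1 mulr1. Qed.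

Lemma ltc_real (t e : R[i]) : 0 < e -> (`|t| < e) = (normc t < complex.Re e).
Proof.
by rewrite normr_normc !ltcE /= => /andP[/eqP -> _]; rewrite eqxx.
Qed.

Lemma closureP (S : set A) a :
  closure (S : set (topo A)) a <->
  forall e : R, 0 < e -> exists2 v, S v & nm (a - v) < e.
Proof.
split=> [cl e e0|h B].
  have e0' : 0 < e%:C%C :> R[i] by rewrite ltcR.
  have [v [Sv]] := cl _ (nbhsx_ballx (a : topo A) _ e0').
  rewrite -ball_normE /= => va; exists v => //.
  by move: va; rewrite topo_normE ltcR.
move=> /nbhs_ballP [e /= e0 sB].
have e0' : 0 < complex.Re e by move: e0; rewrite ltcE => /andP[].
have [v Sv va] := h _ e0'; exists v; split => //; apply: sB.
rewrite -ball_normE /=; move: e0 va; rewrite topo_normE.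
by rewrite !ltcE /= => /andP[/eqP -> _]; rewrite eqxx.
Qed.

(** The norm topology is metric, so sequences determine closures and closed sets ([closure_nlim],
    [closedP]); filters are met again only for completeness. *)
Definition nlim (f : nat -> A) a :=
  forall e : R, 0 < e -> exists N, forall n, (N <= n)%N -> nm (f n - a) < e.

Lemma nlim_cst a : nlim (fun=> a) a.
Proof. by move=> e e0; exists 0%N => n _; rewrite subrr nm0. Qed.

Lemma nlim_near f g a :
  (exists N, forall n, (N <= n)%N -> f n = g n) -> nlim f a -> nlim g a.
Proof.
move=> [N1 fg] fa e /fa[N2 h]; exists (maxn N1 N2) => n; rewrite geq_max => /andP[n1 n2].
by rewrite -fg // h.
Qed.

Lemma nlim_unique f a b : nlim f a -> nlim f b -> a = b.
Proof.
move=> fa fb; apply/eqP; rewrite -subr_eq0; apply/eqP/nm_eps => e e0.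
have e2 : 0 < e / 2 by rewrite divr_gt0.
have [N1 h1] := fa _ e2; have [N2 h2] := fb _ e2.
have := h1 _ (leq_maxl N1 N2); have := h2 _ (leq_maxr N1 N2).
have := nm_triangle (f (maxn N1 N2)) a b; rewrite (nmB a (f _)); lra.
Qed.

Lemma nlimD f g a b : nlim f a -> nlim g b -> nlim (fun n => f n + g n) (a + b).
Proof.
move=> fa fb e e0; have e2 : 0 < e / 2 by rewrite divr_gt0.
have [N1 h1] := fa _ e2; have [N2 h2] := fb _ e2.
exists (maxn N1 N2) => n; rewrite geq_max => /andP[/h1 l1 /h2 l2].
rewrite opprD addrACA; apply: le_lt_trans (nmD _ _) _; lra.
Qed.

(** Only the Lipschitz bound matters, so that the conjugate-linear [star] is covered as well. *)
Lemma nlim_lin (h : A -> A) (M : R) f a :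
  (forall x y, nm (h x - h y) <= M * nm (x - y)) ->
  nlim f a -> nlim (h \o f) (h a).
Proof.
move=> hM fa e e0.
have M0 : 0 < `|M| + 1 by rewrite ltr_wpDl.
have [N hN] := fa _ (divr_gt0 e0 M0); exists N => n /hN /=.
rewrite ltr_pdivlMr // mulrC; apply: le_lt_trans; apply: le_trans (hM _ _) _.
by apply: ler_wpM2r; [exact: nm_ge0|rewrite ler_wpDr // ler_norm].
Qed.

Lemma nlimZ t f a : nlim f a -> nlim (fun n => t *: f n) (t *: a).
Proof.
by apply: (@nlim_lin (fun x => t *: x) (normc t)) => x y; rewrite -scalerBr nmZ.
Qed.

Lemma nlimMl b f a : nlim f a -> nlim (fun n => b * f n) (b * a).
Proof.
by apply: (@nlim_lin (fun x => b * x) (nm b)) => x y; rewrite -mulrBr nmM.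
Qed.

Lemma nlimMr b f a : nlim f a -> nlim (fun n => f n * b) (a * b).
Proof.
by apply: (@nlim_lin (fun x => x * b) (nm b)) => x y; rewrite -mulrBl mulrC nmM.
Qed.

Lemma nlim_star f a : nlim f a -> nlim (fun n => star (f n)) (star a).
Proof.
by apply: (@nlim_lin star 1) => x y; rewrite -starN -starD nm_star mul1r.
Qed.

Lemma nlim_bounded f a : nlim f a -> exists M, forall n, nm (f n) <= M.
Proof.
move=> /(_ 1 ltr01) [N h].
exists (\sum_(i < N) nm (f i) + (1 + nm a)) => n; case: (ltnP n N) => [nN|/h nN].
  rewrite (bigD1 (Ordinal nN)) //= -addrA lerDl addr_ge0 //.
    by rewrite sumr_ge0 // => i _; exact: nm_ge0.
  by rewrite addr_ge0 // nm_ge0.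
rewrite ler_wpDl //; first by rewrite sumr_ge0 // => i _; exact: nm_ge0.
by have := nmD (f n - a) a; rewrite subrK; lra.
Qed.

Lemma nlimM f g a b : nlim f a -> nlim g b -> nlim (fun n => f n * g n) (a * b).
Proof.
move=> fa gb; have [M hM] := nlim_bounded fa.
have M0 : 0 < M + 1 by rewrite ltr_wpDl // (le_trans (nm_ge0 _) (hM 0%N)).
suff h : nlim (fun n => f n * (g n - b)) 0.
  have := nlimD h (nlimMr b fa); rewrite add0r; apply: nlim_near.
  by exists 0%N => n _; rewrite mulrBr subrK.
move=> e e0; have [N hN] := gb _ (divr_gt0 e0 M0); exists N => n /hN.
rewrite subr0 ltr_pdivlMr // mulrC; apply: le_lt_trans.
apply: le_trans (nmM _ _) _; apply: ler_wpM2r; first exact: nm_ge0.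
by apply: le_trans (hM n) _; rewrite lerDl.
Qed.

Lemma nlim_sum (I : Type) (s : seq I) (f : I -> nat -> A) (a : I -> A) :
  (forall i, nlim (f i) (a i)) ->
  nlim (fun n => \sum_(i <- s) f i n) (\sum_(i <- s) a i).
Proof.
move=> h; elim: s => [|i s IH].
  by apply: nlim_near (nlim_cst _); exists 0%N => n _; rewrite !big_nil.
rewrite big_cons; apply: nlim_near (nlimD (h i) IH).
by exists 0%N => n _; rewrite big_cons.
Qed.

Lemma nlim_nm_le f a M : nlim f a -> (forall n, nm (f n) <= M) -> nm a <= M.
Proof.
move=> fa hM; apply/ler_addgt0Pr => e /fa [N /(_ N (leqnn _)) h].
have := nmD (a - f N) (f N); have := hM N; rewrite subrK nmB in h *; lra.
Qed.

Lemma closed_nlim (S : set A) f a :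
  closed (S : set (topo A)) -> (forall n, S (f n)) -> nlim f a -> S a.
Proof.
move=> cS Sf fa; apply: cS; apply/closureP => e /fa [N /(_ N (leqnn _)) h].
by exists (f N); rewrite // nmB.
Qed.

Lemma closure_nlim (S : set A) a :
  closure (S : set (topo A)) a -> exists2 f, forall n, S (f n) & nlim f a.
Proof.
move=> /closureP h.
have /choice [f fP] n : exists v, S v /\ nm (a - v) < n.+1%:R^-1.
  have n0 : 0 < n.+1%:R^-1 :> R by rewrite invr_gt0 ltr0Sn.
  by have [v Sv va] := h _ n0; exists v.
exists f => [n|e e0]; first by have [] := fP n.
have [N _ hN] := near_infty_natSinv_lt (PosNum e0).
exists N => n Nn; rewrite nmB; have [_ /lt_trans] := fP n; apply.
exact: hN.
Qed.

Lemma closedP (S : set A) :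
  (forall f a, (forall n, S (f n)) -> nlim f a -> S a) ->
  closed (S : set (topo A)).
Proof. by move=> h a /closure_nlim [f Sf fa]; exact: h fa. Qed.

End Norm.

Section Complete.
Variables (R : realType) (A : cstarAlgType R).

Lemma nlim_complete (f : nat -> A) :
  (forall e : R, 0 < e -> exists N, forall m n, (N <= m)%N -> (N <= n)%N ->
     nm (f m - f n) < e) ->
  exists a, nlim f a.
Proof.
move=> h; pose F : set_system (topo A) := (f : nat -> topo A) @ \oo.
have FF : ProperFilter F by exact: fmap_proper_filter.
have Fc : cauchy F.
  apply/cauchy_ballP => e e0.
  have e0' : 0 < complex.Re e by move: e0; rewrite ltcE => /andP[].
  have [N hN] := h _ e0'.
  exists (f @` [set n | (N <= n)%N], f @` [set n | (N <= n)%N]) => /=.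
    by split; exists N => // n /= Nn; exists n.
  move=> [_ _] /= [[m Nm <-] [n Nn <-]].
  rewrite -ball_normE /=; move: e0 (hN _ _ Nm Nn); rewrite topo_normE.
  by rewrite !ltcE /= => /andP[/eqP -> _]; rewrite eqxx.
have /cvg_ex [l /cvgrPdist_lt Fl] := @cstar_complete R A F FF Fc.
exists l => e e0; have e0' : 0 < e%:C%C :> R[i] by rewrite ltcR.
have [N _ hN] := Fl _ e0'; exists N => n /hN /=.
by rewrite topo_normE ltcR nmB.
Qed.

End Complete.

Section ComplexComplete.
Variable R : realType.

Lemma real_cauchy (f : nat -> R) :
  (forall e : R, 0 < e -> exists N, forall m n, (N <= m)%N -> (N <= n)%N ->
     `|f m - f n| < e) ->
  exists a, forall e : R, 0 < e -> exists N, forall n, (N <= n)%N -> `|f n - a| < e.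
Proof.
move=> h.
have /cvg_ex [l /cvgrPdist_lt fl] : cvg (f @ \oo).
  apply/cauchy_cvgP/cauchy_ballP => e e0; have [N hN] := h _ e0.
  exists (f @` [set n | (N <= n)%N], f @` [set n | (N <= n)%N]) => /=.
    by split; exists N => // n /= Nn; exists n.
  by move=> [_ _] /= [[m Nm <-] [n Nn <-]]; exact: hN.
exists l => e /fl [N _ hN]; exists N => n /hN /=.
by rewrite distrC.
Qed.

Lemma complex_cauchy (f : nat -> R[i]) :
  (forall e : R, 0 < e -> exists N, forall m n, (N <= m)%N -> (N <= n)%N ->
     normc (f m - f n) < e) ->
  exists a, forall e : R, 0 < e ->
    exists N, forall n, (N <= n)%N -> normc (f n - a) < e.
Proof.
move=> h.
have [|a ha] := @real_cauchy (fun n => complex.Re (f n)).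
  move=> e /h [N hN]; exists N => m n Nm Nn; apply: le_lt_trans (hN _ _ Nm Nn).
  by rewrite -raddfB; exact: normc_Re.
have [|b hb] := @real_cauchy (fun n => complex.Im (f n)).
  move=> e /h [N hN]; exists N => m n Nm Nn; apply: le_lt_trans (hN _ _ Nm Nn).
  by rewrite -raddfB; exact: normc_Im.
exists (a +i* b)%C => e e0; have e2 : 0 < e / 2 by rewrite divr_gt0.
have [N1 h1] := ha _ e2; have [N2 h2] := hb _ e2.
exists (maxn N1 N2) => n; rewrite geq_max => /andP[/h1 l1 /h2 l2].
apply: le_lt_trans (normc_ReIm _) _; rewrite raddfB raddfB /=; lra.
Qed.

End ComplexComplete.

(** * Roots of unity *)

Section Character.
Variables (R : realType) (p : nat).
Hypothesis p_prime : prime p.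
Local Notation F := 'F_p.

Lemma card_Fp' : (Zp_trunc (pdiv p)).+2 = p.
Proof. exact: Fp_cast. Qed.

Lemma ltn_Fp (a : F) : (nat_of_ord a < p)%N.
Proof. by rewrite -{2}card_Fp' ltn_ord. Qed.

Lemma val_FpD (a b : F) :
  nat_of_ord (a + b) = ((nat_of_ord a + nat_of_ord b) %% p)%N.
Proof.
by rewrite /=; move: (nat_of_ord a) (nat_of_ord b) => m n; rewrite card_Fp'.
Qed.

Lemma zetaX k : zeta R p ^+ k =
  Complex (cos (k%:R * (2 * pi / p%:R))) (sin (k%:R * (2 * pi / p%:R))).
Proof.
elim: k => [|k IH]; first by rewrite expr0 mul0r cos0 sin0.
have kS : k.+1%:R = k%:R + 1 :> R by rewrite natr1.
rewrite exprSr IH /zeta kS (mulrDl k%:R 1) mul1r cosD sinD /=.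
apply/eqP; rewrite eq_complex /=; apply/andP; split; apply/eqP; ring.
Qed.

Lemma zeta_order : zeta R p ^+ p = 1.
Proof.
rewrite zetaX mulrC divfK ?pnatr_eq0 ?(gtn_eqF (prime_gt0 p_prime)) //.
by rewrite mulr_natl cos2pi sin2pi.
Qed.

(** The standard additive character of [F_p]: phases written through [chi] multiply by adding
    exponents in the field. *)
Definition chi (a : F) : R[i] := zeta R p ^+ nat_of_ord a.

Lemma chi0 : chi 0 = 1. Proof. exact: expr0. Qed.

Lemma chiD a b : chi (a + b) = chi a * chi b.
Proof. by rewrite /chi -exprD val_FpD (expr_mod _ zeta_order). Qed.

Lemma chiMn a n : chi (a *+ n) = chi a ^+ n.
Proof.
elim: n => [|n IH]; first by rewrite mulr0n chi0 expr0.
by rewrite mulrS chiD IH exprS.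
Qed.

Lemma chi_unit a : normc (chi a) = 1.
Proof.
rewrite /chi normcX; have -> : normc (zeta R p) = 1; last by rewrite expr1n.
by rewrite /zeta /= cos2Dsin2 sqrtr1.
Qed.

Lemma chi_neq0 a : chi a != 0.
Proof.
by apply/eqP => h; have := chi_unit a; rewrite h normc0 => /esym/eqP; rewrite oner_eq0.
Qed.

Lemma chiN a : chi (- a) = (chi a)^*.
Proof.
apply: (mulfI (chi_neq0 a)); rewrite -chiD subrr chi0 mulrC conj_unit //.
exact: chi_unit.
Qed.

Lemma chi_order a : chi a ^+ p = 1.
Proof. by rewrite /chi -exprM mulnC exprM zeta_order expr1n. Qed.

Lemma chi_eq1 a : chi a = 1 -> a = 0.
Proof.
rewrite /chi zetaX => /eqP; rewrite eq_complex /= => /andP[/eqP c1 _].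
apply/eqP; apply: contraT => a0.
have p0 : 0 < p%:R :> R by rewrite ltr0n prime_gt0.
(* Half of the angle of [chi a]: it lies strictly between 0 and pi, where the sine is positive,
   whereas cos (2 t) = 1 forces sin t = 0. *)
pose t : R := (nat_of_ord a)%:R * (pi / p%:R).
have t0 : 0 < t.
  by rewrite mulr_gt0 ?divr_gt0 ?pi_gt0 // ltr0n lt0n.
have tpi : t < pi.
  rewrite /t mulrCA -[ltRHS]mulr1 ltr_pM2l ?pi_gt0 // ltr_pdivrMr // mul1r.
  by rewrite ltr_nat ltn_Fp.
have : 0 < sin t by apply: sin_gt0_pi; rewrite t0 tpi.
have e : (nat_of_ord a)%:R * (2 * pi / p%:R) = t *+ 2 :> R.
  by rewrite /t mulr2n; ring.
move: c1; rewrite e cos_mulr2n => h s0.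
have : sin t ^+ 2 = 0 by have := cos2Dsin2 t; move: h; lra.
by move/eqP; rewrite sqrf_eq0 gt_eqF.
Qed.

Lemma sum_chi a : a != 0 -> \sum_(j < p) chi a ^+ j = 0.
Proof.
move=> a0; apply: (mulfI (x := chi a - 1)).
  by apply: contra a0; rewrite subr_eq0 => /eqP/chi_eq1/eqP.
by rewrite -subrX1 chi_order subrr mulr0.
Qed.

(** The inverse of a unimodular [t] is its conjugate, so [s] is a p-th root of [t^*]. This serves to
    rescale words to order p. *)
Lemma unit_root (t : R[i]) : normc t = 1 ->
  exists2 s : R[i], normc s = 1 & s ^+ p * t = 1.
Proof.
move=> t1; have pp := prime_gt0 p_prime; exists (p.-root (t^*)%R).
  have : normc (p.-root (t^*)%R) ^+ p = 1 by rewrite -normcX rootCK // normc_conj.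
  by move/eqP; rewrite pexpr_eq1 ?normc_ge0 // => /eqP.
by rewrite rootCK // conj_unit.
Qed.

Lemma expr_Fp (A : nzRingType) (v : A) (a b : F) : v ^+ p = 1 ->
  v ^+ nat_of_ord (a + b) = v ^+ nat_of_ord a * v ^+ nat_of_ord b.
Proof. by move=> vp; rewrite -exprD val_FpD (expr_mod _ vp). Qed.

Lemma Fp_nat (a : F) : (nat_of_ord a)%:R = a.
Proof. exact: natr_Zp. Qed.

Lemma Fp_mulrn (a : F) (V : lmodType F) (x : V) : x *+ nat_of_ord a = a *: x.
Proof. by rewrite -scaler_nat Fp_nat. Qed.

Lemma Fp_mulrp (V : lmodType F) (x : V) : x *+ p = 0.
Proof. by rewrite -scaler_nat pchar_Fp_0 // scale0r. Qed.

End Character.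

(** * Words *)

Section Span.
Variables (R : realType) (A : cstarAlgType R).
Implicit Types (S T : set A) (x y : A) (t : R[i]).

Lemma lin_span0 S : lin_span S 0.
Proof. by exists 0%N, (fun=> 0), (fun=> 0); split=> [[]//|]; rewrite big_ord0. Qed.

Lemma sub_lin_span S x : S x -> lin_span S x.
Proof.
by move=> Sx; exists 1%N, (fun=> 1), (fun=> x); split=> //; rewrite big_ord1 scale1r.
Qed.

Lemma lin_span_lin S t x y : lin_span S x -> lin_span S y -> lin_span S (t *: x + y).
Proof.
move=> [m [a [v [vS ->]]]] [n [b [w [wS ->]]]].
exists (m + n)%N, (fun i => match fintype.split i with inl j => t * a j | inr j => b j end),
  (fun i => match fintype.split i with inl j => v j | inr j => w j end); split.
  by move=> i; case: (fintype.split i).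
rewrite big_split_ord /= scaler_sumr; congr (_ + _); apply: eq_bigr => i _.
  by rewrite (unsplitK (inl i) : fintype.split (lshift n i) = inl i) scalerA.
by rewrite (unsplitK (inr i) : fintype.split (rshift m i) = inr i).
Qed.

Lemma lin_spanZ S t x : lin_span S x -> lin_span S (t *: x).
Proof. by move=> Sx; rewrite -[_ *: _]addr0; apply: lin_span_lin => //; exact: lin_span0. Qed.

Lemma lin_spanD S x y : lin_span S x -> lin_span S y -> lin_span S (x + y).
Proof. by move=> Sx Sy; rewrite -[x]scale1r; exact: lin_span_lin. Qed.

Lemma lin_span_sum S (I : Type) (s : seq I) (P : pred I) (F : I -> A) :
  (forall i, P i -> lin_span S (F i)) -> lin_span S (\sum_(i <- s | P i) F i).
Proof. by move=> h; elim/big_ind: _ => //; [exact: lin_span0|exact: lin_spanD]. Qed.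

Lemma lin_span_ind S (P : A -> Prop) :
  P 0 -> (forall t x y, P x -> P y -> P (t *: x + y)) -> S `<=` P ->
  lin_span S `<=` P.
Proof.
move=> P0 Pl SP _ [n [a [v [vS ->]]]]; elim/big_rec: _ => // i y _ Py.
by apply: Pl => //; exact: SP.
Qed.

Lemma lin_spanM S x y :
  (forall v w, S v -> S w -> lin_span S (v * w)) ->
  lin_span S x -> lin_span S y -> lin_span S (x * y).
Proof.
move=> SM + Sy; move: x; apply: lin_span_ind.
- by rewrite mul0r; exact: lin_span0.
- by move=> t v w Sv Sw; rewrite mulrDl -scalerAl; exact: lin_span_lin.
- move=> v Sv; move: y Sy; apply: lin_span_ind.
  + by rewrite mulr0; exact: lin_span0.
  + by move=> t x w Sx Sw; rewrite mulrDr -scalerAr; exact: lin_span_lin.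
  + by move=> w Sw; exact: SM.
Qed.

Lemma lin_span_star S x :
  (forall v, S v -> lin_span S (star v)) -> lin_span S x -> lin_span S (star x).
Proof.
move=> Ss; move: x; apply: lin_span_ind => //.
- by rewrite star0; exact: lin_span0.
- by move=> t v w Sv Sw; rewrite starD starZ; exact: lin_span_lin.
Qed.

Lemma closed_span_lin S t x y :
  closed_span S x -> closed_span S y -> closed_span S (t *: x + y).
Proof.
move=> /closure_nlim [f fS fx] /closure_nlim [g gS gy].
apply: (@closed_nlim _ _ _ (fun n => t *: f n + g n)); first exact: closed_closure.
  by move=> n; apply: subset_closure; apply: lin_span_lin.
by apply: nlimD => //; exact: nlimZ.
Qed.

Lemma sub_closed_span S x : lin_span S x -> closed_span S x.
Proof. exact: subset_closure. Qed.

Lemma closed_span_sum S (I : Type) (s : seq I) (F : I -> A) :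
  (forall i, closed_span S (F i)) -> closed_span S (\sum_(i <- s) F i).
Proof.
move=> h; elim/big_ind: _ => //; first exact/sub_closed_span/lin_span0.
by move=> x y Sx Sy; rewrite -[x]scale1r; exact: closed_span_lin.
Qed.

Lemma closed_span_min S T :
  closed (T : set (topo A)) -> lin_span S `<=` T -> closed_span S `<=` T.
Proof. by move=> cT ST x /closure_nlim [f fS]; apply: closed_nlim => // n; exact: ST. Qed.

End Span.

(** The hypotheses end in [lin_span S] rather than [S], because products and adjoints of words are
    words only up to a phase. *)
Lemma closed_span_subalgebra (R : realType) (A : cstarAlgType R) (S : set A) :
  lin_span S 1 ->
  (forall v w, S v -> S w -> lin_span S (v * w)) ->
  (forall v, S v -> lin_span S (star v)) ->
  closed_star_subalgebra (closed_span S).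
Proof.
move=> S1 SM Ss; split.
- exact: closed_closure.
- exact: sub_closed_span.
- by move=> t x y; exact: closed_span_lin.
- move=> x y /closure_nlim [f fS fx] /closure_nlim [g gS gy].
  apply: (@closed_nlim _ _ _ (fun n => f n * g n)); first exact: closed_closure.
    by move=> n; apply: subset_closure; exact: lin_spanM.
  exact: nlimM.
- move=> x /closure_nlim [f fS fx].
  apply: (@closed_nlim _ _ _ (fun n => star (f n))); first exact: closed_closure.
    by move=> n; apply: subset_closure; exact: lin_span_star.
  exact: nlim_star.
Qed.

Section Omega.
Variables (p : nat) (c : nat -> nat -> 'F_p).
Hypothesis c_skew : skew_symmetric c.
Implicit Types x y z : {poly 'F_p}.
Local Notation om := (omega c).

(** The summation ranges in [omega] depend on the sizes of the arguments, which change under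
    addition; a common bound makes the sums comparable term by term. *)
Lemma omega_widen n x y : (size x <= n)%N -> (size y <= n)%N ->
  om x y = \sum_(i < n) \sum_(j < n) c i j * x`_j * y`_i.
Proof.
move=> xn yn.
transitivity (\sum_(i < size y) \sum_(j < n) c i j * x`_j * y`_i).
  apply: eq_bigr => i _.
  rewrite (big_ord_widen n (fun j => c i j * x`_j * y`_i)) // big_mkcond.
  apply: eq_bigr => j _; case: ltnP => // h.
  by rewrite nth_default // mulr0 mul0r.
rewrite (big_ord_widen n (fun i => \sum_(j < n) c i j * x`_j * y`_i)) // big_mkcond.
apply: eq_bigr => i _; case: ltnP => // h.
by rewrite big1 // => j _; rewrite [y`_i]nth_default // mulr0.
Qed.

Lemma omegaDl x y z : om (x + y) z = om x z + om y z.
Proof.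
pose n := maxn (maxn (size x) (size y)) (size z).
have hx : (size x <= n)%N by rewrite /n !leq_max leqnn.
have hy : (size y <= n)%N by rewrite /n !leq_max leqnn orbT.
have hz : (size z <= n)%N by rewrite /n !leq_max leqnn orbT.
have hxy : (size (x + y)%R <= n)%N.
  by apply: leq_trans (size_polyD _ _) _; rewrite geq_max hx.
rewrite !(@omega_widen n) // -big_split; apply: eq_bigr => i _ /=.
rewrite -big_split; apply: eq_bigr => j _ /=.
by rewrite coefD mulrDr mulrDl.
Qed.

Lemma omega_skew x y : om x y = - om y x.
Proof.
pose n := maxn (size x) (size y).
rewrite !(@omega_widen n) ?leq_maxl ?leq_maxr // exchange_big -sumrN.
apply: eq_bigr => i _; rewrite -sumrN; apply: eq_bigr => j _.
by rewrite (c_skew j i).1 mulNr mulNr mulrAC.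
Qed.

(** For p = 2 this does not follow from [omega_skew]: the diagonal terms vanish because c_ii = 0,
    and the others cancel in pairs. *)
Lemma omega_alt x : om x x = 0.
Proof.
rewrite (@omega_widen (size x)) //; elim: (size x) => [|n IH]; first by rewrite big_ord0.
rewrite big_ord_recr /= big_ord_recr /= (c_skew n n).2 !mul0r addr0.
under eq_bigr do rewrite big_ord_recr /=.
rewrite big_split /= IH add0r -big_split big1 // => i _ /=.
by rewrite (c_skew i n).1; ring.
Qed.

Lemma omega0l x : om 0 x = 0.
Proof. by apply: (addrI (om 0 x)); rewrite -omegaDl !addr0. Qed.

Lemma omega0r x : om x 0 = 0.
Proof. by rewrite omega_skew omega0l oppr0. Qed.

Lemma omegaNl x y : om (- x) y = - om x y.
Proof. by apply/eqP; rewrite -addr_eq0 -omegaDl addNr omega0l. Qed.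

(** A scalar of the prime field acts as a repeated addition, so additivity suffices. *)
Lemma omegaZl (a : 'F_p) x y : om (a *: x) y = a * om x y.
Proof.
rewrite -{1}(natr_Zp a) scaler_nat -{2}(natr_Zp a) mulr_natl.
by elim: (nat_of_ord a) => [|n IH]; rewrite ?mulr0n ?omega0l // !mulrS omegaDl IH.
Qed.

Lemma omegaZr (a : 'F_p) x y : om x (a *: y) = a * om x y.
Proof. by rewrite omega_skew omegaZl -mulrN -omega_skew. Qed.

Lemma omega_suml (I : Type) (s : seq I) (P : pred I) (F : I -> {poly 'F_p}) y :
  om (\sum_(i <- s | P i) F i) y = \sum_(i <- s | P i) om (F i) y.
Proof. by elim/big_rec2: _ => [|i a b _ IH]; rewrite ?omega0l // omegaDl IH. Qed.

Lemma ker_omega0 : ker_omega c 0.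
Proof. by move=> y; rewrite omega0l. Qed.

Lemma ker_omegaD x y : ker_omega c x -> ker_omega c y -> ker_omega c (x + y).
Proof. by move=> hx hy z; rewrite omegaDl hx hy addr0. Qed.

End Omega.

Section Words.
Variables (R : realType) (p : nat) (c : nat -> nat -> 'F_p).
Hypotheses (p_prime : prime p) (c_skew : skew_symmetric c).
Variables (A : cstarAlgType R) (u : nat -> A).
Hypothesis rel : relations c u.
Local Notation om := (omega c).
Local Notation chi := (@chi R p).
Local Notation w := (@word R p A u).
Implicit Types x y z : {poly 'F_p}.

Lemma gen_unitary k : unitary_elt (u k).
Proof. by have [h _ _] := rel; exact: h. Qed.

(** The number of factors is detached from the size of [x], so that words of different sizes are
    compared at one length and by induction on it. *)
Definition wordn n x : A := \prod_(k < n) u k ^+ nat_of_ord (x`_k).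

Lemma wordE n x : (size x <= n)%N -> w x = wordn n x.
Proof.
move=> xn; rewrite /word /wordn.
rewrite -(big_mkord xpredT (fun k => u k ^+ nat_of_ord (x`_k))).
rewrite -(big_mkord xpredT (fun k => u k ^+ nat_of_ord (x`_k))).
rewrite [RHS](big_cat_nat (n := size x)) //= [X in _ = _ * X]big1_seq ?mulr1 // => k.
by rewrite mem_index_iota => /andP[_ /andP[h _]]; rewrite nth_default // expr0.
Qed.

Lemma phase_expl (a b : A) (t : R[i]) n : a * b = t *: (b * a) ->
  a ^+ n * b = t ^+ n *: (b * a ^+ n).
Proof.
move=> ab; elim: n => [|n IH]; first by rewrite !expr0 mul1r mulr1 scale1r.
rewrite exprS -mulrA IH -scalerAr (mulrA a) ab -scalerAl scalerA -mulrA -!exprS.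
by rewrite -exprSr.
Qed.

Lemma phase_expr (a b : A) (t : R[i]) n : a * b = t *: (b * a) ->
  a * b ^+ n = t ^+ n *: (b ^+ n * a).
Proof.
move=> ab; elim: n => [|n IH]; first by rewrite !expr0 mul1r mulr1 scale1r.
by rewrite exprS (mulrA a) ab -scalerAl -(mulrA b a) IH -scalerAr scalerA (mulrA b) -!exprS.
Qed.

Lemma wordn_gen_comm n x j (b : 'F_p) :
  wordn n x * u j ^+ nat_of_ord b =
  chi (\sum_(i < n) c i j * b * x`_i) *: (u j ^+ nat_of_ord b * wordn n x).
Proof.
elim: n => [|n IH].
  by rewrite /wordn !big_ord0 chi0 scale1r mul1r mulr1.
rewrite /wordn !big_ord_recr /= -/(wordn n x).
have h : u n * u j = chi (c n j) *: (u j * u n) by have [_ _] := rel; apply.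
have h' := phase_expl (nat_of_ord x`_n) (phase_expr (nat_of_ord b) h).
rewrite -mulrA h' -scalerAr (mulrA (wordn n x)) IH -scalerAl scalerA.
rewrite -(mulrA _ (wordn n x)); congr (_ *: _).
rewrite -(chiMn R p_prime (c n j)) -(chiMn R p_prime) -chiD //; congr (chi _).
rewrite addrC; congr (_ + _).
by rewrite -[c n j *+ _]mulr_natr -[_ *+ nat_of_ord _]mulr_natr !natr_Zp.
Qed.

Lemma wordn_comm n x y : wordn n x * wordn n y =
  chi (\sum_(i < n) \sum_(j < n) c i j * y`_j * x`_i) *: (wordn n y * wordn n x).
Proof.
(* The two lengths are decoupled, so that the induction lets only the second word grow. *)
suff h m : wordn n x * wordn m y =
    chi (\sum_(i < n) \sum_(j < m) c i j * y`_j * x`_i) *: (wordn m y * wordn n x).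
  exact: h.
elim: m => [|m IH].
  have -> : wordn 0 y = 1 by rewrite /wordn big_ord0.
  rewrite mulr1 mul1r.
  by rewrite big1 ?chi0 ?scale1r // => i _; rewrite big_ord0.
rewrite [wordn m.+1 y]/wordn big_ord_recr /= -/(wordn m y).
rewrite mulrA IH -scalerAl -(mulrA _ (wordn n x)) wordn_gen_comm -scalerAr scalerA.
rewrite (mulrA (wordn m y)).
congr (_ *: _); rewrite -chiD // -big_split /=; congr (chi _).
by apply: eq_bigr => i _; rewrite big_ord_recr.
Qed.

Lemma word_comm x y : w x * w y = chi (om y x) *: (w y * w x).
Proof.
pose n := maxn (size x) (size y).
by rewrite !(@wordE n) ?leq_maxl ?leq_maxr // wordn_comm (@omega_widen _ _ n) ?leq_maxl ?leq_maxr.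
Qed.

(** Each crossing of generators costs a phase. The resulting cocycle is left existential, since
    later arguments only use that it takes values among those of [chi]. *)
Lemma wordn_mul n x y : exists a : 'F_p, wordn n x * wordn n y = chi a *: wordn n (x + y).
Proof.
elim: n => [|n [a IH]]; first by exists 0; rewrite /wordn !big_ord0 chi0 mulr1 scale1r.
rewrite /wordn !big_ord_recr /= -!/(wordn n _).
have [t ht] : exists b : 'F_p, u n ^+ nat_of_ord x`_n * wordn n y =
    chi b *: (wordn n y * u n ^+ nat_of_ord x`_n).
  exists (- \sum_(i < n) c i n * x`_n * y`_i).
  by rewrite wordn_gen_comm scalerA -chiD // addNr chi0 scale1r.
exists (a + t); rewrite mulrA -[_ * _ * wordn n y]mulrA ht.
rewrite -scalerAr -scalerAl mulrA IH -!scalerAl scalerA -mulrA chiD // mulrC.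
by rewrite coefD (expr_Fp p_prime) // ; case: rel.
Qed.

Lemma word_mul x y : exists a : 'F_p, w x * w y = chi a *: w (x + y).
Proof.
pose n := maxn (size x) (size y).
rewrite !(@wordE n) ?leq_maxl ?leq_maxr //; first exact: wordn_mul.
exact: size_polyD.
Qed.

Lemma word0 : w 0 = 1.
Proof. by rewrite /word size_poly0 big_ord0. Qed.

Lemma wordX k : w 'X^k = u k.
Proof.
rewrite /word size_polyXn big_ord_recr /= big1 => [|i _].
  by rewrite mul1r coefXn eqxx /= (modn_small (m := 1)) ?expr1.
by rewrite coefXn ltn_eqF ?ltn_ord.
Qed.

Lemma word_unitary x : unitary_elt (w x).
Proof.
rewrite /word; elim/big_ind: _ => [|a b|i _]; [exact: unitary1|exact: unitaryM|].
exact/unitaryX/gen_unitary.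
Qed.

Lemma word_add x y : exists a : 'F_p, w (x + y) = chi a *: (w x * w y).
Proof.
have [a h] := word_mul x y; exists (- a).
by rewrite h scalerA -chiD // addNr chi0 scale1r.
Qed.

Lemma star_word x : exists a : 'F_p, star (w x) = chi a *: w (- x).
Proof.
have [a h] := word_mul (- x) x; rewrite addNr word0 in h.
exists (- a); rewrite -[LHS]mul1r.
have -> : 1 = chi (- a) *: (w (- x) * w x) by rewrite h scalerA -chiD // addNr chi0 scale1r.
by rewrite -scalerAl -mulrA (word_unitary x).2 mulr1.
Qed.

Lemma word_exp x n : exists a : 'F_p, w x ^+ n = chi a *: w (x *+ n).
Proof.
elim: n => [|n [a IH]]; first by exists 0; rewrite expr0 mulr0n word0 chi0 scale1r.
have [b h] := word_mul x (x *+ n); exists (a + b).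
by rewrite exprS IH -scalerAr h scalerA chiD // mulrS.
Qed.

Lemma word_conj x y : w y * w x * star (w y) = chi (om x y) *: w x.
Proof. by rewrite word_comm -scalerAl -mulrA (word_unitary y).2 mulr1. Qed.

(** By [word_exp], [w x ^+ p] is a phase times the word of [p x = 0]. The phase can differ from 1:
    for p = 2 the product of two anticommuting generators has square -1. *)
Lemma word_normalize x : exists2 t, normc t = 1 & (t *: w x) ^+ p = 1.
Proof.
have [a h] := word_exp x p; rewrite Fp_mulrp // word0 in h.
have [t t1 ht] := unit_root p_prime (chi_unit R a); exists t => //.
by rewrite exprZn h scalerA ht scale1r.
Qed.

Definition words (P : set {poly 'F_p}) : set A := [set w x | x in P].

Definition subgroup (P : set {poly 'F_p}) :=
  [/\ P 0, forall x y, P x -> P y -> P (x + y) & forall x, P x -> P (- x)].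

Lemma words_subalgebra P : subgroup P -> closed_star_subalgebra (closed_span (words P)).
Proof.
move=> [P0 PD PN]; apply: closed_span_subalgebra.
- by apply: sub_lin_span; exists 0 => //; rewrite word0.
- move=> _ _ [x Px <-] [y Py <-]; have [a ->] := word_mul x y.
  by apply: lin_spanZ; apply: sub_lin_span; exists (x + y) => //; exact: PD.
- move=> _ [x Px <-]; have [a ->] := star_word x.
  by apply: lin_spanZ; apply: sub_lin_span; exists (- x) => //; exact: PN.
Qed.

(** Terms are grouped by exponent, not by value, since words with different exponents may coincide
    in [A]. Each exponent then has one coefficient, which the averages can read off. *)
Lemma lin_span_wordsP P v : lin_span (words P) v ->
  exists (l : seq {poly 'F_p}) (t : {poly 'F_p} -> R[i]),
    [/\ uniq l, forall x, x \in l -> P x & v = \sum_(x <- l) t x *: w x].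
Proof.
move=> [n [a [f [fS ->]]]].
have /choice [g gP] i : exists x, P x /\ w x = f i by have [x Px <-] := fS i; exists x.
pose l := undup [seq g i | i : 'I_n].
exists l, (fun x => \sum_(i < n | g i == x) a i); split.
- exact: undup_uniq.
- by move=> x; rewrite mem_undup => /mapP[i _ ->]; exact: (gP i).1.
- under [RHS]eq_bigr do rewrite scaler_suml big_mkcond.
  rewrite exchange_big; apply: eq_bigr => i _ /=.
  have gl : g i \in l by rewrite mem_undup map_f // mem_enum.
  rewrite (bigD1_seq (g i)) ?undup_uniq //= eqxx big1 ?addr0 => [|x].
    by rewrite (gP i).2.
  by rewrite eq_sym => /negbTE ->.
Qed.

End Words.

Section CstarWords.
Variables (R : realType) (p : nat) (c : nat -> nat -> 'F_p).
Hypotheses (p_prime : prime p) (c_skew : skew_symmetric c).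
Variables (E : cstarAlgType R) (u : nat -> E).
Hypothesis rel : relations c u.

Lemma nm_Cstar (G : set E) (x : Cstar G) : nm x = nm (Cstar_val x).
Proof. by []. Qed.

Lemma generator_relations : relations c (generator u : nat -> cstar_seq u).
Proof.
have [h1 h2 h3] := rel; split.
- by move=> k; have [a b] := h1 k; split; apply: Cstar_val_inj.
- move=> k; apply: Cstar_val_inj; rewrite -[RHS](h2 k).
  exact: (rmorphXn (\val : Cstar (range u) -> E)).
- by move=> i j; apply: Cstar_val_inj; exact: h3.
Qed.

Lemma val_word (x : {poly 'F_p}) : Cstar_val (word (generator u : nat -> cstar_seq u) x) = word u x.
Proof.
rewrite /word; elim/big_rec2: _ => [//|k a b _ <-].
rewrite -[LHS]/(Cstar_val (generator u k ^+ nat_of_ord x`_k) * Cstar_val b).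
congr (_ * _); exact: (rmorphXn (\val : Cstar (range u) -> E)).
Qed.

(** The closed span of the words is a closed star-subalgebra of [E] containing the generators, hence
    contains the generated one. The approximating sums of words themselves lie in [cstar_seq u],
    with the same norm, so density descends. *)
Lemma words_dense (a : cstar_seq u) :
  closed_span (words (generator u : nat -> cstar_seq u) (fun _ : {poly 'F_p} => True)) a.
Proof.
have : closed_span (words u (fun _ : {poly 'F_p} => True)) (Cstar_val a).
  apply: (Cstar_valP a); first exact: (words_subalgebra p_prime rel).
  move=> _ [k _ <-]; apply/sub_closed_span/sub_lin_span.
  by exists 'X^k => //; rewrite wordX.
move=> /closureP h; apply/closureP => e /h [_ [n [t [f [fS ->]]]] hv].
have /choice [g gP] i : exists x : {poly 'F_p}, word u x = f i.
  by have [x _ <-] := fS i; exists x.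
exists (\sum_(i < n) t i *: word (generator u : nat -> cstar_seq u) (g i)).
  exists n, t, (fun i => word (generator u : nat -> cstar_seq u) (g i)); split => // i.
  by exists (g i).
rewrite nm_Cstar; apply: le_lt_trans hv.
rewrite -[X in nm X <= _]/(Cstar_val a - Cstar_val _).
suff -> : Cstar_val (\sum_(i < n) t i *: word (generator u : nat -> cstar_seq u) (g i)) =
  \sum_(i < n) t i *: f i by [].
elim/big_rec2: _ => [//|i x y _ <-].
rewrite -[LHS]/(t i *: Cstar_val (word (generator u : nat -> cstar_seq u) (g i)) + Cstar_val y).
by rewrite val_word gP.
Qed.

End CstarWords.

(** * Averaging over words and the center *)

Section Averaging.
Variables (R : realType) (p : nat) (c : nat -> nat -> 'F_p).
Hypotheses (p_prime : prime p) (c_skew : skew_symmetric c).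
Variables (A : cstarAlgType R) (u : nat -> A).
Hypothesis rel : relations c u.
Local Notation om := (omega c).
Local Notation chi := (@chi R p).
Local Notation w := (@word R p A u).
Implicit Types (x y z : {poly 'F_p}) (a b : A) (Y : seq {poly 'F_p}).

Let p_gt0 : (0 < p)%N := prime_gt0 p_prime.

Let p_neq0 : p%:R != 0 :> R[i].
Proof. by rewrite pnatr_eq0 -lt0n. Qed.

(** Conjugation ignores scalars and [w y ^+ p] is one, so the [p] conjugates form a full period. *)
Definition avg y a : A := p%:R^-1 *: \sum_(j < p) w y ^+ j * a * star (w y ^+ j).

Lemma avg_lin y (t : R[i]) a b : avg y (t *: a + b) = t *: avg y a + avg y b.
Proof.
rewrite /avg scalerA mulrC -scalerA -scalerDr; congr (_ *: _).
rewrite scaler_sumr -big_split; apply: eq_bigr => j _ /=.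
by rewrite mulrDr mulrDl -scalerAr -scalerAl.
Qed.

Lemma avg_nm y a : nm (avg y a) <= nm a.
Proof.
rewrite /avg nmZ normcV normc_real_nat ler_pdivrMl ?ltr0n //.
apply: le_trans (nm_sum _ _ _) _.
apply: (@le_trans _ _ (\sum_(j < p) nm a)); last first.
  by rewrite sumr_const card_ord mulr_natl.
apply: ler_sum => j _; have uj := unitaryX j (word_unitary rel y).
apply: le_trans (nmM _ _) _; rewrite nm_star (nm_unitary uj) mulr1.
by apply: le_trans (nmM _ _) _; rewrite (nm_unitary uj) mul1r.
Qed.

Lemma avg_word y x : avg y (w x) = if om x y == 0 then w x else 0.
Proof.
have conj j : w y ^+ j * w x * star (w y ^+ j) = chi (om x y) ^+ j *: w x.
  elim: j => [|j IH]; first by rewrite !expr0 mul1r star1 mulr1 scale1r.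
  rewrite exprS starM; have -> : w y * w y ^+ j * w x * (star (w y ^+ j) * star (w y)) =
    w y * (w y ^+ j * w x * star (w y ^+ j)) * star (w y) by rewrite !mulrA.
  by rewrite IH -scalerAr -scalerAl (word_conj p_prime rel) scalerA -exprSr.
rewrite /avg; under eq_bigr do rewrite conj.
rewrite -scaler_suml; case: eqP => [->|/eqP h].
  under eq_bigr do rewrite chi0 expr1n.
  by rewrite sumr_const card_ord scalerA mulVf ?scale1r.
by rewrite sum_chi // scale0r scaler0.
Qed.

Lemma avg_fix y a : a * w y = w y * a -> avg y a = a.
Proof.
move=> com; rewrite /avg; under eq_bigr => j _.
  have -> : w y ^+ j * a = a * w y ^+ j.
    by have : GRing.comm a (w y) by []; move/(commrX j).
  rewrite -mulrA (unitaryX j (word_unitary rel y)).2 mulr1; over.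
by rewrite sumr_const card_ord -(scaler_nat p a) scalerA mulVf ?scale1r.
Qed.

Lemma avg_central y a (z : A) : cstar_center A z -> avg y (z * a) = z * avg y a.
Proof.
move=> hz; rewrite /avg -scalerAr mulr_sumr; congr (_ *: _); apply: eq_bigr => j _.
by rewrite !mulrA (hz (w y ^+ j)).
Qed.

Lemma avg_ideal y a J : closed_ideal J -> J a -> J (avg y a).
Proof.
move=> [_ J0 Jl JM] Ja.
have JZ t b : J b -> J (t *: b) by move=> Jb; rewrite -[_ *: _]addr0; exact: Jl.
apply: JZ; elim/big_ind: _ => // [b d Jb Jd|j _].
  by rewrite -[b]scale1r; exact: Jl.
by apply: (JM _ _ _).2; apply: (JM _ _ _).1.
Qed.

Definition avgs Y a : A := foldr avg a Y.

Lemma avgs_lin Y (t : R[i]) a b : avgs Y (t *: a + b) = t *: avgs Y a + avgs Y b.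
Proof. by elim: Y => //= y Y ->; exact: avg_lin. Qed.

Lemma avgs0 Y : avgs Y 0 = 0.
Proof. by have := avgs_lin Y (-1) 0 0; rewrite scaler0 addr0 scaleN1r addNr. Qed.

Lemma avgsZ Y (t : R[i]) a : avgs Y (t *: a) = t *: avgs Y a.
Proof. by rewrite -[t *: a]addr0 avgs_lin avgs0 addr0. Qed.

Lemma avgsD Y a b : avgs Y (a + b) = avgs Y a + avgs Y b.
Proof. by rewrite -[a]scale1r avgs_lin !scale1r. Qed.

Lemma avgsB Y a b : avgs Y (a - b) = avgs Y a - avgs Y b.
Proof. by rewrite avgsD -scaleN1r avgsZ scaleN1r. Qed.

Lemma avgs_sum Y (I : Type) (s : seq I) (P : pred I) (F : I -> A) :
  avgs Y (\sum_(i <- s | P i) F i) = \sum_(i <- s | P i) avgs Y (F i).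
Proof. by elim/big_rec2: _ => [|i a b _ <-]; rewrite ?avgs0 ?avgsD. Qed.

Lemma avgs_nm Y a : nm (avgs Y a) <= nm a.
Proof. by elim: Y => //= y Y; apply: le_trans; exact: avg_nm. Qed.

Lemma avgs_word Y x :
  avgs Y (w x) = if all (fun y => om x y == 0) Y then w x else 0.
Proof.
elim: Y => //= y Y ->; case: ifP => _; last first.
  by rewrite andbF; exact: (avgs0 [:: y]).
by rewrite avg_word andbT.
Qed.

Lemma avgs_fix Y a : (forall y, y \in Y -> a * w y = w y * a) -> avgs Y a = a.
Proof.
elim: Y => //= y Y IH h; rewrite IH => [|z zY]; last by apply: h; rewrite inE zY orbT.
by apply: avg_fix; apply: h; rewrite inE eqxx.
Qed.

Lemma avgs_central Y a (z : A) : cstar_center A z -> avgs Y (z * a) = z * avgs Y a.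
Proof. by move=> hz; elim: Y => //= y Y ->; exact: avg_central. Qed.

Lemma avgs_ideal Y a J : closed_ideal J -> J a -> J (avgs Y a).
Proof. by move=> hJ Ja; elim: Y => //= y Y; exact: avg_ideal. Qed.

Hypothesis dense : forall a, closed_span (words u (fun _ : {poly 'F_p} => True)) a.

Lemma central_of_words a : (forall x, a * w x = w x * a) -> cstar_center A a.
Proof.
move=> h b; have : closed_span (words u (fun _ : {poly 'F_p} => True)) b by exact: dense.
have cT : closed ([set b | a * b = b * a] : set (topo A)).
  apply: closedP => f d fS fd; apply: (nlim_unique (nlimMl a fd)).
  by apply: nlim_near (nlimMr a fd); exists 0%N => n _; rewrite fS.
apply: (closed_span_min cT); apply: lin_span_ind.
- by rewrite /= mulr0 mul0r.
- by move=> t x y /= hx hy; rewrite mulrDr mulrDl -scalerAr -scalerAl hx hy.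
- by move=> _ [x _ <-] /=; exact: h.
Qed.

Lemma word_central x : ker_omega c x -> cstar_center A (w x).
Proof.
move=> kx; apply: central_of_words => y.
by rewrite (word_comm p_prime rel x y) (omega_skew c_skew y x) kx oppr0 chi0 scale1r.
Qed.

(** Each exponent outside the kernel is given one [y] that pairs nontrivially with it; finitely many
    exponents need only finitely many averages. *)
Lemma detect_ker (l : seq {poly 'F_p}) : exists Y, forall x, x \in l ->
  all (fun y => om x y == 0) Y -> ker_omega c x.
Proof.
elim: l => [|x l [Y hY]]; first by exists [::].
have [kx|nkx] := pselect (ker_omega c x).
  by exists Y => z; rewrite inE => /orP[/eqP -> //|]; exact: hY.
have [y hy] : exists y, om x y <> 0.
  by apply: contrapT => h; apply: nkx => y; apply: contrapT => hy; apply: h; exists y.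
exists (y :: Y) => z; rewrite inE => /orP[/eqP -> /=|zl /= /andP[_]]; last exact: hY.
by move=> /andP[/eqP /hy].
Qed.

Lemma centerE : cstar_center A = closed_span (words u (ker_omega c)).
Proof.
apply/seteqP; split=> z.
  move=> hz; apply/closureP => e e0.
  have [v Sv zv] := (closureP _ _).1 (@dense z) _ e0.
  have [l [t [_ _ vE]]] := lin_span_wordsP Sv.
  (* Averaging over Y fixes z and kills the words of v outside the kernel. *)
  have [Y hY] := detect_ker l; exists (avgs Y v); last first.
    apply: le_lt_trans zv; rewrite -{1}(@avgs_fix Y z) => [|y _]; last exact: hz.
    by rewrite -avgsB avgs_nm.
  rewrite vE avgs_sum big_seq; apply: lin_span_sum => x xl.
  rewrite avgsZ; apply: lin_spanZ; rewrite avgs_word; case: ifP => h.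
    by apply: sub_lin_span; exists x => //; exact: hY h.
  exact: lin_span0.
have cT : closed (cstar_center A : set (topo A)).
  apply: closedP => f d fS fd b; apply: (nlim_unique (nlimMr b fd)).
  by apply: nlim_near (nlimMl b fd); exists 0%N => n _; rewrite fS.
apply: (closed_span_min cT); apply: lin_span_ind.
- by move=> b; rewrite mulr0 mul0r.
- by move=> t x y hx hy b; rewrite mulrDr mulrDl -scalerAr -scalerAl hx hy.
- by move=> _ [x kx <-]; exact: word_central.
Qed.

End Averaging.

(** * Symplectic bases *)

Section QuotientDim.
Variables (F : fieldType) (V : lmodType F) (W : set V).
Hypotheses (W0 : W 0) (WD : forall x y, W x -> W y -> W (x + y))
  (WZ : forall (a : F) x, W x -> W (a *: x)).

Lemma subspace_sum (I : Type) (s : seq I) (G : I -> V) :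
  (forall i, W (G i)) -> W (\sum_(i <- s) G i).
Proof. by move=> WG; elim/big_ind: _. Qed.

(** Modulo [W] the [v j] are rows of a k by n matrix; for k > n this has a nonzero left kernel
    vector, that is, a nontrivial combination of the [v j] in [W]. *)
Lemma quotient_indep_le n k (v : 'I_k -> V) : quotient_dim W n ->
  (forall a : 'I_k -> F, W (\sum_i a i *: v i) -> forall i, a i = 0) -> (k <= n)%N.
Proof.
move=> [b [_ bspan]] vfree; rewrite leqNgt; apply/negP => nk.
have [M MP] := choice (fun j => bspan (v j)).
pose B : 'M[F]_(k, n) := \matrix_(j, i) M j i.
have : kermx B != 0.
  rewrite -mxrank_eq0 mxrank_ker -lt0n subn_gt0.
  exact: leq_ltn_trans (rank_leq_col _) nk.
move=> /rowV0Pn [a /sub_kermxP aB /negP]; apply; apply/eqP/rowP => j.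
rewrite mxE; apply: (vfree (fun j => a 0 j)).
(* As [a] lies in the left kernel of [B], the subtracted multiples of the [b l] add up to zero. *)
have -> : \sum_i a 0 i *: v i = \sum_i a 0 i *: (v i - \sum_l M i l *: b l).
  apply/eqP; rewrite -subr_eq0 -sumrB; apply/eqP.
  under eq_bigr do rewrite scalerBr opprB addrC subrK scaler_sumr.
  rewrite exchange_big big1 // => l _.
  under eq_bigr do rewrite scalerA.
  have h : \sum_i a 0 i * M i l = 0.
    have := congr1 (fun r : 'rV_n => r 0 l) aB; rewrite mxE [RHS]mxE => h.
    by rewrite -[RHS]h; apply: eq_bigr => i _; rewrite mxE.
  by rewrite -scaler_suml h scale0r.
by apply: subspace_sum => i; apply: WZ; exact: MP.
Qed.

Lemma quotient_dim_unique m n : quotient_dim W m -> quotient_dim W n -> m = n.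
Proof.
move=> Wm Wn; apply/eqP; rewrite eqn_leq.
have [[b [bf _]] [d [df _]]] := (Wm, Wn).
by rewrite (quotient_indep_le Wn bf) (quotient_indep_le Wm df).
Qed.

End QuotientDim.

Section SymplecticBasis.
Variables (p : nat) (c : nat -> nat -> 'F_p).
Hypotheses (c_skew : skew_symmetric c).
Local Notation G := {poly 'F_p}.
Local Notation om := (omega c).
Local Notation K := (ker_omega c).
Implicit Types (x y : G) (L : seq (G * G)).

Let omDl := omegaDl c.
Let omNl := omegaNl c.

(** The default 0 lets orthogonality relations be stated for all indices, including those beyond the
    end of the list. *)
Definition pair_e L k : G := (nth (0, 0) L k).1.
Definition pair_f L k : G := (nth (0, 0) L k).2.

Definition pcomb (e f : nat -> G) n (a b : nat -> 'F_p) : G :=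
  \sum_(k < n) (a k *: e k + b k *: f k).

Definition hyperbolic L := forall i j,
  [/\ om (pair_e L i) (pair_e L j) = 0, om (pair_f L i) (pair_f L j) = 0 &
      om (pair_e L i) (pair_f L j) = ((i == j) && (i < size L)%N)%:R].

Definition covers L x := exists a b, K (x - pcomb (pair_e L) (pair_f L) (size L) a b).

(** Symplectic Gram-Schmidt: since om(e_k, f_k) = 1 and om(f_k, e_k) = -1, the coefficient at e_k is
    read off with f_k, and the one at f_k with e_k up to sign. *)
Definition residue L x := x -
  pcomb (pair_e L) (pair_f L) (size L) (fun k => om x (pair_f L k)) (fun k => - om x (pair_e L k)).

Lemma omega_pcomb e f n a b y :
  om (pcomb e f n a b) y = \sum_(k < n) (a k * om (e k) y + b k * om (f k) y).
Proof.
rewrite omega_suml; apply: eq_bigr => k _; by rewrite omDl !omegaZl.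
Qed.

Lemma pair_default L k : (size L <= k)%N -> pair_e L k = 0 /\ pair_f L k = 0.
Proof. by move=> h; rewrite /pair_e /pair_f nth_default. Qed.

Lemma pcomb_e L n a b j : hyperbolic L -> (n <= size L)%N ->
  om (pcomb (pair_e L) (pair_f L) n a b) (pair_e L j) = if (j < n)%N then - b j else 0.
Proof.
move=> hL nL; rewrite omega_pcomb.
under eq_bigr => k _.
  rewrite (omega_skew c_skew (pair_f L k)).
  have [-> _ _] := hL k j; have [_ _ ->] := hL j k.
  rewrite mulr0 add0r; over.
case: (ltnP j n) => jn.
  rewrite (bigD1 (Ordinal jn)) //= eqxx (leq_trans jn nL) mulrN1 big1 ?addr0 // => i.
  rewrite -val_eqE /= eq_sym => /negbTE ->; by rewrite oppr0 mulr0.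
by rewrite big1 // => i _; rewrite gtn_eqF ?oppr0 ?mulr0 // (leq_trans (ltn_ord i)).
Qed.

Lemma pcomb_f L n a b j : hyperbolic L -> (n <= size L)%N ->
  om (pcomb (pair_e L) (pair_f L) n a b) (pair_f L j) = if (j < n)%N then a j else 0.
Proof.
move=> hL nL; rewrite omega_pcomb.
under eq_bigr => k _.
  have [_ -> _] := hL k j; have [_ _ ->] := hL k j.
  rewrite mulr0 addr0; over.
case: (ltnP j n) => jn.
  rewrite (bigD1 (Ordinal jn)) //= eqxx (leq_trans jn nL) mulr1 big1 ?addr0 // => i.
  rewrite -val_eqE /= => /negbTE ->; by rewrite mulr0.
by rewrite big1 // => i _; rewrite ltn_eqF ?mulr0 // (leq_trans (ltn_ord i)).
Qed.

Lemma residue_orth L x j : hyperbolic L ->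
  om (residue L x) (pair_e L j) = 0 /\ om (residue L x) (pair_f L j) = 0.
Proof.
move=> hL; rewrite /residue !omDl !omNl pcomb_e // pcomb_f //.
case: ltnP => h; first by rewrite opprK !subrr.
by have [-> ->] := pair_default h; rewrite omega0r // subr0.
Qed.

Lemma covers_cat L L' x : covers L x -> covers (L ++ L') x.
Proof.
move=> [a [b h]].
exists (fun k => if (k < size L)%N then a k else 0),
  (fun k => if (k < size L)%N then b k else 0).
suff -> : pcomb (pair_e (L ++ L')) (pair_f (L ++ L')) (size (L ++ L'))
  (fun k => if (k < size L)%N then a k else 0)
  (fun k => if (k < size L)%N then b k else 0) =
  pcomb (pair_e L) (pair_f L) (size L) a b by [].
rewrite /pcomb size_cat big_split_ord /= [X in _ + X]big1 ?addr0 => [|k _].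
  apply: eq_bigr => k _; rewrite /= ltn_ord /pair_e /pair_f nth_cat ltn_ord //.
by rewrite ltnNge leq_addr /= !scale0r addr0.
Qed.

(** The residue of [x] is the new e. It pairs nontrivially with some y; being orthogonal to the old
    pairs, it pairs equally with the residue of y, which after rescaling is the new f. *)
Lemma hyperbolic_rcons L x : hyperbolic L -> ~ K (residue L x) ->
  exists ef, hyperbolic (rcons L ef) /\ covers (rcons L ef) x.
Proof.
move=> hL nK; set e' := residue L x.
have [y hy] : exists y, om e' y != 0.
  apply: contrapT => h; apply: nK => y; apply: contrapT => hy; apply: h.
  by exists y; apply/eqP.
have e'y : om e' (residue L y) = om e' y.
  rewrite (omega_skew c_skew) /residue omDl omNl omega_pcomb big1 => [|k _].
    by rewrite subr0 -(omega_skew c_skew).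
  rewrite !(omega_skew c_skew _ e'); have [-> ->] := residue_orth x k hL.
  by rewrite oppr0 !mulr0 addr0.
pose f' := (om e' y)^-1 *: residue L y.
have e'f' : om e' f' = 1 by rewrite omegaZr // e'y mulVf.
have f'o j : om f' (pair_e L j) = 0 /\ om f' (pair_f L j) = 0.
  by rewrite !omegaZl; have [-> ->] := residue_orth y j hL; rewrite mulr0.
exists (e', f').
have pe k : pair_e (rcons L (e', f')) k =
    if (k < size L)%N then pair_e L k else if k == size L then e' else 0.
  by rewrite /pair_e nth_rcons; case: ltnP => // _; case: eqP.
have pf k : pair_f (rcons L (e', f')) k =
    if (k < size L)%N then pair_f L k else if k == size L then f' else 0.
  by rewrite /pair_f nth_rcons; case: ltnP => // _; case: eqP.
split.
  move=> i j; rewrite !pe !pf size_rcons ltnS.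
  have [hee hff hef] := hL i j.
  have [ro1 ro2] := residue_orth x j hL; have [fo1 fo2] := f'o j.
  have [ro3 ro4] := residue_orth x i hL; have [fo3 fo4] := f'o i.
  have s := omega_skew c_skew.
  have iS : ((i == j) && (i <= size L)%N)%:R =
      (if (i < size L)%N then ((i == j) && (i < size L)%N)%:R else
       if (i == size L) && (j == size L) then 1 else 0) :> 'F_p.
    by case: (ltngtP i (size L)) => [iL|iL|->];
      rewrite ?andbF ?andbT ?(eq_sym _ j) //; case: eqP.
  rewrite iS; clear iS.
  case: (ltngtP i (size L)) => iL; case: (ltngtP j (size L)) => jL;
    rewrite ?hee ?hff ?hef ?iL ?omega0l ?omega0r ?omega_alt ?e'f' ?ro1 ?ro2 ?fo1 ?fo2
      ?(s (pair_e L i) e') ?(s (pair_f L i) f') ?(s (pair_e L i) f') ?ro3 ?fo3 ?fo4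
      ?oppr0 ?eqxx ?andbF //=; by split => //; case: eqP => // ij; lia.
(* By definition of the residue, [x] is the new e plus its old components: coefficient 1 at the new
   e and 0 at the new f. *)
exists (fun k => if k == size L then 1 else om x (pair_f L k)),
  (fun k => if k == size L then 0 else - om x (pair_e L k)).
rewrite /pcomb size_rcons big_ord_recr /= pe pf ltnn eqxx scale1r scale0r addr0.
suff -> : \sum_(i < size L)
   ((if nat_of_ord i == size L then 1 else om x (pair_f L i)) *: pair_e (rcons L (e', f')) i +
    (if nat_of_ord i == size L then 0 else - om x (pair_e L i)) *: pair_f (rcons L (e', f')) i) =
   x - e'.
  by rewrite subrK subrr; exact: ker_omega0.
rewrite /e' /residue subKr; apply: eq_bigr => k _.
by rewrite pe pf ltn_ord ltn_eqF.
Qed.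

Lemma hyperbolic_step L x : hyperbolic L ->
  exists t, hyperbolic (L ++ t) /\ covers (L ++ t) x.
Proof.
move=> hL; have [h|/(hyperbolic_rcons hL)[ef]] := pselect (K (residue L x)).
  exists [::]; rewrite cats0; split=> //.
  by exists (fun k => om x (pair_f L k)), (fun k => - om x (pair_e L k)).
by exists [:: ef]; rewrite cats1.
Qed.

Lemma covers_lin L (t : 'F_p) x y : covers L x -> covers L y -> covers L (t *: x + y).
Proof.
move=> [a [b h]] [a' [b' h']].
exists (fun k => t * a k + a' k), (fun k => t * b k + b' k).
have -> : pcomb (pair_e L) (pair_f L) (size L) (fun k => t * a k + a' k) (fun k => t * b k + b' k)
  = t *: pcomb (pair_e L) (pair_f L) (size L) a b + pcomb (pair_e L) (pair_f L) (size L) a' b'.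
  rewrite /pcomb scaler_sumr -big_split; apply: eq_bigr => k _ /=.
  by rewrite scalerDr !scalerA !scalerDl addrACA.
rewrite opprD addrACA -scalerBr => z; rewrite omDl omegaZl.
by rewrite h h' mulr0 addr0.
Qed.

Lemma covers_all L n x : (forall i, (i < n)%N -> covers L 'X^i) ->
  (size x <= n)%N -> covers L x.
Proof.
move=> h xn; rewrite -[x]coefK poly_def.
elim/big_ind: _ => [|y z hy hz|i _].
- exists (fun=> 0), (fun=> 0); rewrite /pcomb big1 ?subr0 => [|i _]; first exact: ker_omega0.
  by rewrite !scale0r addr0.
- by rewrite -[y]scale1r; exact: covers_lin.
- rewrite -[_ *: _]addr0; apply: covers_lin; first by apply: h; exact: leq_trans xn.
  exists (fun=> 0), (fun=> 0); rewrite /pcomb big1 ?subr0 => [|k _]; first exact: ker_omega0.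
  by rewrite !scale0r addr0.
Qed.

(** The monomials are treated one after the other. Lists are only extended at the end, so a pair
    never changes once it has appeared and an infinite sequence can be read off in the limit. *)
Lemma hyperbolic_chain : exists Ls : nat -> seq (G * G),
  [/\ forall n, hyperbolic (Ls n),
      forall m n, (m <= n)%N -> exists t, Ls n = Ls m ++ t &
      forall n i, (i < n)%N -> covers (Ls n) 'X^i].
Proof.
have stepP (q : {L | hyperbolic L} * nat) : exists L' : {L | hyperbolic L},
    (exists t, sval L' = sval q.1 ++ t) /\ covers (sval L') 'X^(q.2).
  case: q => [[L hL] n] /=; have [t [ht hc]] := hyperbolic_step 'X^n hL.
  by exists (exist _ _ ht); split => //; exists t.
have [step stepE] := choice stepP.
have h0 : hyperbolic [::].
  move=> i j; rewrite /pair_e /pair_f !nth_nil andbF; split; exact: omega0l.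
pose Ls := fix Ls n := if n is m.+1 then step (Ls m, m) else exist _ _ h0.
have mono m n : (m <= n)%N -> exists t, sval (Ls n) = sval (Ls m) ++ t.
  elim: n => [|n IH]; first by rewrite leqn0 => /eqP ->; exists [::]; rewrite cats0.
  rewrite leq_eqVlt => /orP[/eqP ->|]; first by exists [::]; rewrite cats0.
  rewrite ltnS => /IH [t ht]; have [[t' ht'] _] := stepE (Ls n, n).
  by exists (t ++ t'); rewrite /= ht' /= ht catA.
exists (fun n => sval (Ls n)); split => //; first by move=> n; exact: (svalP (Ls n)).
move=> n i iln; have [t ->] := mono _ _ iln; apply: covers_cat.
exact: (stepE (Ls i, i)).2.
Qed.

Lemma pcomb_free L a b n : hyperbolic L -> (n <= size L)%N ->
  K (pcomb (pair_e L) (pair_f L) n a b) -> forall k, (k < n)%N -> a k = 0 /\ b k = 0.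
Proof.
move=> hL nL h k kn; have := h (pair_e L k); have := h (pair_f L k).
rewrite pcomb_e // pcomb_f // kn => -> /eqP; rewrite oppr_eq0 => /eqP ->.
by [].
Qed.

Definition basis_vec L n (i : 'I_(n + n)) : G :=
  match fintype.split i with inl k => pair_e L k | inr k => pair_f L k end.

Lemma basis_vec_comb L n (a : 'I_(n + n) -> 'F_p) (a' b' : nat -> 'F_p) :
  (forall k : 'I_n, a' k = a (lshift n k)) -> (forall k : 'I_n, b' k = a (rshift n k)) ->
  \sum_i a i *: basis_vec L i = pcomb (pair_e L) (pair_f L) n a' b'.
Proof.
move=> ha hb; rewrite big_split_ord /pcomb big_split /=; congr (_ + _).
  apply: eq_bigr => k _; rewrite ha /basis_vec.
  by rewrite (unsplitK (inl k) : fintype.split (lshift n k) = inl k).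
apply: eq_bigr => k _; rewrite hb /basis_vec.
by rewrite (unsplitK (inr k) : fintype.split (rshift n k) = inr k).
Qed.

Definition ext_fun n (a : 'I_n -> 'F_p) (k : nat) : 'F_p :=
  if insub k is Some i then a i else 0.

Lemma ext_funE n (a : 'I_n -> 'F_p) (k : 'I_n) : ext_fun a k = a k.
Proof. by rewrite /ext_fun valK. Qed.

Lemma basis_vec_free L n : hyperbolic L -> (n <= size L)%N ->
  forall a : 'I_(n + n) -> 'F_p, K (\sum_i a i *: basis_vec L i) -> forall i, a i = 0.
Proof.
move=> hL nL a.
rewrite (@basis_vec_comb L n a (ext_fun (fun k => a (lshift n k)))
   (ext_fun (fun k => a (rshift n k)))) => [||]; try by move=> k; rewrite ext_funE.
move=> /(pcomb_free hL nL) h i; rewrite -(splitK i).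
by case: (fintype.split i) => k; have [] := h k (ltn_ord k); rewrite !ext_funE.
Qed.

Lemma covers_quotient_dim L : hyperbolic L -> (forall x, covers L x) ->
  quotient_dim (K : set (Gamma p)) (2 * size L).
Proof.
move=> hL hc; rewrite mul2n -addnn; exists (@basis_vec L (size L)); split.
  exact: (basis_vec_free hL (leqnn _)).
move=> x; have [a [b h]] := hc x.
exists (fun i => match fintype.split i with inl k => a k | inr k => b k end).
rewrite (@basis_vec_comb L _ _ a b) // => k.
  by rewrite (unsplitK (inl k) : fintype.split (lshift _ k) = inl k).
by rewrite (unsplitK (inr k) : fintype.split (rshift _ k) = inr k).
Qed.

(* For a rank 2 m the sequences of pairs are padded with zeros beyond m, so that
   finite and infinite ranks are treated alike. *)
Definition below (r : option nat) k := if r is Some m then (k < m)%N else true.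

(** If the lists have bounded length, one of maximal length is the basis; otherwise the k-th pair is
    taken from any list that is long enough. Counting independent vectors modulo the kernel matches
    the two cases with [r]. *)
Lemma symplectic_basis (r : option nat) : half_rank c r ->
  exists e f : nat -> G,
  [/\ forall k, ~~ below r k -> e k = 0 /\ f k = 0,
      forall i j, [/\ om (e i) (e j) = 0, om (f i) (f j) = 0 &
        om (e i) (f j) = ((i == j) && below r i)%:R] &
      forall x, exists n a b, K (x - pcomb e f n a b)].
Proof.
move=> hr; have [Ls [hyp mono cov]] := hyperbolic_chain.
have KD := @ker_omegaD p c.
have KZ (a : 'F_p) x : K x -> K (a *: x) by move=> hx y; rewrite omegaZl hx mulr0.
have K0 := ker_omega0 c.
have [[M hM]|unb] := pselect (exists M, forall n, (size (Ls n) <= M)%N).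
  have [n hn] : exists n, forall k, (size (Ls k) <= size (Ls n))%N.
    elim: M hM => [|M IH] hM.
      by exists 0%N => k; have := hM k; rewrite leqn0 => /eqP ->.
    have [h|/existsNP [n hn]] := pselect (forall n, (size (Ls n) <= M)%N); first exact: IH.
    by exists n => k; apply: leq_trans (hM k) _; rewrite ltnNge; apply/negP.
  (* Later lists extend [Ls n] without being longer, hence are equal to it, so it covers every
     monomial. *)
  have all_cov x : covers (Ls n) x.
    pose m := maxn n (size x); have [t ht] := mono n m (leq_maxl _ _).
    have t0 : t = [::].
      apply: size0nil; have := hn m; rewrite ht size_cat -[leqRHS]addn0 leq_add2l.
      by rewrite leqn0 => /eqP.
    have <- : Ls m = Ls n by rewrite ht t0 cats0.
    exact: (@covers_all _ m _ (@cov m) (leq_maxr _ _)).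
  have qd := covers_quotient_dim (hyp n) all_cov.
  case: r hr => [m|] /= hr; last by have := hr _ qd.
  have sm : size (Ls n) = m.
    have := quotient_dim_unique (V := Gamma p) K0 KD KZ qd hr.
    by move=> /eqP; rewrite eqn_mul2l /= => /eqP.
  exists (pair_e (Ls n)), (pair_f (Ls n)); split.
  - by move=> k; rewrite -leqNgt -sm; exact: pair_default.
  - by move=> i j; rewrite -sm; exact: hyp.
  - by move=> x; have [a [b h]] := all_cov x; exists (size (Ls n)), a, b.
have big k : exists n, (k < size (Ls n))%N.
  apply: contrapT => h; apply: unb; exists k => n; rewrite leqNgt; apply/negP => kn.
  by apply: h; exists n.
have [N hN] := choice big.
case: r hr => [m|] /= hr.
  (* The first m + 1 pairs give 2 m + 2 vectors independent modulo the kernel, too many for rank 2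
     m. *)
  have := quotient_indep_le (V := Gamma p) K0 KD KZ hr (basis_vec_free (hyp (N m)) (hN m)).
  by rewrite addnn -mul2n leq_mul2l ltnn.
have same n n' k : (k < size (Ls n))%N -> (n <= n')%N ->
    nth (0, 0) (Ls n') k = nth (0, 0) (Ls n) k.
  by move=> kn nn'; have [t ->] := mono _ _ nn'; rewrite nth_cat kn.
have nthE n k : (k < size (Ls n))%N ->
    nth (0, 0) (Ls n) k = nth (0, 0) (Ls (N k)) k.
  move=> kn; case/orP: (leq_total n (N k)) => h; first by rewrite (same n (N k)).
  by rewrite (same (N k) n).
exists (fun k => pair_e (Ls (N k)) k), (fun k => pair_f (Ls (N k)) k); split => //.
- move=> i j; pose n := maxn (N i) (N j).
  have hi := same _ n i (hN i) (leq_maxl _ _).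
  have hj := same _ n j (hN j) (leq_maxr _ _).
  have [t ht] := mono _ _ (leq_maxl (N i) (N j)).
  have := hyp n i j; rewrite /pair_e /pair_f hi hj.
  have -> : (i < size (Ls n))%N by rewrite ht size_cat ltn_addr.
  by [].
- move=> x; have [a [b h]] := covers_all (@cov (size x)) (leqnn _).
  exists (size (Ls (size x))), a, b.
  suff -> : pcomb (fun k => pair_e (Ls (N k)) k) (fun k => pair_f (Ls (N k)) k)
      (size (Ls (size x))) a b =
    pcomb (pair_e (Ls (size x))) (pair_f (Ls (size x))) (size (Ls (size x))) a b by [].
  by apply: eq_bigr => k _; rewrite /pair_e /pair_f (nthE (size x)).
Qed.

End SymplecticBasis.

(** * The trace on the symplectic part *)

Section Trace.
Variables (R : realType) (p : nat) (c : nat -> nat -> 'F_p).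
Hypotheses (p_prime : prime p) (c_skew : skew_symmetric c).
Variables (A : cstarAlgType R) (u : nat -> A).
Hypothesis rel : relations c u.
Local Notation om := (omega c).
Local Notation chi := (@chi R p).
Local Notation w := (@word R p A u).
Local Notation G := {poly 'F_p}.
Local Notation avgs := (avgs u).
Implicit Types (x y z : G) (a b : A).

Variables (e f : nat -> G) (r : option nat).
Hypothesis ef_default : forall k, ~~ below r k -> e k = 0 /\ f k = 0.
Hypothesis ef_hyp : forall i j,
  [/\ om (e i) (e j) = 0, om (f i) (f j) = 0 &
      om (e i) (f j) = ((i == j) && below r i)%:R].

Definition pspan n : set G := [set x | exists a b : nat -> 'F_p, x = pcomb e f n a b].
Definition pspan_all : set G := [set x | exists n, pspan n x].

Lemma pcombD n (a b a' b' : nat -> 'F_p) :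
  pcomb e f n a b + pcomb e f n a' b' =
  pcomb e f n (fun k => a k + a' k) (fun k => b k + b' k).
Proof.
rewrite -big_split; apply: eq_bigr => k _ /=.
by rewrite !scalerDl addrACA.
Qed.

Lemma pcombN n (a b : nat -> 'F_p) :
  - pcomb e f n a b = pcomb e f n (fun k => - a k) (fun k => - b k).
Proof. by rewrite -sumrN; apply: eq_bigr => k _; rewrite opprD !scaleNr. Qed.

Lemma pspanS n x : pspan n x -> pspan n.+1 x.
Proof.
move=> [a [b ->]].
exists (fun k => if (k < n)%N then a k else 0), (fun k => if (k < n)%N then b k else 0).
rewrite /pcomb big_ord_recr /= ltnn !scale0r !addr0; apply: eq_bigr => k _.
by rewrite ltn_ord.
Qed.

Lemma pspan_mono m n x : (m <= n)%N -> pspan m x -> pspan n x.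
Proof. by move=> /subnK <-; elim: (n - m)%N => // k IH /IH; exact: pspanS. Qed.

Lemma pspan_subgroup n : subgroup (pspan n).
Proof.
split=> [|x y [a [b ->]] [a' [b' ->]]|x [a [b ->]]].
- exists (fun=> 0), (fun=> 0); rewrite /pcomb big1 // => k _.
  by rewrite !scale0r addr0.
- by rewrite pcombD; eexists; eexists.
- by rewrite pcombN; eexists; eexists.
Qed.

Lemma pspan_all_subgroup : subgroup pspan_all.
Proof.
split=> [|x y [m hx] [n hy]|x [n hx]].
- by exists 0%N; have [] := pspan_subgroup 0.
- exists (maxn m n); have [_ h _] := pspan_subgroup (maxn m n).
  by apply: h; [apply: pspan_mono hx|apply: pspan_mono hy]; rewrite ?leq_maxl ?leq_maxr.
- by exists n; have [_ _ h] := pspan_subgroup n; exact: h.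
Qed.

Lemma pspan_e k : pspan_all (e k).
Proof.
exists k.+1, (fun i => (i == k)%:R), (fun=> 0).
rewrite /pcomb big_ord_recr /= eqxx scale1r scale0r addr0 big1 ?add0r // => i _.
by rewrite ltn_eqF // !scale0r addr0.
Qed.

Lemma pspan_f k : pspan_all (f k).
Proof.
exists k.+1, (fun=> 0), (fun i => (i == k)%:R).
rewrite /pcomb big_ord_recr /= eqxx scale1r scale0r add0r big1 ?add0r // => i _.
by rewrite ltn_eqF // !scale0r addr0.
Qed.

Lemma om_pcomb_e n (a b : nat -> 'F_p) k : om (pcomb e f n a b) (e k) =
  if (k < n)%N && below r k then - b k else 0.
Proof.
rewrite omega_pcomb; under eq_bigr => i _.
  rewrite (omega_skew c_skew (f i)); have [-> _ _] := ef_hyp i k.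
  have [_ _ ->] := ef_hyp k i; rewrite mulr0 add0r; over.
case: (ltnP k n) => kn /=; last first.
  by rewrite big1 // => i _; rewrite gtn_eqF ?oppr0 ?mulr0 // (leq_trans (ltn_ord i)).
rewrite (bigD1 (Ordinal kn)) //= eqxx big1 ?addr0 => [|i].
  by case: (below r k); rewrite ?mulrN1 ?oppr0 ?mulr0.
by rewrite -val_eqE /= eq_sym => /negbTE ->; rewrite oppr0 mulr0.
Qed.

Lemma om_pcomb_f n (a b : nat -> 'F_p) k : om (pcomb e f n a b) (f k) =
  if (k < n)%N && below r k then a k else 0.
Proof.
rewrite omega_pcomb; under eq_bigr => i _.
  have [_ -> _] := ef_hyp i k.
  have [_ _ ->] := ef_hyp i k; rewrite mulr0 addr0; over.
case: (ltnP k n) => kn /=; last first.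
  by rewrite big1 // => i _; rewrite ltn_eqF ?mulr0 // (leq_trans (ltn_ord i)).
rewrite (bigD1 (Ordinal kn)) //= eqxx big1 ?addr0 => [|i].
  by case: (below r k); rewrite ?mulr1 ?mulr0.
by rewrite -val_eqE /= => /negbTE ->; rewrite mulr0.
Qed.

Definition prange m n : seq G := flatten [seq [:: e k; f k] | k <- iota m (n - m)].

Lemma all_prange m n (q : pred G) :
  all q (prange m n) = [forall k : 'I_n, (m <= k)%N ==> q (e k) && q (f k)].
Proof.
apply/allP/forallP => [h k|h y /flatten_mapP[k]].
  apply/implyP => mk; apply/andP; split; apply: h; apply/flatten_mapP; exists (nat_of_ord k);
    by rewrite ?inE ?eqxx ?orbT // mem_iota mk /= subnKC ?ltn_ord // (leq_trans mk (ltnW (ltn_ord k))).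
rewrite mem_iota => /andP[mk kn]; have kn' : (k < n)%N by lia.
have := h (Ordinal kn'); rewrite /= mk => /andP[qe qf].
by rewrite !inE => /orP[] /eqP ->.
Qed.

Lemma pspan_orth m n x : pspan m x -> all (fun y => om x y == 0) (prange m n).
Proof.
move=> [a [b ->]]; rewrite all_prange; apply/forallP => k; apply/implyP => mk.
by rewrite om_pcomb_e om_pcomb_f ltnNge mk /= eqxx.
Qed.

(** Pairing with f_k and e_k reads off the coefficients of the k-th pair up to sign. Above the rank
    nothing can be read off, but there both vectors are zero. *)
Lemma orth_pspan m n x : (m <= n)%N -> pspan n x ->
  all (fun y => om x y == 0) (prange m n) -> pspan m x.
Proof.
move=> mn [a [b ->]]; rewrite all_prange => /forallP h; exists a, b.
rewrite /pcomb -!(big_mkord xpredT (fun k => a k *: e k + b k *: f k)).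
rewrite [LHS](big_cat_nat (n := m)) //= [X in _ + X]big1_seq ?addr0 // => k.
rewrite mem_index_iota => /andP[_ /andP[mk kn]].
have := h (Ordinal kn); rewrite /= mk /= om_pcomb_e om_pcomb_f kn /=.
case: (boolP (below r k)) => [_|/ef_default [-> ->] _].
  by rewrite oppr_eq0 => /andP[/eqP -> /eqP ->]; rewrite !scale0r addr0.
by rewrite !scaler0 addr0.
Qed.

Lemma pspan0 x : pspan 0 x -> x = 0.
Proof. by move=> [a [b ->]]; rewrite /pcomb big_ord0. Qed.

(** Finiteness of the field of scalars; the length of this list calibrates the estimate in
    [faithful]. *)
Lemma pspan_finite n : exists L : seq G, forall x, pspan n x -> x \in L.
Proof.
elim: n => [|n [L hL]]; first by exists [:: 0] => x /pspan0 ->; rewrite inE.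
exists [seq x + (t.1 *: e n + t.2 *: f n) | x <- L, t <- enum [set: 'F_p * 'F_p]].
move=> _ [a [b ->]]; rewrite /pcomb big_ord_recr /=; apply/allpairsP.
exists (pcomb e f n a b, (a n, b n)) => /=; split => //.
  by apply: hL; exists a, b.
by rewrite mem_enum inE.
Qed.

Lemma pspan_bound (l : seq G) : (forall x, x \in l -> pspan_all x) ->
  exists n, forall x, x \in l -> pspan n x.
Proof.
elim: l => [|x l IH] h; first by exists 0%N.
have [|n hn] := IH; first by move=> y yl; apply: h; rewrite inE yl orbT.
have [m hm] := h x (mem_head _ _); exists (maxn m n) => y; rewrite inE.
case/orP => [/eqP ->|/hn]; last by apply: pspan_mono; exact: leq_maxr.
by apply: pspan_mono hm; exact: leq_maxl.
Qed.

Lemma avgs_prange_word m n x : (m <= n)%N -> pspan n x ->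
  avgs (prange m n) (w x) = if `[< pspan m x >] then w x else 0.
Proof.
move=> mn hx; rewrite (avgs_word p_prime rel); case: asboolP => h.
  by rewrite pspan_orth.
by case: ifP => // /(orth_pspan mn hx).
Qed.

Let W := words u pspan_all.

(** On a finite sum of words the averages are eventually constant, equal to the coefficient of the
    empty word. Contractivity makes these coefficients a Cauchy sequence along any approximation of
    [a], and their limit is the trace. *)
Lemma scalar_limit a : closed_span W a ->
  exists t : R[i], nlim (fun m => avgs (prange 0 m) a) (t *: 1).
Proof.
have step v : lin_span W v ->
    exists (t : R[i]) N, forall m, (N <= m)%N -> avgs (prange 0 m) v = t *: 1.
  move: v; apply: lin_span_ind.
  - by exists 0, 0%N => m _; rewrite avgs0 // scale0r.
  - move=> s v v' [t [N h]] [t' [N' h']]; exists (s * t + t'), (maxn N N') => m.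
    rewrite geq_max => /andP[/h h1 /h' h2].
    by rewrite avgs_lin // h1 h2 scalerA scalerDl.
  - move=> _ [x [n hx] <-]; exists (x == 0)%:R, n => m nm.
    rewrite avgs_prange_word //; last exact: pspan_mono hx.
    case: asboolP => [/pspan0 ->|h]; first by rewrite eqxx scale1r word0.
    case: eqP => [x0|]; last by rewrite scale0r.
    by case: h; rewrite x0; have [] := pspan_subgroup 0.
move=> /closure_nlim [v vW va].
have [t ht] := choice (fun n => step (v n) (vW n)).
have tE m n : normc (t m - t n) <= nm (v m - v n).
  have [M hM] := ht m; have [N hN] := ht n.
  have := hM _ (leq_maxl M N); have := hN _ (leq_maxr M N) => h2 h1.
  rewrite -(nm_scalar A) scalerBl -h1 -h2 -avgsB //; exact: (avgs_nm p_prime rel).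
have [|s hs] := @complex_cauchy _ t.
  move=> d d0; have d2 : 0 < d / 2 by rewrite divr_gt0.
  have [N hN] := va _ d2; exists N => m n Nm Nn; apply: le_lt_trans (tE m n) _.
  have := nm_triangle a (v m) (v n); have := hN _ Nm; have := hN _ Nn.
  by rewrite (nmB (v n) a); lra.
exists s => d d0; have d3 : 0 < d / 3 by rewrite divr_gt0.
have [N1 h1] := va _ d3; have [N2 h2] := hs _ d3; pose n := maxn N1 N2.
have [N3 h3] := ht n; exists N3 => m /h3 hm.
have l1 := h1 n (leq_maxl _ _); have l2 := h2 n (leq_maxr _ _).
have l3 : nm (avgs (prange 0 m) a - t n *: 1) < d / 3.
  rewrite -hm -avgsB //; apply: le_lt_trans (avgs_nm p_prime rel _ _) _.
  by rewrite nmB.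
have := nm_triangle (t n *: 1) (avgs (prange 0 m) a) (s *: 1).
by rewrite -scalerBl nm_scalar; lra.
Qed.

Lemma lin_span_pspan v : lin_span W v -> exists n, lin_span (words u (pspan n)) v.
Proof.
have mono m n : (m <= n)%N -> lin_span (words u (pspan m)) `<=` lin_span (words u (pspan n)).
  move=> mn; apply: lin_span_ind; first exact: lin_span0.
    by move=> t a b; exact: lin_span_lin.
  by move=> _ [x hx <-]; apply: sub_lin_span; exists x => //; exact: pspan_mono hx.
move: v; apply: lin_span_ind.
- by exists 0%N; exact: lin_span0.
- move=> t v v' [m hm] [n hn]; exists (maxn m n); apply: lin_span_lin.
    exact: (mono _ _ (leq_maxl m n) _ hm).
  exact: (mono _ _ (leq_maxr m n) _ hn).
- by move=> _ [x [n hx] <-]; exists n; apply: sub_lin_span; exists x.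
Qed.

(* The average over the pairs N, ..., M - 1 fixes the words of the first N pairs
   and kills all the other words of the first M pairs: it compresses a to a
   finite-dimensional algebra, where a is determined by its coefficients. *)
Lemma faithful a : closed_span W a ->
  (forall x, pspan_all x -> nlim (fun m => avgs (prange 0 m) (a * w x)) 0) -> a = 0.
Proof.
move=> /closureP aW hx; apply: nm_eps => d d0.
(* The final count is at most d' for [a - a0], then 2 d' for [a0 - a1] and 2 d' for the average of
   [a1]. *)
pose d' := d / 5; have d'0 : 0 < d' by rewrite divr_gt0.
have [a0 a0W a0a] := aW _ d'0.
have [N hN] := lin_span_pspan a0W; have [L hL] := pspan_finite N.
(* After averaging, at most [size L] words of [a1] survive, each with a coefficient at most 2 d' /
   n1, for a total at most 2 d'. The successor avoids a division by 0. [N] and [L] come from [a0],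
   so they are fixed before [a1] is chosen. *)
pose n1 : R := (size L).+1%:R.
have n10 : 0 < n1 by rewrite ltr0Sn.
have g0 : 0 < d' / n1 by rewrite divr_gt0.
have [a1 a1W a1a] := aW _ g0.
have [l [t [ul lS a1E]]] := lin_span_wordsP a1W.
have [M0 hM0] := pspan_bound lS; pose M := maxn M0 N.
have NM : (N <= M)%N := leq_maxr _ _.
have hM x : x \in l -> pspan M x by move=> /hM0; apply: pspan_mono; exact: leq_maxl.
(* Up to a phase, [t x] is an average of [a1 * w (- x)]. It differs from the same average of
   [a * w (- x)] by less than d' / n1, and the latter is eventually below d' / n1 by hypothesis. *)
have coef x : x \in l -> normc (t x) <= 2 * (d' / n1).
  move=> xl; have [_ PD PN] := pspan_subgroup M.
  have hNx : pspan_all (- x) by exists M; apply: PN; exact: hM.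
  have [M1 hM1] := hx _ hNx _ g0; pose m := maxn M M1.
  have PM z : pspan M z -> pspan m z by apply: pspan_mono; exact: leq_maxl.
  have e1 : exists q : 'F_p, avgs (prange 0 m) (a1 * w (- x)) = (t x * chi q) *: 1.
    rewrite a1E mulr_suml avgs_sum //.
    have [q hq] := word_mul p_prime rel x (- x); exists q.
    rewrite (bigD1_seq x) //= -scalerAl hq avgsZ // avgsZ // subrr word0.
    rewrite -(@word0 R p A u) avgs_prange_word //; last by have [] := pspan_subgroup m.
    rewrite asboolT; last by have [] := pspan_subgroup 0.
    rewrite scalerA big_seq_cond big1 ?addr0 // => z /andP[zl zx].
    have [q' hq'] := word_mul p_prime rel z (- x).
    rewrite -scalerAl hq' avgsZ // avgsZ // avgs_prange_word //; last first.
      by apply: PM; apply: PD; [exact: hM|apply: PN; exact: hM].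
    case: asboolP => [/pspan0 /eqP|_]; last by rewrite !scaler0.
    by rewrite subr_eq0 (negbTE zx).
  have [q hq] := e1.
  have -> : normc (t x) = nm (avgs (prange 0 m) (a1 * w (- x))).
    by rewrite hq nm_scalar normcM chi_unit mulr1.
  have := hM1 m (leq_maxr _ _); rewrite subr0.
  have := nm_triangle (avgs (prange 0 m) (a * w (- x))) (avgs (prange 0 m) (a1 * w (- x))) 0.
  rewrite !subr0 -avgsB // -mulrBl.
  have := avgs_nm p_prime rel (prange 0 m) ((a1 - a) * w (- x)).
  have := nmM (a1 - a) (w (- x)); rewrite (nm_unitary (word_unitary rel _)) mulr1.
  have a1a' : nm (a1 - a) < d' / n1 by rewrite nmB.
  move: a1a'; move: (d' / n1) (nm (a1 - a)) (nm _) (nm _) (nm _) => q1 q2 q3 q4 q5; lra.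
have fix0 : avgs (prange N M) a0 = a0.
  have [l0 [t0 [_ l0S ->]]] := lin_span_wordsP hN.
  rewrite avgs_sum // big_seq [RHS]big_seq; apply: eq_bigr => x xl.
  rewrite avgsZ // avgs_prange_word //; last exact: pspan_mono (l0S _ xl).
  by rewrite asboolT //; exact: l0S.
have small : nm (avgs (prange N M) a1) <= 2 * d'.
  rewrite a1E avgs_sum //.
  have -> : \sum_(x <- l) avgs (prange N M) (t x *: w x) =
      \sum_(x <- [seq x <- l | x \in L]) (if `[< pspan N x >] then t x *: w x else 0).
    rewrite big_filter [RHS]big_mkcond; apply: eq_big_seq => x xl.
    rewrite avgsZ // avgs_prange_word //; last exact: hM.
    by case: asboolP => [/hL -> //|_]; rewrite scaler0; case: ifP.
  apply: le_trans (nm_sum _ _ _) _.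
  apply: (@le_trans _ _ (\sum_(x <- [seq x <- l | x \in L]) 2 * (d' / n1))).
    rewrite big_seq [X in _ <= X]big_seq; apply: ler_sum => x.
    rewrite mem_filter => /andP[_ xl]; case: asboolP => _; last first.
      by rewrite nm0 mulr_ge0 // ltW.
    by rewrite nmZ (nm_unitary (word_unitary rel _)) mulr1 coef.
  rewrite big_const_seq count_predT iter_addr_0 -mulrnAr ler_wpM2l //.
  rewrite -mulr_natr -mulrA -[leRHS]mulr1 ler_wpM2l ?(ltW d'0) //.
  rewrite ler_pdivrMl // mulr1 /n1 ler_nat.
  apply: leq_trans (leqnSn _); apply: uniq_leq_size; first exact: filter_uniq.
  by move=> x; rewrite mem_filter => /andP[].
have h1 : nm (avgs (prange N M) (a0 - a1)) <= nm (a0 - a1) := avgs_nm p_prime rel _ _.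
rewrite avgsB // fix0 in h1.
have h2 := nm_triangle a a0 a1; rewrite (nmB a0 a) in h2.
have h3 : d' / n1 <= d' by rewrite ler_pdivrMr // ler_peMr ?(ltW d'0) // ler1n.
have h4 := nmD (a - a0) a0; rewrite subrK in h4.
have h5 := nmD (a0 - avgs (prange N M) a1) (avgs (prange N M) a1); rewrite subrK in h5.
have h6 : 5 * d' = d by rewrite /d' mulrC divfK.
move: a0a a1a h1 h2 h3 h4 h5 h6 small; clear; move: (d' / n1) (nm _) (nm _) (nm _).
by move: (nm _) (nm _) (nm _) => *; lra.
Qed.

Lemma ideal_scalar J a : closed_ideal J -> J a -> closed_span W a ->
  (forall x, pspan_all x -> closed_span W (a * w x)) ->
  ~ J 1 -> a = 0.
Proof.
move=> hJ Ja aW awW J1; apply: faithful => // x hx.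
have [t ht] := scalar_limit (awW _ hx).
have [Jc J0 Jl JM] := hJ.
have Jt : J (t *: 1).
  apply: (closed_nlim Jc _ ht) => m; apply: avgs_ideal => //.
  exact: (JM a (w x) Ja).2.
have [t0|t0] := eqVneq t 0; first by rewrite t0 scale0r in ht.
case: J1; rewrite -[1]addr0 -[1]scale1r -(mulVf t0) -scalerA.
exact: Jl.
Qed.

Lemma simple_of_symplectic :
  (forall a, closed_span (words u (fun _ : G => True)) a) ->
  (forall x, pspan_all x) -> simple_cstar A.
Proof.
move=> gen all_x J hJ; have WE : W = words u (fun _ : G => True).
  by rewrite /W; congr (words u _); apply/seteqP; split.
have [J1|J1] := pselect (J 1).
  right; apply/seteqP; split=> // a _; have [_ _ _ JM] := hJ.
  by have [] := JM 1 a J1; rewrite mulr1.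
left; apply/seteqP; split=> [a Ja|_ ->]; last by case: hJ.
have gW b : closed_span W b by rewrite WE; exact: gen.
exact: (ideal_scalar hJ Ja (gW a) (fun _ _ => gW _)).
Qed.

End Trace.

(** * Matrix units *)

Section SpectralProjections.
Variables (R : realType) (p : nat).
Hypothesis p_prime : prime p.
Variable A : cstarAlgType R.
Local Notation chi := (@chi R p).
Local Notation F := 'F_p.
Implicit Types (a b : A) (i j t : F).

Let p_neq0 : p%:R != 0 :> R[i].
Proof. by rewrite pnatr_eq0 -lt0n prime_gt0. Qed.

Let cardF : #|{: F}| = p.
Proof. exact: card_Fp. Qed.

(** The inverse discrete Fourier transform of the powers of [a], that is, the spectral projection
    for the eigenvalue [chi i]. *)
Definition eproj a i : A := p%:R^-1 *: \sum_(t : F) chi (- (i * t)) *: a ^+ nat_of_ord t.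

(** Orthogonality of characters: multiplying the sum by [chi i] only translates the summation index,
    and [chi i] differs from 1 unless i = 0. *)
Lemma sum_chi_mul (i : F) : \sum_(t : F) chi (i * t) = if i == 0 then p%:R else 0.
Proof.
case: eqP => [->|/eqP i0].
  under eq_bigr do rewrite mul0r chi0.
  by rewrite sumr_const cardF.
apply: (mulfI (x := chi i - 1)).
  by apply: contra i0; rewrite subr_eq0 => /eqP/(chi_eq1 p_prime)/eqP.
rewrite mulr0 mulrBl mul1r mulr_sumr.
under eq_bigr => t _.
  have -> : chi i * chi (i * t) = chi (i * (t + 1)) by rewrite -chiD // mulrDr mulr1 addrC.
  over.
by rewrite [X in _ - X](reindex_inj (addIr 1)) subrr.
Qed.

Variable a : A.
Hypotheses (a_unit : unitary_elt a) (a_p : a ^+ p = 1).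

Let aD s t : a ^+ nat_of_ord (s + t) = a ^+ nat_of_ord s * a ^+ nat_of_ord t.
Proof. exact: expr_Fp. Qed.

Lemma eproj_shift s i : a ^+ nat_of_ord s * eproj a i = chi (i * s) *: eproj a i.
Proof.
rewrite /eproj -scalerAr scalerA mulrC -scalerA; congr (_ *: _).
rewrite mulr_sumr scaler_sumr [RHS](reindex_inj (addrI s)) /=.
apply: eq_bigr => t _; rewrite -scalerAr -aD scalerA.
by rewrite -chiD //; congr (chi _ *: _); ring.
Qed.

Lemma eproj_mul i j : eproj a i * eproj a j = if i == j then eproj a i else 0.
Proof.
rewrite {1}/eproj -scalerAl mulr_suml.
under eq_bigr do rewrite -scalerAl eproj_shift scalerA -chiD // -mulNr -mulrDl.
rewrite -scaler_suml sum_chi_mul addrC subr_eq0 eq_sym.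
case: eqP => [->|]; last by rewrite scale0r scaler0.
by rewrite scalerA mulVf // scale1r.
Qed.

Lemma eproj_idem i : eproj a i * eproj a i = eproj a i.
Proof. by rewrite eproj_mul eqxx. Qed.

Lemma sum_eproj : \sum_i eproj a i = 1.
Proof.
rewrite /eproj -scaler_sumr exchange_big (bigD1 0) //= [X in _ + X]big1 => [|t t0].
  under eq_bigr do rewrite mulr0 oppr0 chi0 expr0 scale1r.
  by rewrite sumr_const cardF addr0 -(scaler_nat p (1 : A)) scalerA mulVf // scale1r.
rewrite -scaler_suml; under eq_bigr do rewrite -mulrN mulrC.
by rewrite sum_chi_mul oppr_eq0 (negbTE t0) scale0r.
Qed.

Lemma star_expr (s : F) : star (a ^+ nat_of_ord s) = a ^+ nat_of_ord (- s).
Proof.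
have := (unitaryX (nat_of_ord s) a_unit).1 => h.
by rewrite -[LHS]mulr1 -(expr0 a) -[0%N]/(nat_of_ord (0 : F)) -(subrr s) aD mulrA h mul1r.
Qed.

Lemma star_eproj i : star (eproj a i) = eproj a i.
Proof.
rewrite /eproj starZ fmorphV rmorph_nat; congr (_ *: _).
rewrite star_sum [RHS](reindex_inj oppr_inj); apply: eq_bigr => t _.
by rewrite starZ star_expr -chiN // mulrN.
Qed.

Lemma sum_chi_eproj (s : F) : a ^+ nat_of_ord s = \sum_i chi (i * s) *: eproj a i.
Proof.
rewrite -[LHS]mulr1 -sum_eproj mulr_sumr.
by apply: eq_bigr => i _; rewrite eproj_shift.
Qed.

(** The commutation relation says that [b] raises the eigenvalue index of [a] by one. *)
Lemma eproj_conj b i : b ^+ p = 1 -> a * b = chi 1 *: (b * a) -> forall s : F,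
  eproj a i * b ^+ nat_of_ord s = b ^+ nat_of_ord s * eproj a (i - s).
Proof.
move=> b_p ab s; rewrite /eproj -scalerAl -scalerAr; congr (_ *: _).
rewrite mulr_suml mulr_sumr; apply: eq_bigr => t _.
rewrite -scalerAl -scalerAr (phase_expl _ (phase_expr _ ab)) scalerA.
rewrite -!chiMn // -chiD //; congr (chi _ *: _).
have -> : (1 : F) *+ nat_of_ord s *+ nat_of_ord t = s * t.
  by rewrite natr_Zp -[s *+ _]mulr_natr natr_Zp.
by ring.
Qed.

Lemma eproj_comm b i : GRing.comm b a -> b * eproj a i = eproj a i * b.
Proof.
move=> ba; rewrite /eproj -scalerAl -scalerAr mulr_suml mulr_sumr.
congr (_ *: _); apply: eq_bigr => t _; rewrite -scalerAl -scalerAr.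
by congr (_ *: _); exact: commrX.
Qed.

End SpectralProjections.

Section MatrixUnits.
Variables (R : realType) (B : starAlgType R) (I : finType).

Record matrix_units (E : I -> I -> B) : Prop := MatrixUnits {
  mu_mul : forall i j k l, E i j * E k l = if j == k then E i l else 0;
  mu_sum : \sum_i E i i = 1;
  mu_star : forall i j, star (E i j) = E j i
}.

Variable E : I -> I -> B.
Hypothesis EM : matrix_units E.

(** Between [E s k] and [E l s] only the entry (k, l) survives, as [E s s * D k l]; the sum over s
    then restores the identity. This extracts entries of a matrix with coefficients commuting with
    the matrix units. *)
Lemma mu_slice (D : I -> I -> B) k l :
  (forall i j i' j', D i j * E i' j' = E i' j' * D i j) ->
  \sum_s E s k * (\sum_i \sum_j E i j * D i j) * E l s = D k l.
Proof.
move=> com.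
transitivity (\sum_s E s s * D k l); last by rewrite -mulr_suml (mu_sum EM) mul1r.
apply: eq_bigr => s _; rewrite mulr_sumr mulr_suml (bigD1 k) //= [X in _ + X]big1 ?addr0 => [|i ik].
  rewrite mulr_sumr mulr_suml (bigD1 l) //= [X in _ + X]big1 ?addr0 => [|j jl].
    by rewrite mulrA (mu_mul EM) eqxx -mulrA com mulrA (mu_mul EM) eqxx.
  by rewrite -!mulrA com !mulrA (mu_mul EM) eqxx (mu_mul EM) (negbTE jl) mul0r.
rewrite mulr_sumr mulr_suml big1 // => j _.
by rewrite !mulrA (mu_mul EM) eq_sym (negbTE ik) !mul0r.
Qed.

Variables (n : nat) (s : 'I_n.-1.+1 -> I).
Hypothesis s_bij : bijective s.

Definition mat_hom (M : Mat R n) : B :=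
  \sum_i \sum_j (M : 'M[R[i]]_(n.-1.+1)) i j *: E (s i) (s j).

Lemma mat_hom_star_hom : star_hom mat_hom.
Proof.
have s_inj := bij_inj s_bij; split.
- move=> a M N; rewrite /mat_hom scaler_sumr -big_split; apply: eq_bigr => i _ /=.
  rewrite scaler_sumr -big_split; apply: eq_bigr => j _ /=.
  by rewrite !mxE scalerDl scalerA.
- move=> M N; rewrite /mat_hom mulr_suml; apply: eq_bigr => i _ /=.
  rewrite mulr_suml; under eq_bigr do rewrite mxE scaler_suml.
  rewrite exchange_big; apply: eq_bigr => j _ /=.
  rewrite mulr_sumr [RHS](bigD1 j) //= [X in _ + X]big1 ?addr0 => [|k kj].
    rewrite mulr_sumr; apply: eq_bigr => l _.
    by rewrite -scalerAl -scalerAr scalerA (mu_mul EM) eqxx.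
  rewrite mulr_sumr big1 // => l _.
  rewrite -scalerAl -scalerAr (mu_mul EM) (inj_eq s_inj) eq_sym (negbTE kj).
  by rewrite !scaler0.
- rewrite /mat_hom -(mu_sum EM) (reindex s) /=; last exact: onW_bij.
  apply: eq_bigr => i _; rewrite (bigD1 i) //= mxE eqxx scale1r big1 ?addr0 // => j ji.
  by rewrite mxE eq_sym (negbTE ji) scale0r.
- move=> M; rewrite /mat_hom exchange_big /=.
  elim/big_rec2: _ => [|i x y _ ->]; first by rewrite -(scale0r (0 : B)) starZ rmorph0 !scale0r.
  rewrite starD; congr (_ + _).
  elim/big_rec2: _ => [|j z t _ ->]; first by rewrite -(scale0r (0 : B)) starZ rmorph0 !scale0r.
  by rewrite starD starZ (mu_star EM) !mxE.
Qed.

Lemma mat_hom_inj : injective mat_hom.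
Proof.
have sl M k l : mat_hom M = 0 -> (M : 'M[R[i]]_(n.-1.+1)) k l = 0.
  move=> M0; have [s' sK s'K] := s_bij.
  have := @mu_slice (fun i j => ((M : 'M[R[i]]_(n.-1.+1)) (s' i) (s' j))%:A) (s k) (s l).
  have -> : \sum_i \sum_j E i j * ((M : 'M[R[i]]_(n.-1.+1)) (s' i) (s' j))%:A = mat_hom M.
    rewrite /mat_hom (reindex s) /=; last exact: onW_bij.
    apply: eq_bigr => i _; rewrite (reindex s) /=; last exact: onW_bij.
    by apply: eq_bigr => j _; rewrite !sK -scalerAr mulr1.
  rewrite M0 big1 => [|i _]; last by rewrite mulr0 mul0r.
  rewrite !sK => /(_ _)/esym h.
  have /eqP : ((M : 'M[R[i]]_(n.-1.+1)) k l)%:A = 0 :> B.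
    by apply: h => i j i' j'; rewrite -scalerAl -scalerAr mulr1 mul1r.
  by rewrite scaler_eq0 oner_eq0 orbF => /eqP.
have [lin _ _ _] := mat_hom_star_hom.
move=> M N /eqP; rewrite -subr_eq0 => /eqP MN.
apply/matrixP => k l; apply/eqP; rewrite -subr_eq0; apply/eqP.
have := sl (M - N) k l; rewrite !mxE; apply.
have -> : M - N = (-1) *: N + M by rewrite scaleN1r addrC.
by rewrite lin scaleN1r addrC.
Qed.

End MatrixUnits.

Section ClockShift.
Variables (R : realType) (p : nat).
Hypothesis p_prime : prime p.
Variables (A : cstarAlgType R) (a b : A).
Local Notation chi := (@chi R p).
Local Notation F := 'F_p.
Hypotheses (a_unit : unitary_elt a) (a_p : a ^+ p = 1).
Hypotheses (b_unit : unitary_elt b) (b_p : b ^+ p = 1).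
Hypothesis ab : a * b = chi 1 *: (b * a).

(** [b ^+ (i - j)] carries the j-th eigenspace of [a] onto the i-th one. *)
Definition clock_shift_unit (i j : F) : A := b ^+ nat_of_ord (i - j) * eproj a j.

Lemma clock_shift_units : matrix_units clock_shift_unit.
Proof.
rewrite /clock_shift_unit; split=> [i j k l||i j].
- rewrite mulrA -(mulrA _ (eproj a j)) (eproj_conj p_prime _ b_p ab) mulrA.
  rewrite -(expr_Fp p_prime) // -mulrA eproj_mul //.
  have -> : (j - (k - l) == l) = (j == k).
    have e : j - (k - l) - l = j - k by ring.
    by rewrite -subr_eq0 e subr_eq0.
  case: eqP => [->|_]; last by rewrite mulr0.
  have -> : k - (k - l) = l by ring.
  by have -> : i - k + (k - l) = i - l by ring.
- by under eq_bigr do rewrite subrr expr0 mul1r; exact: sum_eproj.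
- rewrite starM star_eproj // star_expr // opprB (eproj_conj p_prime _ b_p ab).
  by congr (_ * eproj a _); ring.
Qed.

Lemma clock_shift_a : a = \sum_i chi i *: clock_shift_unit i i.
Proof.
rewrite -[LHS]expr1; have -> : 1%N = nat_of_ord (1 : F).
  by rewrite /= modn_small // (Fp_Zcast p_prime) prime_gt1.
rewrite (sum_chi_eproj p_prime a_p); apply: eq_bigr => i _.
by rewrite /clock_shift_unit subrr expr0 mul1r mulr1.
Qed.

Lemma clock_shift_b : b = \sum_i clock_shift_unit (i + 1) i.
Proof.
rewrite -[LHS]mulr1 -(sum_eproj p_prime a) mulr_sumr; apply: eq_bigr => i _.
rewrite /clock_shift_unit addrAC subrr add0r; congr (_ * _).
Qed.

End ClockShift.

Section LineClosed.
Variables (R : realType) (A : cstarAlgType R).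

(** Lets statements of the form [_ = t *: v] with unspecified [t] pass from a dense subspace to
    limits: the scalars form a Cauchy sequence unless v = 0. *)
Lemma line_closed (v a : A) (f : nat -> A) : (forall n, exists t : R[i], f n = t *: v) ->
  nlim f a -> exists t : R[i], a = t *: v.
Proof.
move=> /choice [t ft] fa; have [v0|v0] := eqVneq (nm v) 0.
  exists 0; rewrite scale0r; apply: (nlim_unique fa).
  apply: nlim_near (nlim_cst _); exists 0%N => n _.
  by rewrite ft (nm_eq0 v0) scaler0.
have vp : 0 < nm v by rewrite lt_neqAle eq_sym v0 nm_ge0.
have [e e0|s hs] := @complex_cauchy _ t.
  have [N hN] := fa _ (divr_gt0 (mulr_gt0 e0 vp) (ltr0n R 2)).
  exists N => m n Nm Nn; rewrite -(ltr_pM2r vp) -nmZ scalerBl -!ft.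
  have := nm_triangle a (f m) (f n); have := hN _ Nm; have := hN _ Nn.
  by rewrite (nmB (f n) a); move: (nm _) (nm _) (nm _) (e * nm v) => q1 q2 q3 q4; lra.
exists s; apply: (nlim_unique fa) => e e0; have [N hN] := hs _ (divr_gt0 e0 vp).
by exists N => n /hN; rewrite ft -scalerBl nmZ ltr_pdivlMr.
Qed.

End LineClosed.

Section NoncommutativeProducts.
Variable A : nzRingType.
Implicit Types (x y : nat -> A).

Lemma comm_prodr n x a : (forall k, (k < n)%N -> GRing.comm a (x k)) ->
  GRing.comm a (\prod_(k < n) x k).
Proof.
move=> h; elim/big_ind: _ => [|b d hb hd|i _]; [exact: commr1|exact: commrM|exact: h].
Qed.

Lemma prod_mul_comm n x y :
  (forall k l, (k < n)%N -> (l < n)%N -> (k != l) -> GRing.comm (x k) (y l)) ->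
  (\prod_(k < n) x k) * (\prod_(k < n) y k) = \prod_(k < n) (x k * y k).
Proof.
elim: n => [|n IH] h; first by rewrite !big_ord0 mulr1.
rewrite !big_ord_recr /= -IH; last by move=> k l kn ln; apply: h; exact: ltnW.
rewrite mulrA -(mulrA _ (x n)) (_ : x n * _ = (\prod_(k < n) y k) * x n) ?mulrA //.
by apply: comm_prodr => k kn; apply: h => //; [exact: ltnW|rewrite gtn_eqF].
Qed.

Lemma prodr_zero n x k : (k < n)%N -> x k = 0 -> \prod_(k < n) x k = 0.
Proof.
elim: n => // n IH; rewrite ltnS leq_eqVlt big_ord_recr /=.
by move=> /orP[/eqP ->|/IH h] xk; rewrite ?xk ?mulr0 // h ?mul0r.
Qed.

End NoncommutativeProducts.

Section LinIndepDual.
Variables (F : fieldType) (m n : nat) (I : finType) (a : I -> 'M[F]_(m, n)).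

(** Written as rows, independent matrices form a row-free matrix; the columns of a right inverse are
    the dual family for the entrywise pairing. *)
Lemma lin_indep_dual : lin_indep a -> exists b : I -> 'M[F]_(m, n),
  forall i i', \sum_k \sum_l b i' k l * a i k l = (i == i')%:R.
Proof.
move=> ha; pose M : 'M[F]_(#|I|, m * n) := \matrix_i mxvec (a (enum_val i)).
have /row_freeP [N MN] : row_free M.
  apply: inj_row_free => v vM; apply/rowP => i; rewrite mxE.
  rewrite -(enum_valK i); set j := enum_val i.
  apply: (ha (fun j => v 0 (enum_rank j))).
  rewrite -[RHS](linear0 (@vec_mx F m n)) -vM mulmx_sum_row linear_sum /=.
  rewrite (reindex_onto enum_rank enum_val) => [|k _]; last exact: enum_valK.
  apply: eq_big => [k|k _]; first by rewrite enum_rankK eqxx.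
  by rewrite linearZ /= rowK mxvecK enum_rankK.
exists (fun i' => vec_mx (col (enum_rank i') N)^T) => i i'.
have := congr1 (fun Q : 'M[F]_#|I| => Q (enum_rank i) (enum_rank i')) MN.
rewrite !mxE (inj_eq enum_rank_inj) => <-.
rewrite pair_bigA /= (reindex _ (curry_mxvec_bij m n)) /=.
apply: eq_bigr => -[k l] _ /=.
by rewrite !mxE /= enum_rankK mxvecE mulrC.
Qed.

End LinIndepDual.

Section MatSlice.
Variables (R : realType) (B : starAlgType R) (J : finType) (E : J -> J -> B).
Hypothesis EM : matrix_units E.
Variables (n : nat) (s : 'I_n.-1.+1 -> J).
Hypothesis s_bij : bijective s.

(** The core of tensor injectivity: slicing gives [\sum_i (a i) k l *: D i = 0] for each entry, and
    the dual family of the [a i] isolates every [D i]. *)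
Lemma mat_hom_indep (I : finType) (a : I -> Mat R n) (D : I -> B) :
  (forall i j k, D i * E j k = E j k * D i) -> lin_indep a ->
  \sum_i D i * mat_hom E s (a i) = 0 -> forall i, D i = 0.
Proof.
move=> com /lin_indep_dual [b hb] D0 i0; have [s' sK s'K] := s_bij.
have kl k l : \sum_i (a i : 'M[R[i]]_(n.-1.+1)) k l *: D i = 0.
  pose D' x y := \sum_i (a i : 'M[R[i]]_(n.-1.+1)) (s' x) (s' y) *: D i.
  have := @mu_slice _ _ _ _ EM D' (s k) (s l).
  have -> : \sum_x \sum_y E x y * D' x y = 0.
    rewrite -[RHS]D0 [LHS](reindex s) /=; last exact: onW_bij.
    under eq_bigr => x _.
      rewrite (reindex s) /=; last exact: onW_bij.
      under eq_bigr => y _.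
        rewrite /D' mulr_sumr.
        under eq_bigr => i _ do rewrite -scalerAr -com !sK scalerAr.
        over.
      over.
    under eq_bigr => x _ do rewrite exchange_big.
    rewrite exchange_big; apply: eq_bigr => i _ /=.
    rewrite /mat_hom mulr_sumr; apply: eq_bigr => x _.
    by rewrite mulr_sumr.
  rewrite big1 => [|x _]; last by rewrite mulr0 mul0r.
  rewrite /D' !sK => h; apply/esym/h => i j i' j'.
  rewrite mulr_suml mulr_sumr; apply: eq_bigr => x _.
  by rewrite -scalerAl -scalerAr com.
transitivity (\sum_i (i == i0)%:R *: D i).
  rewrite (bigD1 i0) //= eqxx scale1r big1 ?addr0 // => i /negbTE ->.
  by rewrite scale0r.
under eq_bigr => i _ do rewrite -hb scaler_suml.
rewrite exchange_big big1 // => k _ /=.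
under eq_bigr => i _ do rewrite scaler_suml.
rewrite exchange_big big1 // => l _ /=.
under eq_bigr => i _ do rewrite -scalerA.
by rewrite -scaler_sumr kl scaler0.
Qed.

Lemma mat_hom_comm x M : (forall i j, GRing.comm x (E i j)) ->
  GRing.comm x (mat_hom E s M).
Proof.
move=> h; rewrite /mat_hom; apply: commr_sum => i _; apply: commr_sum => j _.
by rewrite /GRing.comm -scalerAl -scalerAr h.
Qed.

Lemma mat_hom_onto (D : J -> J -> R[i]) :
  exists M, mat_hom E s M = \sum_i \sum_j D i j *: E i j.
Proof.
exists (\matrix_(i, j) D (s i) (s j)); rewrite [RHS](reindex s) /=; last exact: onW_bij.
apply: eq_bigr => i _; rewrite [RHS](reindex s) /=; last exact: onW_bij.
by apply: eq_bigr => j _; rewrite mxE.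
Qed.

End MatSlice.

Lemma exists_index_bij (I : finType) n : (0 < n)%N -> #|I| = n ->
  exists s : 'I_n.-1.+1 -> I, bijective s.
Proof.
move=> n0 cI; have e : n.-1.+1 = #|I| by rewrite cI prednK.
exists (fun i => enum_val (cast_ord e i)).
exists (fun x => cast_ord (esym e) (enum_rank x)) => x.
  by rewrite enum_valK cast_ordK.
by rewrite cast_ordKV enum_rankK.
Qed.

(** * Commuting clock and shift pairs *)

(** Matrix units yield a map from matrices into the algebra, whereas the isomorphism is wanted in
    the other direction. *)
Lemma star_iso_inverse (R : realType) (A B : starAlgType R) (h : A -> B) :
  star_hom h -> injective h -> (forall b, exists a, h a = b) ->
  exists g : B -> A, star_iso g.
Proof.
move=> [hl hm h1 hs] hi hsurj; have [g gK] := choice hsurj.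
have hK : cancel h g by move=> a; apply: hi; rewrite gK.
exists g; split; last by exists h.
split=> [a x y|x y||x]; apply: hi; rewrite ?gK ?hl ?hm ?h1 ?hs ?gK //.
Qed.

Section ExtendFfun.
Variables (n : nat) (I : finType).

Definition ffun_rcons (q : {ffun 'I_n -> I} * I) : {ffun 'I_n.+1 -> I} :=
  [ffun k => if unlift ord_max k is Some k' then q.1 k' else q.2].

Lemma ffun_rcons_bij : bijective ffun_rcons.
Proof.
exists (fun f : {ffun 'I_n.+1 -> I} => ([ffun k => f (lift ord_max k)], f ord_max)).
  move=> [g i]; congr (_, _); rewrite ?ffunE ?unlift_none //.
  by apply/ffunP => k; rewrite !ffunE liftK.
by move=> f; apply/ffunP => k; rewrite ffunE; case: unliftP => [k'|] ->; rewrite ?ffunE.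
Qed.

Lemma ffun_rcons_max q : ffun_rcons q ord_max = q.2.
Proof. by rewrite ffunE unlift_none. Qed.

Lemma ffun_rcons_widen q (k : 'I_n) : ffun_rcons q (widen_ord (leqnSn n) k) = q.1 k.
Proof.
rewrite ffunE; have -> : widen_ord (leqnSn n) k = lift ord_max k.
  by apply: val_inj; rewrite /= /bump leqNgt ltn_ord.
by rewrite liftK.
Qed.

End ExtendFfun.

Section ClockSystem.
Variables (R : realType) (p : nat).
Hypothesis p_prime : prime p.
Variables (B : cstarAlgType R) (r : option nat) (ga gb : nat -> B).
Local Notation chi := (@chi R p).
Local Notation F := 'F_p.

Hypothesis ga_unit : forall k, unitary_elt (ga k).
Hypothesis gb_unit : forall k, unitary_elt (gb k).
Hypothesis ga_p : forall k, ga k ^+ p = 1.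
Hypothesis gb_p : forall k, gb k ^+ p = 1.
Hypothesis gab : forall k, below r k -> ga k * gb k = chi 1 *: (gb k * ga k).
Hypothesis g_comm : forall k l, k != l ->
  [/\ GRing.comm (ga k) (ga l), GRing.comm (ga k) (gb l),
      GRing.comm (gb k) (ga l) & GRing.comm (gb k) (gb l)].
Hypothesis g_default : forall k, ~~ below r k -> ga k = 1 /\ gb k = 1.

Definition monomial k (x y : F) : B := gb k ^+ nat_of_ord x * ga k ^+ nat_of_ord y.

Hypothesis g_dense : forall b, closed_span
  [set v | exists n (x y : nat -> F), v = \prod_(k < n) monomial k (x k) (y k)] b.

Let E k := @clock_shift_unit R p B (ga k) (gb k).

Let EM k : below r k -> matrix_units (E k).
Proof. by move=> rk; apply: clock_shift_units => //; exact: gab. Qed.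

Lemma E_comm l x i j : GRing.comm x (ga l) -> GRing.comm x (gb l) ->
  GRing.comm x (E l i j).
Proof.
move=> ca cb; rewrite /E /clock_shift_unit; apply: commrM; first exact: commrX.
exact: eproj_comm.
Qed.

Lemma EE_comm k l i j i' j' : k != l -> GRing.comm (E k i j) (E l i' j').
Proof.
move=> /g_comm [h1 h2 h3 h4]; apply: E_comm; apply/commr_sym.
  by apply: E_comm; apply/commr_sym.
by apply: E_comm; apply/commr_sym.
Qed.

(** A monomial sends the j-th eigenspace of [ga k] to the (j + x)-th, with phase [chi (j * y)];
    between the two projections it survives only if i = j + x. *)
Lemma monomial_slice k x y i j : below r k ->
  exists t : R[i], E k i i * monomial k x y * E k j j = t *: E k i j.
Proof.
move=> rk; rewrite /E /clock_shift_unit !subrr expr0 !mul1r /monomial.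
rewrite mulrA (eproj_conj p_prime _ (gb_p k) (gab rk)) -!mulrA.
rewrite (eproj_shift p_prime (ga_p k)) -!(scalerAr (chi (j * y))) eproj_mul //.
exists (if i - x == j then chi (j * y) else 0).
case: eqP => [<-|_]; last by rewrite mulr0 scaler0 scale0r.
by rewrite subKr.
Qed.

Section Infinite.
Hypothesis r_inf : r = None.

Variable s : 'I_p.-1.+1 -> F.
Hypothesis s_bij : bijective s.

Let bel k : below r k. Proof. by rewrite r_inf. Qed.

Definition copy k : Mat R p -> B := mat_hom (E k) s.

Lemma copy_hom k : star_hom (copy k).
Proof. exact: (mat_hom_star_hom (EM (bel k)) s_bij). Qed.

Lemma monomial_copy k x y : exists M, copy k M = monomial k x y.
Proof.
have hM := star_hom_mul (copy_hom k); have h1 := star_hom_one (copy_hom k).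
have hX M n : copy k (M ^+ n) = copy k M ^+ n.
  by elim: n => [|n IH]; rewrite ?expr0 // !exprS hM IH.
have [Ma ha] : exists M, copy k M = ga k.
  have [M hMa] := mat_hom_onto (E k) s_bij (fun i j => if i == j then chi i else 0).
  exists M; rewrite /copy hMa [RHS](clock_shift_a p_prime (gb k) (ga_p k)).
  apply: eq_bigr => i _; rewrite (bigD1 i) //= eqxx big1 ?addr0 // => j.
  by rewrite eq_sym => /negbTE ->; rewrite scale0r.
have [Mb hb] : exists M, copy k M = gb k.
  have [M hMb] := mat_hom_onto (E k) s_bij (fun i j => if i == j + 1 then 1 else 0).
  exists M; rewrite /copy hMb exchange_big [RHS](clock_shift_b p_prime (ga k) (gb k)).
  apply: eq_bigr => j _; rewrite (bigD1 (j + 1)) //= eqxx scale1r big1 ?addr0 // => i.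
  by move=> /negbTE ->; rewrite scale0r.
by exists (Mb ^+ nat_of_ord x * Ma ^+ nat_of_ord y); rewrite hM !hX ha hb.
Qed.

Lemma copies_comm k l : k <> l -> forall M N, copy k M * copy l N = copy l N * copy k M.
Proof.
move=> /eqP kl M N; apply: mat_hom_comm => i j; apply/commr_sym.
by apply: mat_hom_comm => i' j'; apply: EE_comm; rewrite eq_sym.
Qed.

Lemma clock_infinite_tensor : is_infinite_tensor copy.
Proof.
split.
- exact: copy_hom.
- exact: copies_comm.
- elim=> [|n IH] I a ha.
    move=> t h f0; move: h; rewrite (bigD1 f0) //= [X in _ + X]big1 => [|f ff0].
      by rewrite big_ord0 addr0 => /eqP; rewrite scaler_eq0 oner_eq0 orbF => /eqP.
    by case/eqP: ff0; apply/ffunP => -[].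
  move=> t h f0.
  have [g gK Kg] := ffun_rcons_bij n I.
  rewrite -(Kg f0); move: (g f0) => [f1 i1]; clear f0.
  (* Grouping by the index in the last factor turns the relation into one over the n-th copy, with
     coefficients [D i] from the first n copies, which commute with it. Once [D i = 0] is known, the
     induction hypothesis applies. *)
  pose D i := \sum_(f : {ffun 'I_n -> I}) t (ffun_rcons (f, i)) *:
    \prod_(k < n) copy k (a (widen_ord (leqnSn n) k) (f k)).
  have h' : \sum_i D i * copy n (a ord_max i) = 0.
    rewrite -[RHS]h [RHS](reindex _ (onW_bij _ (ffun_rcons_bij n I))) /=.
    rewrite -(pair_bigA _ (fun f i => t (ffun_rcons (f, i)) *: \prod_(k < n.+1) copy k (a k (ffun_rcons (f, i) k)))) /=.
    rewrite exchange_big; apply: eq_bigr => i _ /=; rewrite /D mulr_suml.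
    apply: eq_bigr => f _; rewrite -scalerAl big_ord_recr /= ffun_rcons_max.
    by congr (_ *: (_ * _)); apply: eq_bigr => k _; rewrite ffun_rcons_widen.
  have Dc i j k : D i * E n j k = E n j k * D i.
    rewrite /D mulr_suml mulr_sumr; apply: eq_bigr => f _.
    rewrite -scalerAl -scalerAr; congr (_ *: _); apply/esym/commr_prod => l _.
    by apply: mat_hom_comm => i' j'; apply: EE_comm; rewrite gtn_eqF.
  have D0 := mat_hom_indep (EM (bel n)) s_bij Dc (ha ord_max) h'.
  exact: (IH I (fun k => a (widen_ord (leqnSn n) k)) (fun k => ha _)
            (fun f => t (ffun_rcons (f, i1))) (D0 i1) f1).
- apply/seteqP; split=> // b _.
  apply: (closed_span_min _ _ (@g_dense b)); first exact: closed_closure.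
  move=> v hv; apply: sub_closed_span; move: v hv; apply: lin_span_ind.
  + exact: lin_span0.
  + by move=> t x y; exact: lin_span_lin.
  + move=> _ [n [x [y ->]]]; apply: sub_lin_span.
    have [M hM] := choice (fun k => monomial_copy k (x k) (y k)).
    by exists n, (fun k => M k); apply: eq_bigr => k _; rewrite hM.
Qed.

End Infinite.

Section Finite.
Variable m : nat.
Hypothesis r_fin : r = Some m.

Let bel k : (k < m)%N -> below r k. Proof. by rewrite r_fin. Qed.

Local Notation J := {ffun 'I_m -> F}.

Definition multi_unit (f g : J) : B := \prod_(k < m) E k (f k) (g k).

(** The lemmas on products of commuting factors take sequences indexed by [nat], whence the
    extension by 0. *)
Let X (f : J) (k : nat) : F := if insub k is Some i then f i else 0.

Let XE f (k : 'I_m) : X f k = f k. Proof. by rewrite /X valK. Qed.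

Let multi_unitE f g : multi_unit f g = \prod_(k < m) E k (X f k) (X g k).
Proof. by apply: eq_bigr => k _; rewrite !XE. Qed.

Lemma multi_matrix_units : matrix_units multi_unit.
Proof.
split=> [f g f' g'||f g].
- rewrite !multi_unitE (@prod_mul_comm _ m (fun k => E k (X f k) (X g k))
    (fun k => E k (X f' k) (X g' k))) => [|k l _ _]; last exact: EE_comm.
  case: eqP => [->|/eqP gf].
    by apply: eq_bigr => k _; rewrite (mu_mul (EM (bel (ltn_ord k)))) eqxx.
  have [k hk] : exists k, g k != f' k.
    apply/existsP; rewrite -negb_forall; apply: contra gf => /forallP h.
    by apply/eqP/ffunP => k; apply/eqP.
  apply: (@prodr_zero _ m (fun k => E k (X f k) (X g k) * E k (X f' k) (X g' k)) k) => //.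
  by rewrite (mu_mul (EM (bel (ltn_ord k)))) !XE (negbTE hk).
- rewrite -(bigA_distr_bigA (fun (k : 'I_m) i => E k i i)) big1 // => k _.
  exact: (mu_sum (EM (bel (ltn_ord k)))).
- have : forall n, (n <= m)%N -> star (\prod_(k < n) E k (X f k) (X g k)) =
      \prod_(k < n) E k (X g k) (X f k).
    elim=> [|n IH] nm; first by rewrite !big_ord0 star1.
    rewrite !big_ord_recr /= starM (IH (ltnW nm)) (mu_star (EM (bel nm))).
    by apply: (@comm_prodr _ n (fun k => E k (X g k) (X f k))) => k kn; apply: EE_comm; rewrite gtn_eqF.
  by move=> h; rewrite !multi_unitE h.
Qed.

(** For a monomial this is a computation factor by factor, and it passes to limits because lines are
    closed. As the diagonal units sum to 1, the matrix units therefore span the whole algebra. *)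
Lemma multi_slice b f g :
  exists t : R[i], multi_unit f f * b * multi_unit g g = t *: multi_unit f g.
Proof.
have cl : closed ([set b | exists t : R[i],
    multi_unit f f * b * multi_unit g g = t *: multi_unit f g] : set (topo B)).
  apply: closedP => h b' hh hb.
  exact: (line_closed hh (nlimMr _ (nlimMl _ hb))).
apply: (closed_span_min cl _ (@g_dense b)); apply: lin_span_ind.
- by exists 0; rewrite mulr0 mul0r scale0r.
- move=> t x y [tx hx] [ty hy]; exists (t * tx + ty).
  by rewrite mulrDr mulrDl -scalerAr -scalerAl hx hy scalerA scalerDl.
move=> _ [n [x [y ->]]].
(* The product is brought to exactly m factors: missing ones are filled with 1, and those beyond the
   rank are 1 by [g_default]. *)
have -> : \prod_(k < n) monomial k (x k) (y k) =
    \prod_(k < m) (if (k < n)%N then monomial k (x k) (y k) else 1).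
  have wide n1 n2 (G : nat -> B) : (n1 <= n2)%N ->
      \prod_(k < n2) (if (k < n1)%N then G k else 1) = \prod_(k < n1) G k.
    move=> /subnKC <-; rewrite big_split_ord /= [X in _ * X]big1 ?mulr1.
      by apply: eq_bigr => k _; rewrite ltn_ord.
    by move=> k _; rewrite ltnNge leq_addr.
  have [mn|/ltnW nm] := leqP m n; last exact: (esym (wide n m (fun k => monomial k (x k) (y k)) nm)).
  rewrite -(wide _ _ (fun k => if (k < n)%N then monomial k (x k) (y k) else 1) mn).
  apply: eq_bigr => k _; rewrite ltn_ord; case: ltnP => // mk.
  have [|ha hb] := g_default (k := k); first by rewrite r_fin /= -leqNgt.
  by rewrite /monomial ha hb !expr1n mulr1.
pose G k := if (k < n)%N then monomial k (x k) (y k) else 1.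
have Gc k l i j : k != l -> GRing.comm (G k) (E l i j) /\ GRing.comm (E l i j) (G k).
  move=> kl; suff h : GRing.comm (G k) (E l i j) by split => //; exact: commr_sym.
  rewrite /G; case: ifP => _; last exact/commr_sym/commr1.
  have [h1 h2 h3 h4] := g_comm kl; apply: E_comm; apply/commr_sym.
    by apply: commrM; apply: commrX; apply/commr_sym.
  by apply: commrM; apply: commrX; apply/commr_sym.
rewrite !multi_unitE -[\prod_(k < m) (if _ then _ else _)]/(\prod_(k < m) G k) /=.
rewrite (@prod_mul_comm _ m (fun k => E k (X f k) (X f k)) G); last first.
  by move=> k l _ _ kl; apply: (Gc l k _ _ _).2; rewrite eq_sym.
rewrite (@prod_mul_comm _ m (fun k => E k (X f k) (X f k) * G k)
   (fun k => E k (X g k) (X g k))); last first.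
  move=> k l _ _ kl; apply/commr_sym/commrM; first by apply: EE_comm; rewrite eq_sym.
  exact: (Gc k l _ _ kl).2.
have /choice [t ht] k : exists t : R[i], (k < m)%N ->
    E k (X f k) (X f k) * G k * E k (X g k) (X g k) = t *: E k (X f k) (X g k).
  have [km|] := ltnP k m; last by exists 0.
  rewrite /G; case: ifP => _.
    by have [t ht] := monomial_slice (x k) (y k) (X f k) (X g k) (bel km); exists t.
  have := monomial_slice 0 0 (X f k) (X g k) (bel km).
  by rewrite /monomial !expr0 mulr1 => -[t ht]; exists t.
exists (\prod_(k < m) t k); rewrite -scaler_prod; apply: eq_bigr => k _.
exact: ht.
Qed.

Lemma clock_matrix_iso : exists f : B -> Mat R (p ^ m)%N, star_iso f.
Proof.
have pm0 : (0 < p ^ m)%N by rewrite expn_gt0 prime_gt0.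
have [|s s_bij] := @exists_index_bij J _ pm0.
  by rewrite card_ffun !card_ord card_Fp'.
have EMJ := multi_matrix_units.
apply: (star_iso_inverse (mat_hom_star_hom EMJ s_bij) (mat_hom_inj EMJ s_bij)) => b.
have /choice [t ht] (fg : J * J) := multi_slice b fg.1 fg.2.
have [M hM] := mat_hom_onto multi_unit s_bij (fun f g => t (f, g)).
exists M; rewrite hM -[RHS]mul1r -[RHS]mulr1 -(mu_sum EMJ) !mulr_suml.
apply: eq_bigr => f _; rewrite mulr_sumr; apply: eq_bigr => g _.
by rewrite (ht (f, g)).
Qed.

End Finite.
End ClockSystem.

(** * The subalgebra generated by the symplectic basis *)

Section SubalgebraEmbedding.
Variables (R : realType) (A : cstarAlgType R) (G : set A).

Definition generated_alg : cstarAlgType R := CStarAlgebra.clone R (Cstar G) _.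

Definition gval (b : generated_alg) : A := Cstar_val b.

Lemma gval_hom : star_hom gval.
Proof. by split. Qed.

Lemma gval_inj : injective gval.
Proof. exact: Cstar_val_inj. Qed.

Lemma gval_expr b n : gval (b ^+ n) = gval b ^+ n.
Proof. by elim: n => [|n IH]; rewrite ?expr0 // !exprS -IH. Qed.

Lemma gval_surj a : generated G a -> exists b, gval b = a.
Proof. by move=> Ga; exists (MkCstar (introT (generated_predP G a) Ga)). Qed.

Lemma gval_sum (I : Type) (s : seq I) (F : I -> generated_alg) :
  gval (\sum_(i <- s) F i) = \sum_(i <- s) gval (F i).
Proof. by elim: s => [|i s IH]; rewrite ?big_nil // !big_cons -IH. Qed.

(** The embedding [gval] is isometric, so density in the subalgebra can be tested in [A]. *)
Lemma closed_span_lift (S : set generated_alg) (T : set A) b :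
  (forall v, T v -> exists2 d, lin_span S d & gval d = v) ->
  closed_span T (gval b) -> closed_span S b.
Proof.
move=> TS /closureP h; apply/closureP => e /h [v Tv bv].
have [d Sd dv] : exists2 d, lin_span S d & gval d = v.
  move: v Tv {bv}; apply: lin_span_ind => //.
    by exists 0 => //; exact: lin_span0.
  move=> t v v' [d Sd <-] [d' Sd' <-]; exists (t *: d + d') => //.
  exact: lin_span_lin.
by exists d; rewrite // -dv in bv.
Qed.

End SubalgebraEmbedding.

Section SymplecticPart.
Variables (R : realType) (p : nat) (c : nat -> nat -> 'F_p).
Hypotheses (p_prime : prime p) (c_skew : skew_symmetric c).
Variables (A : cstarAlgType R) (u : nat -> A).
Hypothesis rel : relations c u.
Local Notation om := (omega c).
Local Notation chi := (@chi R p).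
Local Notation w := (@word R p A u).
Variables (e f : nat -> {poly 'F_p}) (r : option nat).
Hypothesis ef_default : forall k, ~~ below r k -> e k = 0 /\ f k = 0.
Hypothesis ef_hyp : forall i j,
  [/\ om (e i) (e j) = 0, om (f i) (f j) = 0 &
      om (e i) (f j) = ((i == j) && below r i)%:R].

Definition ef_words : set A := words u [set x | exists k, x = e k \/ x = f k].

Local Notation B := (generated_alg ef_words).

Lemma gval_closed_span (b : B) : closed_span (words u (pspan_all e f)) (gval b).
Proof.
have sub := words_subalgebra p_prime rel (pspan_all_subgroup e f).
apply: (Cstar_valP b) => // _ [x [k [->|->]] <-]; apply/sub_closed_span/sub_lin_span.
  by exists (e k) => //; exact: pspan_e.
by exists (f k) => //; exact: pspan_f.
Qed.

Lemma word_pcomb n (a b : nat -> 'F_p) : exists t : R[i], w (pcomb e f n a b) =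
  t *: \prod_(k < n) (w (e k) ^+ nat_of_ord (a k) * w (f k) ^+ nat_of_ord (b k)).
Proof.
have wZ (x : {poly 'F_p}) (q : 'F_p) : exists t : R[i], w (q *: x) = t *: w x ^+ nat_of_ord q.
  have [d hd] := word_exp p_prime rel x (nat_of_ord q); exists (chi (- d)).
  by rewrite hd Fp_mulrn scalerA -chiD // addNr chi0 scale1r.
elim: n => [|n [t IH]]; first by exists 1; rewrite /pcomb !big_ord0 word0 scale1r.
rewrite /pcomb !big_ord_recr /= -/(pcomb e f n a b).
have [d1 ->] := word_add p_prime rel (pcomb e f n a b) (a n *: e n + b n *: f n).
have [d2 ->] := word_add p_prime rel (a n *: e n) (b n *: f n).
have [t1 ->] := wZ (e n) (a n); have [t2 ->] := wZ (f n) (b n).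
rewrite IH -!(scalerAl, scalerAr) !scalerA.
by eexists.
Qed.

(** The last clause makes the padding generators beyond the rank equal to 1, as [g_default] demands,
    and not merely to a root of unity. *)
Lemma normalizers (y : nat -> {poly 'F_p}) :
  (forall k, ~~ below r k -> y k = 0) ->
  exists t : nat -> R[i], forall k,
  [/\ normc (t k) = 1, (t k *: w (y k)) ^+ p = 1 & ~~ below r k -> t k = 1].
Proof.
move=> hy; suff /choice [t ht] : forall k, exists t : R[i],
    [/\ normc t = 1, (t *: w (y k)) ^+ p = 1 & ~~ below r k -> t = 1] by exists t.
move=> k.
have [rk|/hy yk] := boolP (below r k).
  by have [t t1 ht] := word_normalize p_prime rel (y k); exists t.
by exists 1; split=> //; rewrite ?normc1 // yk word0 scale1r expr1n.
Qed.

Lemma ef_generated k : (generated ef_words (w (e k))) /\ (generated ef_words (w (f k))).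
Proof.
split; apply: sub_generated; [exists (e k)|exists (f k)] => //; exists k; by [left|right].
Qed.

Lemma symplectic_part :
  (match r with
   | Some m => exists h : B -> Mat R (p ^ m)%N, star_iso h
   | None => uhf_type p B
   end) /\
  (forall x, pspan_all e f x -> exists b : B, gval b = w x).
Proof.
have [ta hta] := normalizers (fun k rk => (ef_default rk).2).
have [tb htb] := normalizers (fun k rk => (ef_default rk).1).
have /choice [bf hbf] k : exists b : B, gval b = w (f k) := gval_surj (ef_generated k).2.
have /choice [be hbe] k : exists b : B, gval b = w (e k) := gval_surj (ef_generated k).1.
(* The word of f_k is the clock and that of e_k the shift: by [word_comm] the phase of w(f_k) w(e_k)
   is [chi] of om(e_k, f_k) = 1. *)
pose ga k := ta k *: bf k; pose gb k := tb k *: be k.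
have vga k : gval (ga k) = ta k *: w (f k) by rewrite -hbf.
have vgb k : gval (gb k) = tb k *: w (e k) by rewrite -hbe.
have unit_lift (x : B) : unitary_elt (gval x) -> unitary_elt x.
  by move=> [h1 h2]; split; apply: gval_inj; [exact: h1|exact: h2].
have ga_unit k : unitary_elt (ga k).
  apply: unit_lift; rewrite vga; apply: unitaryZ; first by have [] := hta k.
  exact: (word_unitary rel).
have gb_unit k : unitary_elt (gb k).
  apply: unit_lift; rewrite vgb; apply: unitaryZ; first by have [] := htb k.
  exact: (word_unitary rel).
have ga_p k : ga k ^+ p = 1.
  by apply: gval_inj; rewrite gval_expr vga; have [_ -> _] := hta k.
have gb_p k : gb k ^+ p = 1.
  by apply: gval_inj; rewrite gval_expr vgb; have [_ -> _] := htb k.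
have scal (s t : R[i]) (x y : {poly 'F_p}) : (s *: w x) * (t *: w y) =
    chi (om y x) *: ((t *: w y) * (s *: w x)).
  rewrite -!scalerAl -!scalerAr (word_comm p_prime rel x y) !scalerA.
  by congr (_ *: _); rewrite mulrC -mulrA; congr (_ * _); rewrite mulrC.
have gab k : below r k -> ga k * gb k = chi 1 *: (gb k * ga k).
  move=> rk; apply: gval_inj; rewrite -[LHS]/(gval (ga k) * gval (gb k)).
  rewrite -[RHS]/(chi 1 *: (gval (gb k) * gval (ga k))) vga vgb scal.
  by have [_ _ ->] := ef_hyp k k; rewrite eqxx rk.
have comm0 (s t : R[i]) x y : om y x = 0 -> (s *: w x) * (t *: w y) = (t *: w y) * (s *: w x).
  by move=> h; rewrite scal h chi0 scale1r.
have g_comm (k l : nat) : k != l -> [/\ GRing.comm (ga k) (ga l), GRing.comm (ga k) (gb l),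
      GRing.comm (gb k) (ga l) & GRing.comm (gb k) (gb l)].
  move=> kl; have [h1 h2 h3] := ef_hyp l k; have [_ _ h4] := ef_hyp k l.
  rewrite eq_sym (negbTE kl) in h3; rewrite (negbTE kl) in h4.
  split; apply: gval_inj; rewrite -[LHS]/(gval _ * gval _) -[RHS]/(gval _ * gval _)
    ?vga ?vgb; apply: comm0 => //.
  by rewrite (omega_skew c_skew) h4 oppr0.
have g_default k : ~~ below r k -> ga k = 1 /\ gb k = 1.
  move=> rk; have [e0 f0] := ef_default rk; split; apply: gval_inj.
    by rewrite vga f0 word0; have [_ _ ->] := hta k; rewrite // scale1r.
  by rewrite vgb e0 word0; have [_ _ ->] := htb k; rewrite // scale1r.
have wE n (a b : nat -> 'F_p) : exists t : R[i], w (pcomb e f n a b) =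
    gval (t *: \prod_(k < n) monomial ga gb k (a k) (b k)).
  have [t ->] := word_pcomb n a b.
  have H m : exists s : R[i], \prod_(k < m) (w (e k) ^+ nat_of_ord (a k) * w (f k) ^+ nat_of_ord (b k))
      = s *: gval (\prod_(k < m) monomial ga gb k (a k) (b k)).
    elim: m => [|m [s IH]]; first by exists 1; rewrite !big_ord0 scale1r.
    rewrite !big_ord_recr /= IH.
    rewrite -[Cstar_val (gb m ^+ _)]/(gval (gb m ^+ _)) -[Cstar_val (ga m ^+ _)]/(gval (ga m ^+ _)).
    rewrite !gval_expr.
    rewrite vga vgb !exprZn -!(scalerAl, scalerAr).
    have [ta1 _ _] := hta m; have [tb1 _ _] := htb m.
    have nz (t' : R[i]) : normc t' = 1 -> t' != 0.
      by move=> h; apply/eqP => t0; move: h; rewrite t0 normc0 => /esym/eqP; rewrite oner_eq0.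
    exists (s * (tb m ^+ nat_of_ord (a m) * ta m ^+ nat_of_ord (b m))^-1).
    rewrite !scalerA -(mulrA s) (_ : _^-1 * _ = 1) ?mulr1 //.
    by rewrite mulVf // mulf_neq0 // expf_neq0 // nz.
  have [s ->] := H n; exists (t * s); by rewrite scalerA.
have g_dense (b : B) : closed_span
  [set v | exists n (x y : nat -> 'F_p), v = \prod_(k < n) monomial ga gb k (x k) (y k)] b.
  apply: (closed_span_lift _ (@gval_closed_span b)) => _ [x [n [a [d ->]]] <-].
  have [t ht] := wE n a d; exists (t *: \prod_(k < n) monomial ga gb k (a k) (d k)) => //.
  by apply: lin_spanZ; apply: sub_lin_span; exists n, a, d.
split; last by move=> _ [n [a [d ->]]]; have [t ->] := wE n a d; eexists.
case rE : r => [m|].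
  exact: (clock_matrix_iso p_prime ga_unit gb_unit ga_p gb_p gab g_comm g_default g_dense rE).
have [|s s_bij] := @exists_index_bij 'F_p p (prime_gt0 p_prime).
  by rewrite card_ord card_Fp'.
exists (copy ga gb s).
exact: (clock_infinite_tensor p_prime ga_unit gb_unit ga_p gb_p gab g_comm g_dense rE s_bij).
Qed.

End SymplecticPart.

(** * Sequence spaces *)

Record seqspace (T : finType) (P : set (nat -> T)) : Type :=
  SeqSpace {seq_val :> nat -> T; seq_valP : P seq_val}.

Lemma seq_val_inj (T : finType) (P : set (nat -> T)) (x y : seqspace P) :
  seq_val x =1 seq_val y -> x = y.
Proof.
move=> /funext; case: x y => x px [y py] /= xy.
by rewrite xy in px *; congr SeqSpace; exact: Prop_irrelevance.
Qed.

Definition agree (T : Type) n (x y : nat -> T) := forall k, (k < n)%N -> x k = y k.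

(* The alias carries the base point, and the field R of the pseudometric. *)
Definition seq_pspace (R : realType) (T : finType) (P : set (nat -> T))
  (x0 : seqspace P) : Type := seqspace P.

Section SequenceTopology.
Variables (R : realType) (T : finType) (P : set (nat -> T)) (x0 : seqspace P).
Local Notation X := (seq_pspace R x0).
Implicit Types x y z : X.

HB.instance Definition _ := gen_eqMixin X.
HB.instance Definition _ := gen_choiceMixin X.
HB.instance Definition _ := isPointed.Build X x0.

(* The conjunct [0 < e] is needed for [seq_ball_triangle]: the axiom of
   pseudometrics also quantifies over nonpositive radii. *)
Definition seq_ball x (e : R) : set X :=
  [set y | 0 < e /\ forall k, e <= k.+1%:R^-1 -> seq_val x k = seq_val y k].

Let ent : set_system (X * X) := entourage_ seq_ball.

Let nbhs (x : X) : set_system X := nbhs_ ent x.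

Let nbhsE : nbhs = nbhs_ ent. Proof. by []. Qed.

HB.instance Definition _ := hasNbhs.Build X nbhs.

Fact seq_ball_center x (e : R) : 0 < e -> seq_ball x e x.
Proof. by []. Qed.

Fact seq_ball_sym x y (e : R) : seq_ball x e y -> seq_ball y e x.
Proof. by move=> [e0 xy]; split=> // k /xy. Qed.

Fact seq_ball_triangle x y z (e1 e2 : R) :
  seq_ball x e1 y -> seq_ball y e2 z -> seq_ball x (e1 + e2) z.
Proof.
move=> [e10 xy] [e20 yz]; split=> [|k ek]; first exact: addr_gt0.
have [le1 le2] : e1 <= k.+1%:R^-1 /\ e2 <= k.+1%:R^-1.
  by move: (k.+1%:R^-1) ek => d; split; lra.
by rewrite xy // yz.
Qed.

Let entE : ent = entourage_ seq_ball. Proof. by []. Qed.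

HB.instance Definition _ := @Nbhs_isPseudoMetric.Build R X
  ent nbhsE seq_ball seq_ball_center seq_ball_sym seq_ball_triangle entE.

Definition seq_space : pseudoPMetricType R := X.

End SequenceTopology.

Section SequenceCompact.
Variables (R : realType) (T : finType) (P : set (nat -> T)) (x0 : seqspace P).
Local Notation X := (seq_space R x0).
Implicit Types x y z : X.

Lemma nbhs_seqP x (A : set X) :
  nbhs x A <-> exists n, forall y : X, agree n (x : seqspace P) (y : seqspace P) -> A y.
Proof.
split=> [/nbhs_ballP [e /= e0 sA]|[n sA]].
  have [n _ hn] := near_infty_natSinv_lt (PosNum e0).
  exists n => y xy; apply: sA; split=> // k ek; apply: xy.
  rewrite ltnNge; apply/negP => nk; have /= := hn k nk.
  by rewrite ltNge ek.
apply/nbhs_ballP; exists n.+1%:R^-1; first by rewrite /= invr_gt0 ltr0Sn.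
move=> y [_ xy]; apply: sA => k kn; apply: xy.
by rewrite lef_pV2 ?posrE ?ltr0Sn // ler_nat ltnS ltnW.
Qed.

Lemma open_coord k (t : T) : open [set x : X | (x : seqspace P) k = t].
Proof.
rewrite openE => x /= xk; apply/nbhs_seqP; exists k.+1 => y xy.
by rewrite /= -xk -(xy k).
Qed.

Lemma seq_space_zero_dim : zero_dimensional X.
Proof.
move=> x y /eqP xy; have [k xyk] : exists k, (x : seqspace P) k != (y : seqspace P) k.
  apply: contrapT => h; apply: xy; apply: (@seq_val_inj T P) => k.
  by apply/eqP; apply: contraT => hk; case: h; exists k.
exists [set z : X | (z : seqspace P) k = (x : seqspace P) k]; split => //.
  split; first exact: open_coord.
  rewrite -openC openE => z /= zk; apply/nbhs_seqP; exists k.+1 => z' zz'.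
  by rewrite /= -(zz' k).
by move=> /= yx; rewrite yx eqxx in xyk.
Qed.

Lemma seq_space_hausdorff : hausdorff_space X.
Proof.
move=> x y xy; apply/eqP; apply: contraT => /seq_space_zero_dim [U [[oU cU] Ux Uy]].
have oUC : open (~` U) by rewrite openC.
have [z [Uz nUz]] := xy _ _ (open_nbhs_nbhs (conj oU Ux)) (open_nbhs_nbhs (conj oUC Uy)).
by case: nUz.
Qed.

Lemma seq_space_totally_disconnected : totally_disconnected [set: X].
Proof. exact/zero_dimension_totally_disconnected/seq_space_zero_dim. Qed.

Hypothesis P_closed : forall a : nat -> T,
  (forall n, exists2 x, P x & agree n a x) -> P a.

(** Since [T] is finite, an ultrafilter makes each coordinate constant on one of its members. These
    constants form the limit sequence, whose prefixes are all realized in [P], so that [P_closed]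
    applies. *)
Lemma seq_space_compact : compact [set: X].
Proof.
rewrite compact_ultra => F FU _.
have coord k : exists t, F [set x : X | (x : seqspace P) k = t].
  apply: contrapT => h.
  have hC t : F (~` [set x : X | (x : seqspace P) k = t]).
    have [Ft|//] := in_ultra_setVsetC [set x : X | (x : seqspace P) k = t] FU.
    by case: h; exists t.
  have : F [set x : X | forall t, t \in enum T -> (x : seqspace P) k <> t].
    elim: (enum T) => [|t s IH].
      by apply: filterS filterT => x _ t; rewrite in_nil.
    apply: filterS (filterI (hC t) IH) => x [xt xs] t'.
    by rewrite inE => /orP[/eqP -> //|/xs].
  move=> /filter_ex [x /(_ ((x : seqspace P) k))].
  by rewrite mem_enum => /(_ isT).
have [a aP] := choice coord.
have pre n : F [set x : X | agree n a (x : seqspace P)].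
  elim: n => [|n IH]; first by apply: filterS filterT => x _ k.
  apply: filterS (filterI IH (aP n)) => x [xa xn] k.
  by rewrite ltnS leq_eqVlt => /orP[/eqP ->|/xa].
have Pa : P a.
  apply: P_closed => n; have /filter_ex [x hx] := pre n.
  by exists (x : seqspace P) => //; exact: seq_valP.
exists (SeqSpace Pa : X); split => // A /nbhs_seqP [n sA].
by apply: filterS (pre n) => x; exact: sA.
Qed.

(** Uniform continuity on a compact space, in combinatorial form: a finite prefix determines the
    value up to [e]. *)
Lemma seq_space_unif (f : Cfun R X) (e : R) : 0 < e -> exists n, forall x y : X,
  agree n (x : seqspace P) (y : seqspace P) -> normc (f x - f y) < e.
Proof.
move=> e0; have e20 : 0 < (e / 2)%:C%C :> R[i] by rewrite ltcR divr_gt0.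
have := seq_space_compact; rewrite compact_near_coveringP.
move=> /(_ nat \oo (fun n x => forall y : X, agree n (x : seqspace P) (y : seqspace P) ->
  normc (f x - f y) < e) _) [].
  move=> x _; have /cvgrPdist_lt/(_ _ e20)/nbhs_seqP [n hn] := @cts_fun _ _ f x.
  have hn' y : agree n (x : seqspace P) (y : seqspace P) -> normc (f x - f y) < e / 2.
    by move=> /hn; rewrite normr_normc ltcR.
  exists ([set y : X | agree n (x : seqspace P) (y : seqspace P)], [set m | (n <= m)%N]).
    by split => /=; [apply/nbhs_seqP; exists n|exists n].
  move=> [y m] /= [xy nm] z yz.
  have xz : agree n (x : seqspace P) (z : seqspace P).
    by move=> k kn; rewrite xy // yz // (leq_trans kn).
  have := le_normcD (f y - f x) (f x - f z); rewrite addrA subrK (normcB (f y) (f x)).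
  have := hn' _ xy; have := hn' _ xz; lra.
by move=> n _ hn; exists n => x y; exact: (hn n (leqnn n) x I y).
Qed.

Lemma Cfun_mk (f : X -> R[i]) :
  (forall e : R, 0 < e -> exists n, forall x y : X,
    agree n (x : seqspace P) (y : seqspace P) -> normc (f x - f y) < e) ->
  exists g : Cfun R X, forall x, g x = f x.
Proof.
move=> hf; have cf : continuous (f : X -> R[i]^o).
  move=> x; have FX : Filter (nbhs (x : X)) := nbhs_filter x.
  apply/cvgrPdist_lt => e e0.
  have e0' : 0 < complex.Re e by move: e0; rewrite ltcE => /andP[].
  have [n hn] := hf _ e0'; apply/nbhs_seqP; exists n => y /hn.
  by rewrite -ltc_real.
by exists (mkcts cf : continuousType X R[i]^o).
Qed.

End SequenceCompact.

(** * Functional calculus on the center *)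

Section PartitionOfUnity.
Variables (R : realType) (A : cstarAlgType R) (I : finType) (q : I -> A).
Hypothesis q_mul : forall i j, q i * q j = if i == j then q i else 0.
Hypothesis q_star : forall i, star (q i) = q i.

Lemma punity_mul (s t : I -> R[i]) :
  (\sum_i s i *: q i) * (\sum_i t i *: q i) = \sum_i (s i * t i) *: q i.
Proof.
rewrite mulr_suml; apply: eq_bigr => i _; rewrite mulr_sumr (bigD1 i) //=.
rewrite [X in _ + X]big1 ?addr0 => [|j ji].
  by rewrite -scalerAl -scalerAr scalerA q_mul eqxx.
by rewrite -scalerAl -scalerAr q_mul eq_sym (negbTE ji) !scaler0.
Qed.

Lemma punity_expr (s : I -> R[i]) k :
  (\sum_i s i *: q i) ^+ k.+1 = \sum_i (s i ^+ k.+1) *: q i.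
Proof.
elim: k => [|k IH]; first by under [RHS]eq_bigr do rewrite expr1.
by rewrite exprS IH punity_mul; under eq_bigr do rewrite -exprS.
Qed.

Lemma punity_star (s : I -> R[i]) :
  star (\sum_i s i *: q i) = \sum_i (s i)^* *: q i.
Proof. by rewrite star_sum; apply: eq_bigr => i _; rewrite starZ q_star. Qed.

Lemma punity_nm_le1 i : nm (q i) <= 1.
Proof.
have [->|h] := eqVneq (nm (q i)) 0; first exact: ler01.
have h0 : 0 < nm (q i) by rewrite lt_neqAle eq_sym h nm_ge0.
by rewrite -(ler_pM2r h0) mul1r -expr2 -nm_star_mul q_star q_mul eqxx.
Qed.

(** For a selfadjoint element the C*-identity becomes [nm (z ^+ 2) = nm z ^+ 2], and squaring is
    iterated. *)
Lemma nm_selfadjoint_expr (z : A) k : star z = z -> nm (z ^+ (2 ^ k)) = nm z ^+ (2 ^ k).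
Proof.
move=> zs; elim: k => [|k IH]; first by rewrite !expr1.
rewrite expnS mulnC !exprM -IH expr2 -nm_star_mul; congr (nm (_ * _)).
apply/esym; elim: (2 ^ k)%N => [|n IHn]; first by rewrite expr0 star1.
by rewrite {1}exprS starM IHn zs -exprSr.
Qed.

(* C*-identity: the norm of the selfadjoint [y* y] is the limit of the
   [2^k]-th roots of the norms of its powers. *)
Lemma punity_nm (s : I -> R[i]) (M : R) : 0 <= M ->
  (forall i, q i != 0 -> normc (s i) <= M) -> nm (\sum_i s i *: q i) <= M.
Proof.
move=> M0 hs; set y := \sum_i _; set z := star y * y.
have zE : z = \sum_i ((s i)^* * s i) *: q i by rewrite /z punity_star punity_mul.
(* The triangle inequality costs a factor [#|I|], which does not depend on k. *)
have bound k : (nm y ^+ 2) ^+ (2 ^ k) <= #|I|%:R * (M ^+ 2) ^+ (2 ^ k).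
  rewrite -nm_star_mul -/z -nm_selfadjoint_expr; last by rewrite /z starM starK.
  have [n ->] : exists n, (2 ^ k)%N = n.+1 by exists (2 ^ k).-1; rewrite prednK ?expn_gt0.
  rewrite zE punity_expr; apply: le_trans (nm_sum _ _ _) _.
  apply: (@le_trans _ _ (\sum_(i : I) (M ^+ 2) ^+ n.+1)); last first.
    by rewrite sumr_const mulr_natl.
  apply: ler_sum => i _; have [->|qi] := eqVneq (q i) 0.
    by rewrite scaler0 nm0 !exprn_ge0.
  rewrite nmZ normcX normcM normc_conj -expr2.
  apply: le_trans (ler_wpM2l _ (punity_nm_le1 i)) _; first by rewrite !exprn_ge0 // normc_ge0.
  rewrite mulr1 lerXn2r ?nnegrE ?exprn_ge0 ?normc_ge0 //.
  by rewrite lerXn2r ?nnegrE ?normc_ge0 //; exact: hs.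
rewrite leNgt; apply/negP => My; have y0 : 0 < nm y by exact: le_lt_trans My.
have [M00|Mn0] := eqVneq M 0.
  have := bound 0%N; rewrite M00 !expr1 expr0n mulr0 => h.
  by have := exprn_gt0 2 y0; rewrite ltNge h.
have Mp : 0 < M by rewrite lt_neqAle eq_sym Mn0.
(* If [nm y] exceeded [M], the powers of the ratio 1 + d would stay below [#|I|] by [bound],
   although they grow without limit by Bernoulli's inequality. *)
pose d := nm y ^+ 2 / M ^+ 2 - 1.
have d0 : 0 < d by rewrite subr_gt0 ltr_pdivlMr ?exprn_gt0 // mul1r ltrXn2r ?nnegrE ?ltW.
have bern n : 1 + n%:R * d <= (nm y ^+ 2 / M ^+ 2) ^+ n.
  elim: n => [|n IH]; first by rewrite mul0r addr0 expr0.
  have dE : nm y ^+ 2 / M ^+ 2 = 1 + d by rewrite /d addrC subrK.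
  rewrite dE in IH *; rewrite exprS; apply: le_trans (ler_wpM2l _ IH); last by rewrite addr_ge0 // ltW.
  have : 0 <= n%:R * d ^+ 2 by rewrite mulr_ge0 // exprn_ge0 // ltW.
  by rewrite -natr1 expr2; lra.
have bnd k : 1 + (2 ^ k)%:R * d <= #|I|%:R.
  apply: le_trans (bern _) _; rewrite expr_div_n ler_pdivrMr ?bound //.
  by rewrite !exprn_gt0.
have [N _ hN] := near_infty_natSinv_lt (PosNum (divr_gt0 d0 (ltr0Sn R #|I|))).
have := hN N (leqnn N); rewrite /= ltr_pdivlMr ?ltr0Sn // mulrC.
rewrite ltr_pdivrMr ?ltr0Sn // => h.
have h2 : N.+1%:R <= (2 ^ N.+1)%:R :> R by rewrite ler_nat ltnW // ltn_expl.
have h3 := bnd N.+1.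
have h4 : N.+1%:R * d <= (2 ^ N.+1)%:R * d by rewrite ler_wpM2r // ltW.
have h5 : #|I|%:R < #|I|.+1%:R :> R by rewrite ltr_nat.
move: h h3 h4 h5; rewrite (mulrC d); lra.
Qed.

Lemma punity_nm_ge (s : I -> R[i]) i : q i != 0 ->
  normc (s i) <= nm (\sum_i s i *: q i).
Proof.
move=> qi; have n0 : 0 < nm (q i).
  by rewrite lt_neqAle nm_ge0 andbT eq_sym; apply: contra qi => /eqP/nm_eq0 ->.
rewrite -(ler_pM2r n0) -nmZ; apply: le_trans _ (nmM _ _).
rewrite mulr_suml (bigD1 i) //= [X in _ + X]big1 ?addr0 => [|j ji].
  by rewrite -scalerAl q_mul eqxx.
by rewrite -scalerAl q_mul (negbTE ji) scaler0.
Qed.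

End PartitionOfUnity.

(** * The joint spectrum of countably many central unitaries of order p *)

Section JointSpectrum.
Variables (R : realType) (p : nat).
Hypothesis p_prime : prime p.
Variables (A : cstarAlgType R) (v : nat -> A).
Local Notation chi := (@chi R p).
Local Notation F := 'F_p.
Hypothesis v_unit : forall k, unitary_elt (v k).
Hypothesis v_p : forall k, v k ^+ p = 1.
Hypothesis v_central : forall k, cstar_center A (v k).
Implicit Types (x y : nat -> F) (n m : nat).

Definition cyl n x : A := \prod_(k < n) eproj (v k) (x k).

Lemma eproj_central k (i : F) a : eproj (v k) i * a = a * eproj (v k) i.
Proof. by rewrite eproj_comm //; apply/esym; exact: v_central. Qed.

Lemma cyl_central n x : cstar_center A (cyl n x).
Proof.
move=> a; apply/esym; apply: (@comm_prodr A n (fun k => eproj (v k) (x k)) a) => k _.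
exact/esym/eproj_central.
Qed.

Lemma cyl_agree n x y : agree n x y -> cyl n x = cyl n y.
Proof. by move=> xy; apply: eq_bigr => k _; rewrite xy. Qed.

Lemma cyl_mul n x y : cyl n x * cyl n y = \prod_(k < n) (eproj (v k) (x k) * eproj (v k) (y k)).
Proof.
apply: (@prod_mul_comm A n (fun k => eproj (v k) (x k)) (fun k => eproj (v k) (y k))).
by move=> k l _ _ _; exact: eproj_central.
Qed.

Lemma cyl_idem n x : cyl n x * cyl n x = cyl n x.
Proof. by rewrite cyl_mul; apply: eq_bigr => k _; rewrite eproj_idem. Qed.

Lemma cyl_orth n x y k : (k < n)%N -> x k != y k -> cyl n x * cyl n y = 0.
Proof.
move=> kn xy; rewrite cyl_mul.
apply: (@prodr_zero A n (fun k => eproj (v k) (x k) * eproj (v k) (y k)) k) => //.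
by rewrite eproj_mul // (negbTE xy).
Qed.

Lemma cyl_star n x : star (cyl n x) = cyl n x.
Proof.
elim: n => [|n IH]; first by rewrite /cyl big_ord0 star1.
rewrite /cyl big_ord_recr /= starM star_eproj // -/(cyl n x) IH.
exact: eproj_central.
Qed.

Lemma cylS n x : cyl n.+1 x = cyl n x * eproj (v n) (x n).
Proof. by rewrite /cyl big_ord_recr. Qed.

Lemma cyl_split n m x : (n <= m)%N -> exists a, cyl m x = cyl n x * a.
Proof.
move=> /subnK <-; elim: (m - n)%N => [|k [a ha]]; first by exists 1; rewrite mulr1.
by exists (a * eproj (v (k + n)) (x (k + n)%N)); rewrite addSn cylS ha mulrA.
Qed.

(** Cylinders indexed by a finite type, so that partitions of unity can be summed; the default
    values beyond n are not seen by [cyl n]. *)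
Definition qcyl n (s : {ffun 'I_n -> F}) : A := cyl n (ext_fun s).

Lemma qcyl_mul n (s t : {ffun 'I_n -> F}) : qcyl s * qcyl t = if s == t then qcyl s else 0.
Proof.
case: eqP => [->|st]; first exact: cyl_idem.
have [k hk] : exists k, s k != t k.
  apply/existsP; rewrite -negb_forall; apply/negP => /forallP h.
  by apply: st; apply/ffunP => k; apply/eqP.
by apply: (cyl_orth (ltn_ord k)); rewrite !ext_funE.
Qed.

Lemma qcyl_star n (s : {ffun 'I_n -> F}) : star (qcyl s) = qcyl s.
Proof. exact: cyl_star. Qed.

Lemma qcyl_sum n : \sum_(s : {ffun 'I_n -> F}) qcyl s = 1.
Proof.
under eq_bigr => s _.
  rewrite /qcyl /cyl; under eq_bigr do rewrite ext_funE.
  over.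
rewrite -(bigA_distr_bigA (fun (k : 'I_n) i => eproj (v k) i)) big1 // => k _.
exact: sum_eproj.
Qed.

Definition spectrum : set (nat -> F) := [set x | forall n, cyl n x != 0].

Lemma cyl_neq0_le n m x : (n <= m)%N -> cyl m x != 0 -> cyl n x != 0.
Proof.
move=> nm; apply: contra => /eqP h; have [a ->] := cyl_split x nm.
by rewrite h mul0r.
Qed.

Lemma spectrum_closed (a : nat -> F) :
  (forall n, exists2 x, spectrum x & agree n a x) -> spectrum a.
Proof. by move=> h n; have [x xS /cyl_agree ->] := h n. Qed.

(** A cylinder projection is the sum of the projections of its one-step extensions, which therefore
    cannot all vanish. *)
Lemma cyl_step n x : cyl n x != 0 -> exists y, agree n x y /\ cyl n.+1 y != 0.
Proof.
move=> nx; apply: contrapT => h; move/eqP: nx; apply.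
rewrite -[LHS]mulr1 -(sum_eproj p_prime (v n)) mulr_sumr big1 // => i _.
pose y k := if (k < n)%N then x k else i.
have xy : agree n x y by move=> k kn; rewrite /y kn.
have -> : cyl n x * eproj (v n) i = cyl n.+1 y by rewrite cylS -(cyl_agree xy) /y ltnn.
by apply/eqP; apply: contraT => hy; case: h; exists y.
Qed.

(** Nonzero prefixes are extended one step at a time by dependent choice. The k-th term of [y] is
    read at stage k + 1, where the prefix already has length n + k + 1. *)
Lemma cyl_extend n x : cyl n x != 0 -> exists2 y, spectrum y & agree n x y.
Proof.
move=> nx.
pose Q := {t : nat * (nat -> F) | cyl t.1 t.2 != 0}.
have stepP (t : Q) : exists t' : Q, (sval t').1 = (sval t).1.+1 /\
    agree (sval t).1 (sval t).2 (sval t').2.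
  case: t => [[k z] /= hz]; have [z' [zz' hz']] := cyl_step hz.
  by exists (exist _ (k.+1, z') hz').
have [step stepE] := choice stepP.
pose X j := iter j step (exist _ (n, x) nx).
have X1 j : (sval (X j)).1 = (n + j)%N.
  by elim: j => [|j IH]; rewrite ?addn0 // /X iterS (stepE _).1 IH addnS.
have X2 j i : (j <= i)%N -> agree (n + j) (sval (X j)).2 (sval (X i)).2.
  elim: i => [|i IH]; first by rewrite leqn0 => /eqP ->.
  rewrite leq_eqVlt => /orP[/eqP -> //|]; rewrite ltnS => ji k kn.
  rewrite (IH ji k kn); have := (stepE (X i)).2; rewrite X1; apply.
  by apply: leq_trans kn _; rewrite leq_add2l.
pose y k := (sval (X k.+1)).2 k.
have Xy j : agree (n + j) (sval (X j)).2 y.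
  move=> k kn; rewrite /y; case: (leqP j k.+1) => h; first exact: X2.
  by apply/esym/(X2 _ _ (ltnW h)); rewrite addnS ltnS leq_addl.
exists y; last by move=> k kn; apply: (Xy 0%N); rewrite addn0.
move=> m; apply: (@cyl_neq0_le m (n + m)); first exact: leq_addl.
by rewrite -(cyl_agree (Xy m)); have := svalP (X m); rewrite X1.
Qed.

Lemma spectrum_point : exists x, spectrum x.
Proof.
have [|y yS _] := @cyl_extend 0 (fun=> 0); last by exists y.
by rewrite /cyl big_ord0 oner_neq0.
Qed.

Variable x0 : seqspace spectrum.
Local Notation X := (seq_space R x0).
Implicit Types (f g : Cfun R X).

(** A cylinder with zero projection contains no spectral point; there the default [x0] is harmless
    because its value is multiplied by 0. *)
Lemma sample_exists n (s : {ffun 'I_n -> F}) :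
  exists x : X, qcyl s != 0 -> agree n (ext_fun s) (x : seqspace spectrum).
Proof.
have [s0|/negPf s0] := boolP (qcyl s != 0); last by exists x0.
by have [y yS sy] := cyl_extend s0; exists (SeqSpace yS : X).
Qed.

Definition sample n (s : {ffun 'I_n -> F}) : X := projT1 (cid (sample_exists s)).

Lemma sampleP n (s : {ffun 'I_n -> F}) : qcyl s != 0 ->
  agree n (ext_fun s) (sample s : seqspace spectrum).
Proof. exact: projT2 (cid (sample_exists s)). Qed.

(* f is sampled at one point of each nonempty cylinder; the limit over n inverts
   the Gelfand transform. *)
Definition riemann n f : A := \sum_(s : {ffun 'I_n -> F}) f (sample s) *: qcyl s.

Lemma riemann_hom n : star_hom (riemann n).
Proof.
split=> [a f g|f g||f].
- rewrite /riemann scaler_sumr -big_split; apply: eq_bigr => s _ /=.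
  by rewrite scalerA -scalerDl.
- rewrite /riemann punity_mul; first by [].
  exact: qcyl_mul.
- by rewrite -[RHS](qcyl_sum n); apply: eq_bigr => s _; rewrite scale1r.
- by rewrite /riemann punity_star //; exact: qcyl_star.
Qed.

Definition restr n m (nm : (n <= m)%N) (t : {ffun 'I_m -> F}) : {ffun 'I_n -> F} :=
  [ffun k => t (widen_ord nm k)].

Lemma restr_agree n m (nm : (n <= m)%N) t : agree n (ext_fun (restr nm t)) (ext_fun t).
Proof.
move=> k kn; rewrite -[k]/(nat_of_ord (Ordinal kn)) ext_funE ffunE.
by rewrite -[RHS]/(ext_fun t (nat_of_ord (widen_ord nm (Ordinal kn)))) ext_funE.
Qed.

Lemma qcyl_refine n m (nm : (n <= m)%N) (s : {ffun 'I_n -> F}) (t : {ffun 'I_m -> F}) :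
  qcyl s * qcyl t = if s == restr nm t then qcyl t else 0.
Proof.
have [a ha] := cyl_split (ext_fun t) nm.
rewrite {1}/qcyl /qcyl ha -(cyl_agree (restr_agree nm t)) mulrA.
rewrite -/(qcyl s) -/(qcyl (restr nm t)) qcyl_mul.
by case: eqP => [->//|_]; rewrite mul0r.
Qed.

(** Puts two Riemann sums on the same finer partition of unity, so that their difference is bounded
    by [punity_nm]. *)
Lemma riemann_refine n m (nm : (n <= m)%N) f :
  riemann n f = \sum_(t : {ffun 'I_m -> F}) f (sample (restr nm t)) *: qcyl t.
Proof.
rewrite -[LHS]mulr1 -(qcyl_sum m) mulr_sumr; apply: eq_bigr => t _.
rewrite /riemann mulr_suml (bigD1 (restr nm t)) //= [X in _ + X]big1 ?addr0 => [|s st].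
  by rewrite -scalerAl (qcyl_refine nm) eqxx.
by rewrite -scalerAl (qcyl_refine nm) (negbTE st) scaler0.
Qed.

Lemma restr_neq0 n m (nm : (n <= m)%N) (t : {ffun 'I_m -> F}) :
  qcyl t != 0 -> qcyl (restr nm t) != 0.
Proof.
rewrite /qcyl (cyl_agree (restr_agree nm t)); exact: cyl_neq0_le.
Qed.

Lemma riemann_cauchy f : exists a, nlim (fun n => riemann n f) a.
Proof.
apply: nlim_complete => e e0; have e2 : 0 < e / 2 by rewrite divr_gt0.
have [N hN] := seq_space_unif spectrum_closed f e2; exists N.
suff wl n m : (N <= n)%N -> (n <= m)%N -> nm (riemann n f - riemann m f) < e.
  move=> m n Nm Nn; have [mn|/ltnW nm'] := leqP m n; first exact: wl.
  by rewrite nmB; exact: wl.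
move=> Nn nm'; rewrite (riemann_refine nm') /riemann -sumrB.
under eq_bigr do rewrite -scalerBl.
apply: (@le_lt_trans _ _ (e / 2)); last by lra.
apply: (punity_nm (@qcyl_mul m) (@qcyl_star m)); first exact: ltW.
move=> t t0; apply/ltW/hN => k kN.
have kn := leq_trans kN Nn.
rewrite -(sampleP (restr_neq0 nm' t0) kn) -(sampleP t0 (leq_trans kn nm')).
exact: restr_agree.
Qed.

Definition gelfand f : A := projT1 (cid (riemann_cauchy f)).

Lemma gelfandP f : nlim (fun n => riemann n f) (gelfand f).
Proof. exact: projT2 (cid (riemann_cauchy f)). Qed.

Lemma gelfand_hom : star_hom gelfand.
Proof.
split=> [a f g|f g||f]; apply: (nlim_unique (gelfandP _)).
- apply: nlim_near (nlimD (nlimZ a (gelfandP f)) (gelfandP g)).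
  by exists 0%N => n _; rewrite (star_hom_linear (riemann_hom n)).
- apply: nlim_near (nlimM (gelfandP f) (gelfandP g)).
  by exists 0%N => n _; rewrite (star_hom_mul (riemann_hom n)).
- apply: nlim_near (nlim_cst _).
  by exists 0%N => n _; rewrite (star_hom_one (riemann_hom n)).
- apply: nlim_near (nlim_star (gelfandP f)).
  by exists 0%N => n _; rewrite (star_hom_star (riemann_hom n)).
Qed.

Lemma gelfand_le f (M : R) : 0 <= M -> (forall x : X, normc (f x) <= M) -> nm (gelfand f) <= M.
Proof.
move=> M0 fM; apply: (nlim_nm_le (gelfandP f)) => n.
by apply: (punity_nm (@qcyl_mul n) (@qcyl_star n)) => // s _; exact: fM.
Qed.

(** By definition of the spectrum every cylinder around [x] has a nonzero projection, so the sampled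
    value near [f x] is bounded by the norm of the Riemann sum. Injectivity and closed range both
    rest on this. *)
Lemma gelfand_ge f (x : X) : normc (f x) <= nm (gelfand f).
Proof.
apply/ler_addgt0Pr => e e0; have e2 : 0 < e / 2 by rewrite divr_gt0.
have [N1 h1] := seq_space_unif spectrum_closed f e2.
have [N2 h2] := gelfandP f e2; pose n := maxn N1 N2.
pose s : {ffun 'I_n -> F} := [ffun k : 'I_n => (x : seqspace spectrum) k].
have sx : agree n (ext_fun s) (x : seqspace spectrum).
  by move=> k kn; rewrite -[k]/(nat_of_ord (Ordinal kn)) ext_funE ffunE.
have s0 : qcyl s != 0 by rewrite /qcyl (cyl_agree sx); exact: (seq_valP x).
have l1 : normc (f x - f (sample s)) < e / 2.
  apply: h1 => k kN; have kn : (k < n)%N by rewrite (leq_trans kN) ?leq_maxl.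
  by rewrite -(sampleP s0 kn) sx.
have l2 := h2 n (leq_maxr _ _).
have l3 : normc (f (sample s)) <= nm (riemann n f).
  exact: (punity_nm_ge (@qcyl_mul n) (fun s => f (sample s)) s0).
have l4 := le_normcD (f x - f (sample s)) (f (sample s)); rewrite subrK in l4.
have l5 := nmD (riemann n f - gelfand f) (gelfand f); rewrite subrK in l5.
lra.
Qed.

Lemma gelfand_central f : cstar_center A (gelfand f).
Proof.
move=> a; apply: (nlim_unique (nlimMr a (gelfandP f))).
apply: nlim_near (nlimMl a (gelfandP f)); exists 0%N => n _.
rewrite /riemann mulr_suml mulr_sumr; apply: eq_bigr => s _.
by rewrite -scalerAl -scalerAr cyl_central.
Qed.

Lemma gelfand0_eq0 f : gelfand f = 0 -> f = 0.
Proof.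
move=> f0; apply/continuousEP => x; apply: eq0_normc; apply/eqP.
by rewrite eq_le normc_ge0 andbT -(nm0 A) -f0 gelfand_ge.
Qed.

Lemma gelfandB f g : gelfand (f - g) = gelfand f - gelfand g.
Proof.
have -> : f - g = (-1) *: g + f by rewrite scaleN1r addrC.
by rewrite (star_hom_linear gelfand_hom) scaleN1r addrC.
Qed.

(** The preimage is the k-th coordinate followed by [chi]. Its Riemann sums are exactly [v k] for n
    > k, since [v k] acts on a cylinder as [chi] of its k-th label. *)
Lemma gelfand_coord k : exists f, gelfand f = v k.
Proof.
have [|g gE] := @Cfun_mk R F spectrum x0 (fun x : X => chi ((x : seqspace spectrum) k)).
  move=> e e0; exists k.+1 => x y /(_ k (ltnSn k)) ->.
  by rewrite subrr normc0.
exists g; apply: (nlim_unique (gelfandP g)).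
apply: nlim_near (nlim_cst _); exists k.+1 => n kn.
rewrite -[LHS]mulr1 -(qcyl_sum n) mulr_sumr; apply: eq_bigr => s _.
have [->|s0] := eqVneq (qcyl s) 0; first by rewrite mulr0 scaler0.
rewrite gE -(sampleP s0 kn) /qcyl.
have [a ->] : exists a, cyl n (ext_fun s) = eproj (v k) (ext_fun s k) * a.
  have [a ha] := cyl_split (ext_fun s) kn; exists (cyl k (ext_fun s) * a).
  by rewrite ha cylS mulrA eproj_central.
rewrite mulrA scalerAl; congr (_ * _).
have := eproj_shift p_prime (v_p k) (1 : F) (ext_fun s k); rewrite mulr1 => <-.
by congr (_ * _); rewrite -[LHS]expr1.
Qed.

(** By [gelfand_ge] the preimages of a convergent sequence are uniformly Cauchy; their uniform limit
    is continuous and is mapped to [a]. *)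
Lemma gelfand_range_closed a (h : nat -> A) :
  (forall n, exists f, gelfand f = h n) -> nlim h a -> exists f, gelfand f = a.
Proof.
move=> /choice [f fh] ha.
have fc (e : R) : 0 < e -> exists N, forall m n, (N <= m)%N -> (N <= n)%N -> forall x : X,
    normc (f m x - f n x) < e.
  move=> e0; have e2 : 0 < e / 2 by rewrite divr_gt0.
  have [N hN] := ha _ e2; exists N => m n Nm Nn x.
  apply: le_lt_trans (gelfand_ge (f m - f n) x) _; rewrite gelfandB !fh.
  have := nm_triangle a (h m) (h n); have := hN _ Nm; have := hN _ Nn.
  by rewrite (nmB (h n) a); lra.
have /choice [g hg] (x : X) : exists t, forall e : R, 0 < e ->
    exists N, forall n, (N <= n)%N -> normc (f n x - t) < e.
  apply: complex_cauchy => e /fc [N hN]; exists N => m n Nm Nn; exact: hN.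
have unif (e : R) : 0 < e -> exists N, forall n (x : X), (N <= n)%N -> normc (f n x - g x) <= e.
  move=> e0; have e2 : 0 < e / 2 by rewrite divr_gt0.
  have [N hN] := fc _ e2; exists N => n x Nn.
  have [M hM] := hg x _ e2.
  have h1 := hM _ (leq_maxr N M); have h2 := hN _ _ Nn (leq_maxl N M) x.
  have := le_normcD (f n x - f (maxn N M) x) (f (maxn N M) x - g x).
  by rewrite addrA subrK; lra.
have [|gg ggE] := @Cfun_mk R F spectrum x0 g.
  move=> e e0; have e4 : 0 < e / 4 by rewrite divr_gt0.
  have [N hN] := unif _ e4; have [n hn] := seq_space_unif spectrum_closed (f N) e4.
  exists n => x y /hn h1; have h2 := hN N x (leqnn N); have h3 := hN N y (leqnn N).
  have := le_normcD (g x - f N x) (f N x - g y); rewrite addrA subrK.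
  have := le_normcD (f N x - f N y) (f N y - g y); rewrite addrA subrK.
  by rewrite (normcB (g x) (f N x)); lra.
exists gg; apply/eqP; rewrite -subr_eq0; apply/eqP/nm_eps => e e0.
have e2 : 0 < e / 2 by rewrite divr_gt0.
have [N1 h1] := unif _ e2; have [N2 h2] := ha _ e2; pose n := maxn N1 N2.
have l1 : nm (gelfand gg - h n) <= e / 2.
  rewrite -fh -gelfandB; apply: gelfand_le; first exact: ltW.
  move=> x; rewrite -[(gg - f n) x]/(gg x - f n x) ggE normcB.
  by apply: h1; exact: leq_maxl.
have := nm_triangle (h n) (gelfand gg) a; have := h2 n (leq_maxr _ _); lra.
Qed.

End JointSpectrum.

(** * The Hilbert space l^2 *)

Section DotNorm.
Variables (R : realType) (U : lmodType R[i]) (form : {dot U for (@Num.conj R[i])}).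
Local Notation "''[' u , v ]" := (form u%R v%R) : ring_scope.

Lemma dot_CauchySchwarz u v : `|'[u, v]| ^+ 2 <= '[u, u] * '[v, v].
Proof.
have [->|v0] := eqVneq v 0; first by rewrite !linear0r normr0 expr0n.
have vv0 : 0 < '[v, v] by rewrite dnorm_gt0.
have [t tdef] : {t | t = '[u, v] / '[v, v]} by eexists.
have := dnorm_ge0 form (u - t *: v).
have tE : '[u, t *: v] = t^* * '[u, v] by rewrite linearZr_LR.
have vvR : ('[v, v])^* = '[v, v] by apply/CrealP/ger0_real/ltW.
rewrite dnormB tE dnormZ normCK. rewrite rmorphM /= conjCK.
have tC : t^* = '[u, v]^* / '[v, v] by rewrite tdef rmorphM fmorphV /= vvR.
have -> : '[u, u] + t * t^* * '[v, v] - (t^* * '[u, v] + t * '[u, v]^*) =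
   '[u, u] - `|'[u, v]| ^+ 2 / '[v, v].
  by rewrite normCK tC tdef; field; rewrite gt_eqF.
by rewrite subr_ge0 ler_pdivrMr.
Qed.

Lemma dot_triangle u v :
  sqrtC '[u + v, u + v] <= sqrtC '[u, u] + sqrtC '[v, v].
Proof.
rewrite -(@ler_pXn2r _ 2) ?nnegrE ?addr_ge0 ?sqrtC_ge0 ?dnorm_ge0 //.
rewrite sqrrD !sqrtCK dnormD addrAC lerD2r lerD2l.
have re : '[u, v] + '[u, v]^* = 2%:R * (complex.Re '[u, v])%:C%C by exact: addcJ.
rewrite re -[X in _ <= X]mulr_natl ler_pM2l ?ltr0n //.
apply: (@le_trans _ _ `|'[u, v]|).
  rewrite normr_normc lecR; apply: le_trans (normc_Re _); exact: ler_norm.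
rewrite -sqrtCM ?nnegrE ?dnorm_ge0 //.
rewrite -(@ler_pXn2r _ 2) ?nnegrE ?normr_ge0 ?sqrtC_ge0 ?mulr_ge0 ?dnorm_ge0 //.
by rewrite sqrtCK dot_CauchySchwarz.
Qed.

Lemma dot_sqrtZ (t : R[i]) u : sqrtC '[t *: u, t *: u] = `|t| * sqrtC '[u, u].
Proof.
by rewrite dnormZ sqrtCM ?nnegrE ?dnorm_ge0 ?exprn_ge0 // exprCK.
Qed.

Lemma dot_sqrt_eq0 u : sqrtC '[u, u] = 0 -> u = 0.
Proof. by move=> /eqP; rewrite sqrt_dnorm_eq0 => /eqP. Qed.

End DotNorm.

Record exhaustion (I : choiceType) := Exhaustion {
  ex_seq :> nat -> seq I;
  ex_uniq : forall n, uniq (ex_seq n);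
  ex_mono : forall m n, (m <= n)%N -> {subset ex_seq m <= ex_seq n};
  ex_cover : forall x, exists n, x \in ex_seq n
}.

(* l^2(I), with all sums taken along an exhaustion s of I by finite sets. *)
Section L2.
Variables (R : realType) (I : choiceType) (s : exhaustion I).
Let s_uniq := ex_uniq s.
Let s_mono := @ex_mono _ s.
Let s_cover := ex_cover s.
Implicit Types f g h : I -> R[i].

Definition partial_sum n (F : I -> R[i]) := \sum_(x <- s n) F x.

Definition sqsum n f : R := \sum_(x <- s n) normc (f x) ^+ 2.

Definition sq_summable f := exists M, forall n, sqsum n f <= M.

Lemma big_split_sub (V : nmodType) (F : I -> V) m n : (m <= n)%N ->
  \sum_(x <- s n) F x = \sum_(x <- s m) F x + \sum_(x <- s n | x \notin s m) F x.
Proof.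
move=> mn; rewrite (bigID (mem (s m))) /=; congr (_ + _).
rewrite -big_filter; apply: perm_big; apply: uniq_perm; rewrite ?filter_uniq //.
by move=> x; rewrite mem_filter; case xm: (x \in s m) => //=; rewrite (s_mono mn).
Qed.

Lemma sqsum_mono f m n : (m <= n)%N -> sqsum m f <= sqsum n f.
Proof.
move=> mn; rewrite /sqsum (big_split_sub _ mn) lerDl.
by apply: sumr_ge0 => x _; rewrite exprn_ge0 // normc_ge0.
Qed.

Lemma sqsum_cauchy f : sq_summable f -> forall e : R, 0 < e ->
  exists N, forall m n, (N <= m)%N -> (m <= n)%N -> sqsum n f - sqsum m f < e.
Proof.
move=> [M hM] e e0.
have bd : has_sup [set sqsum n f | n in setT].
  by split; [exists (sqsum 0 f), 0%N|exists M => _ [n _ <-]].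
have [_ [N _ <-] hN] := sup_adherent e0 bd.
exists N => m n Nm mn.
have h1 : sqsum n f <= sup [set sqsum n f | n in setT].
  by apply: ub_le_sup; [case: bd|exists n].
have := sqsum_mono f Nm; lra.
Qed.

Lemma dot_cauchy f g : sq_summable f -> sq_summable g ->
  forall e : R, 0 < e -> exists N, forall m n, (N <= m)%N -> (N <= n)%N ->
    normc (partial_sum m (fun x => f x * (g x)^*) -
           partial_sum n (fun x => f x * (g x)^*)) < e.
Proof.
move=> /sqsum_cauchy hf /sqsum_cauchy hg e e0.
have [N1 h1] := hf _ e0; have [N2 h2] := hg _ e0.
suff wl m n : (maxn N1 N2 <= m)%N -> (m <= n)%N ->
    normc (partial_sum n (fun x => f x * (g x)^*) -
           partial_sum m (fun x => f x * (g x)^*)) < e.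
  exists (maxn N1 N2) => m n Nm Nn; have [mn|/ltnW nm] := leqP m n.
    by rewrite normcB wl.
  exact: wl.
rewrite geq_max => /andP[Nm1 Nm2] mn.
rewrite /partial_sum (big_split_sub _ mn) addrAC subrr add0r.
apply: le_lt_trans (normc_sum _ _ _) _.
(* The inequality 2 |f g| <= |f|^2 + |g|^2 bounds the tail by the tails of the two square sums. *)
apply: (@le_lt_trans _ _ (\sum_(x <- s n | x \notin s m)
    (normc (f x) ^+ 2 / 2 + normc (g x) ^+ 2 / 2))).
  apply: ler_sum => x _; rewrite normcM normc_conj.
  by have := sqr_ge0 (normc (f x) - normc (g x)); rewrite sqrrB mulr2n; lra.
rewrite big_split /= -!mulr_suml.
have := h1 _ _ Nm1 mn; have := h2 _ _ Nm2 mn.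
rewrite /sqsum !(big_split_sub _ mn) !(addrC (\sum_(x <- s m) _)) !addrK; lra.
Qed.

Definition is_sum (F : I -> R[i]) (a : R[i]) := forall e : R, 0 < e ->
  exists N, forall n, (N <= n)%N -> normc (partial_sum n F - a) < e.

Lemma is_sum_unique F a b : is_sum F a -> is_sum F b -> a = b.
Proof.
move=> Fa Fb; apply/eqP; rewrite -subr_eq0; apply/eqP/eq0_normc/eqP.
rewrite eq_le normc_ge0 andbT; apply/ler_addgt0Pr => e e0; rewrite add0r.
have e2 : 0 < e / 2 by rewrite divr_gt0.
have [N1 h1] := Fa _ e2; have [N2 h2] := Fb _ e2.
have := h1 _ (leq_maxl N1 N2); have := h2 _ (leq_maxr N1 N2).
set q := partial_sum _ _ => qb qa.
have := le_normcD (a - q) (q - b); rewrite addrA subrK (normcB a); lra.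
Qed.

Lemma is_sum_lin F G a b (t : R[i]) : is_sum F a -> is_sum G b ->
  is_sum (fun x => t * F x + G x) (t * a + b).
Proof.
move=> Fa Gb e e0; have e2 : 0 < e / 2 by rewrite divr_gt0.
have t0 : 0 < normc t + 1 by rewrite ltr_wpDl // normc_ge0.
have [N1 h1] := Fa _ (divr_gt0 e2 t0); have [N2 h2] := Gb _ e2.
exists (maxn N1 N2) => n; rewrite geq_max => /andP[/h1 l1 /h2 l2].
rewrite /partial_sum big_split /= -mulr_sumr opprD addrACA -mulrBr.
apply: le_lt_trans (le_normcD _ _) _; rewrite normcM.
move: l1; rewrite ltr_pdivlMr // mulrC mulrDl mul1r.
have := normc_ge0 (partial_sum n F - a); rewrite -!/(partial_sum n _); lra.
Qed.

Lemma is_sum_conj F a : is_sum F a -> is_sum (fun x => (F x)^*) a^*.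
Proof.
move=> Fa e /Fa [N hN]; exists N => n /hN.
by rewrite /partial_sum -rmorph_sum -rmorphB normc_conj.
Qed.

Lemma is_sum_eq F G a : F =1 G -> is_sum F a -> is_sum G a.
Proof.
move=> FG Fa e /Fa [N hN]; exists N => n /hN.
by rewrite /partial_sum (eq_bigr G).
Qed.

Definition l2_pred : {pred (I -> R[i])} := fun f => `[< sq_summable f >].

Fact l2_submod_closed : submod_closed l2_pred.
Proof.
split.
  apply/asboolP; exists 0 => n; rewrite /sqsum big1 // => x _.
  by rewrite -[(0 : I -> R[i]) x]/(0 : R[i]) normc0 expr0n.
move=> t f g /asboolP [M hM] /asboolP [N hN]; apply/asboolP.
exists ((normc t ^+ 2 * M + N) *+ 2) => n.
apply: (@le_trans _ _ (\sum_(x <- s n)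
    (normc t ^+ 2 * normc (f x) ^+ 2 + normc (g x) ^+ 2) *+ 2)).
  apply: ler_sum => x _; rewrite -[(t *: f + g) x]/(t * f x + g x).
  rewrite -exprMn -normcM.
  have := le_normcD (t * f x) (g x); have := normc_ge0 (t * f x + g x).
  have := sqr_ge0 (normc (t * f x) - normc (g x)).
  by move: (normc _) (normc (t * _)) (normc (g x)) => a b d; rewrite mulr2n; nra.
rewrite sumrMnl lerMn2r /= big_split /= -mulr_sumr lerD //; last exact: hN.
by rewrite ler_wpM2l ?hM // exprn_ge0 // normc_ge0.
Qed.

HB.instance Definition _ :=
  GRing.isSubmodClosed.Build R[i] (I -> R[i]) l2_pred l2_submod_closed.

Record l2 : Type := Mkl2 {l2_val :> I -> R[i]; _ : l2_val \in l2_pred}.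

HB.instance Definition _ := [isSub for l2_val].
HB.instance Definition _ := [Choice of l2 by <:].
HB.instance Definition _ := [SubChoice_isSubZmodule of l2 by <:].
HB.instance Definition _ := [SubZmodule_isSubLmodule of l2 by <:].

Implicit Types u v w : l2.

Lemma l2P u : sq_summable u.
Proof. exact/asboolP/(valP u). Qed.

Definition l2_dot u v : R[i] :=
  projT1 (cid (complex_cauchy (dot_cauchy (l2P u) (l2P v)))).

Lemma l2_dotP u v : is_sum (fun x => u x * (v x)^*) (l2_dot u v).
Proof. exact: projT2 (cid _). Qed.

Fact l2_dot_linearl v : scalar (l2_dot^~ v).
Proof.
move=> t u w; apply: (is_sum_unique (l2_dotP _ _)).
apply: is_sum_eq (is_sum_lin t (l2_dotP u v) (l2_dotP w v)) => x.
by rewrite /= mulrDl -mulrA.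
Qed.

Fact l2_dot_herm u v : l2_dot u v = (-1) ^+ false * (l2_dot v u)^*.
Proof.
rewrite expr0 mul1r; apply: (is_sum_unique (l2_dotP _ _)).
apply: is_sum_eq (is_sum_conj (l2_dotP v u)) => x.
by rewrite rmorphM /= conjCK mulrC.
Qed.

Fact l2_dot_linearr u : GRing.linear_for (Num.conj \; *%R) (l2_dot u).
Proof.
move=> t v w; rewrite l2_dot_herm l2_dot_linearl expr0 mul1r rmorphD rmorphM.
by rewrite (l2_dot_herm u v) (l2_dot_herm u w) !expr0 !mul1r.
Qed.

Lemma l2_dot_ge u n : ((sqsum n u)%:C <= l2_dot u u)%C.
Proof.
pose d := l2_dot u u; have dP := l2_dotP u u.
have psE k : partial_sum k (fun x => u x * (u x)^*) = (sqsum k u)%:C%C.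
  rewrite /partial_sum /sqsum rmorph_sum; apply: eq_bigr => x _.
  by rewrite -normCK normr_normc rmorphXn.
have im0 : complex.Im d = 0.
  apply/eqP; rewrite -normr_le0; apply/ler_addgt0Pr => e e0; rewrite add0r.
  have [N /(_ N (leqnn _))] := dP _ e0; rewrite psE => /ltW; apply: le_trans.
  by apply: le_trans (normc_Im _); rewrite raddfB /= sub0r normrN.
rewrite lecE im0 /= eqxx; apply/ler_addgt0Pr => e e0.
have [N /(_ (maxn n N) (leq_maxr _ _))] := dP _ e0; rewrite psE => h.
have := le_lt_trans (normc_Re _) h; rewrite raddfB /= ltr_norml => /andP[_].
by have := sqsum_mono u (leq_maxl n N); rewrite /d; lra.
Qed.

Fact l2_dot_gt0 u : u != 0 -> 0 < l2_dot u u.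
Proof.
move=> u0; have [x ux] : exists x, u x != 0.
  apply: contrapT => h; move/eqP: u0; apply; apply: val_inj; apply/funext => x.
  by apply: contrapT => ux; apply: h; exists x; apply/eqP.
have [n xn] := s_cover x; apply: lt_le_trans (l2_dot_ge u n).
rewrite ltcR /sqsum (bigD1_seq x) //= ltr_pwDl //.
  by rewrite exprn_gt0 // lt_neqAle normc_ge0 andbT eq_sym; apply: contra ux => /eqP/eq0_normc ->.
by apply: sumr_ge0 => y _; rewrite exprn_ge0 // normc_ge0.
Qed.

HB.instance Definition _ := bilinear_isBilinear.Build R[i] l2 l2 R[i]
  *%R (Num.conj \; *%R) l2_dot (l2_dot_linearl, l2_dot_linearr).
HB.instance Definition _ :=
  isHermitianSesquilinear.Build R[i] l2 false Num.conj l2_dot l2_dot_herm.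
HB.instance Definition _ := isDotProduct.Build R[i] l2 l2_dot l2_dot_gt0.

Definition l2_dot_form : {dot l2 for (@Num.conj R[i])} := l2_dot.

HB.instance Definition _ := Lmodule_isNormed.Build R[i] l2
  (dot_triangle l2_dot_form) (dot_sqrtZ l2_dot_form) (@dot_sqrt_eq0 _ _ l2_dot_form).

End L2.

Section L2Complete.
Variables (R : realType) (I : choiceType) (s : exhaustion I).
Local Notation l2 := (l2 R s).
Implicit Types u v w : l2.

Definition l2_sq u : R := complex.Re (l2_dot u u).

Lemma l2_dotE u : l2_dot u u = (l2_sq u)%:C%C.
Proof.
rewrite /l2_sq; have := @dnorm_ge0 _ _ (@l2_dot_form R I s) u.
by rewrite /=; case: (l2_dot u u) => a b; rewrite lecE /= => /andP[/eqP -> _].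
Qed.

Lemma l2_normE u : `|u| ^+ 2 = l2_dot u u.
Proof. exact: sqrtCK. Qed.

Lemma l2_norm_lt u (e : R) : 0 < e -> (`|u| < e%:C%C) = (l2_sq u < e ^+ 2).
Proof.
move=> e0; rewrite -(@ltr_pXn2r _ 2) ?nnegrE ?normr_ge0 ?ler0c ?ltW //.
by rewrite l2_normE l2_dotE -rmorphXn ltcR.
Qed.

Lemma sqsum_le u n : sqsum s n u <= l2_sq u.
Proof. by rewrite -lecR -l2_dotE; exact: l2_dot_ge. Qed.

Lemma l2_sq_le u M : (forall n, sqsum s n u <= M) -> l2_sq u <= M.
Proof.
move=> uM; apply/ler_addgt0Pr => e /(l2_dotP u u) [N /(_ N (leqnn _))] h.
have := le_lt_trans (normc_Re _) h; rewrite raddfB /= -/(l2_sq u).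
have -> : complex.Re (partial_sum s N (fun x => u x * (u x)^*)) = sqsum s N u.
  rewrite /partial_sum /sqsum raddf_sum; apply: eq_bigr => x _.
  by rewrite -normCK normr_normc -rmorphXn.
by rewrite ltr_norml => /andP[]; have := uM N; lra.
Qed.

Lemma l2_coord u x : normc (u x) ^+ 2 <= l2_sq u.
Proof.
have [n xn] := ex_cover s x; apply: le_trans (sqsum_le u n).
rewrite /sqsum (bigD1_seq x) //= ?ex_uniq // lerDl.
by apply: sumr_ge0 => y _; rewrite exprn_ge0 // normc_ge0.
Qed.

Lemma sq_normcD (a b : R[i]) :
  normc (a + b) ^+ 2 <= 2 * normc a ^+ 2 + 2 * normc b ^+ 2.
Proof.
have := le_normcD a b; have := normc_ge0 (a + b).
have := sqr_ge0 (normc a - normc b).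
by move: (normc _) (normc a) (normc b) => x y z; nra.
Qed.

Lemma l2_sqD u v : l2_sq (u + v) <= 2 * l2_sq u + 2 * l2_sq v.
Proof.
apply: l2_sq_le => n; have := sqsum_le u n; have := sqsum_le v n.
have : sqsum s n (u + v : l2) <= 2 * sqsum s n u + 2 * sqsum s n v; last by lra.
rewrite /sqsum !mulr_sumr -big_split; apply: ler_sum => x _; exact: sq_normcD.
Qed.

Lemma l2_sqN u : l2_sq (- u) = l2_sq u.
Proof.
apply: complexI; rewrite -!l2_dotE -!l2_normE normrN //.
Qed.

Lemma l2_seq_complete (f : nat -> l2) :
  (forall e : R, 0 < e -> exists N, forall m n, (N <= m)%N -> (N <= n)%N ->
     l2_sq (f m - f n) < e) ->
  exists g : l2, forall e : R, 0 < e ->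
    exists N, forall n, (N <= n)%N -> l2_sq (f n - g) <= e.
Proof.
move=> fc.
have fx x : exists a, forall e : R, 0 < e ->
    exists N, forall n, (N <= n)%N -> normc (f n x - a) < e.
  apply: complex_cauchy => e e0; have [N hN] := fc _ (exprn_gt0 2 e0).
  exists N => m n Nm Nn; have := le_lt_trans (l2_coord _ x) (hN _ _ Nm Nn).
  by rewrite ltr_pXn2r ?nnegrE ?normc_ge0 // ltW.
have {fx}[g gP] := choice fx.
have fin (l : seq I) (e : R) : 0 < e -> exists N, forall n, (N <= n)%N ->
    \sum_(x <- l) normc (f n x - g x) ^+ 2 < e.
  elim: l e => [|x l IH] e e0; first by exists 0%N => n _; rewrite big_nil.
  have e2 : 0 < e / 2 by rewrite divr_gt0.
  have [N1 h1] := IH _ e2.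
  have s0 : 0 < Num.sqrt (e / 2) by rewrite sqrtr_gt0.
  have [N2 h2] := gP x _ s0; exists (maxn N1 N2) => n; rewrite geq_max big_cons.
  move=> /andP[/h1 l1 /h2]; rewrite -(@ltr_pXn2r _ 2) ?nnegrE ?normc_ge0 ?sqrtr_ge0 //.
  rewrite sqr_sqrtr ?(ltW e2) // => l2'; lra.
(* The bound is uniform in the finite set [s k]: the auxiliary index m may depend on k, but it
   disappears from the conclusion. *)
have key (e : R) : 0 < e -> exists N, forall n k, (N <= n)%N ->
    \sum_(x <- s k) normc (f n x - g x) ^+ 2 <= e.
  move=> e0; have e4 : 0 < e / 4 by rewrite divr_gt0.
  have [N hN] := fc _ e4; exists N => n k Nn.
  have [M hM] := fin (s k) _ e4; pose m := maxn N M.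
  apply: (@le_trans _ _ (\sum_(x <- s k)
     (2 * normc ((f n - f m) x) ^+ 2 + 2 * normc (f m x - g x) ^+ 2))).
    apply: ler_sum => x _; apply: le_trans (sq_normcD _ _).
    by rewrite -[(f n - f m) x]/(f n x - f m x) addrA subrK.
  rewrite big_split /= -!mulr_sumr.
  have h1 := hN _ _ Nn (leq_maxl N M); have h2 := hM _ (leq_maxr N M).
  have := sqsum_le (f n - f m) k; rewrite /sqsum -/m in h1 h2 *; lra.
have gl2 : g \in l2_pred s.
  have [N hN] := key _ ltr01; have [M hM] := l2P (f N).
  apply/asboolP; exists (2 * M + 2) => n.
  have h1 := hN N n (leqnn N); have h2 := hM n.
  apply: (@le_trans _ _ (\sum_(x <- s n)
     (2 * normc (f N x) ^+ 2 + 2 * normc (f N x - g x) ^+ 2))).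
    apply: ler_sum => x _; rewrite (normcB (f N x)); apply: le_trans (sq_normcD _ _).
    by rewrite addrC subrK.
  rewrite big_split /= -!mulr_sumr; move: h2; rewrite /sqsum; lra.
exists (Mkl2 gl2) => e /key [N hN]; exists N => n Nn; apply: l2_sq_le => k.
exact: hN.
Qed.

Fact l2_complete (F : set_system l2) : ProperFilter F -> cauchy F -> cvg F.
Proof.
move=> FF /cauchy_ballP Fc.
have F_small (e : R) : 0 < e ->
    exists2 B, F B & forall u v, B u -> B v -> l2_sq (u - v) < e.
  move=> e0; have r0 : 0 < Num.sqrt e by rewrite sqrtr_gt0.
  have r0' : 0 < (Num.sqrt e)%:C%C :> R[i] by rewrite ltcR.
  have [[A B] /= [FA FB] AB] := Fc _ r0'; exists (A `&` B); first exact: filterI.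
  move=> u v [Au _] [_ Bv]; have := AB (u, v) (conj Au Bv).
  by rewrite -ball_normE /= l2_norm_lt // sqr_sqrtr // ltW.
have /choice [B BP] n : exists B, F B /\
    forall u v, B u -> B v -> l2_sq (u - v) < n.+1%:R^-1.
  have n0 : 0 < n.+1%:R^-1 :> R by rewrite invr_gt0 ltr0Sn.
  by have [B FB h] := F_small _ n0; exists B.
(* Choosing [f n] in all of the first n + 1 small sets at once makes the sequence Cauchy and keeps
   it close to each of these sets. *)
have /choice [f fP] n : exists u, forall k, (k <= n)%N -> B k u.
  have : F [set u | forall k, (k <= n)%N -> B k u].
    elim: n => [|n IH].
      by apply: filterS (BP 0%N).1 => u Bu k; rewrite leqn0 => /eqP ->.
    apply: filterS (filterI IH (BP n.+1).1) => u [h Bu] k.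
    by rewrite leq_eqVlt ltnS => /orP[/eqP -> //|/h].
  by move=> /filter_ex.
have [g gP] : exists g : l2, forall e : R, 0 < e ->
    exists N, forall n, (N <= n)%N -> l2_sq (f n - g) <= e.
  apply: l2_seq_complete => e e0.
  have [N _ hN] := near_infty_natSinv_lt (PosNum e0).
  exists N => m n Nm Nn; apply: lt_trans (hN _ (leqnn N)).
  by apply: (BP N).2; apply: fP.
apply/cvg_ex; exists g; apply/cvgrPdist_lt => e e0.
have e0' : 0 < complex.Re e by move: e0; rewrite ltcE => /andP[].
have eE : e = (complex.Re e)%:C%C.
  by move: e0; clear; case: e => a b; rewrite ltcE /= => /andP[/eqP -> _].
(* [l2_sqD] doubles both errors, each at most d, so the total is below 5 d. *)
pose d := complex.Re e ^+ 2 / 5.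
have d0 : 0 < d by rewrite divr_gt0 // exprn_gt0.
have [N1 _ hN1] := near_infty_natSinv_lt (PosNum d0).
have [N2 hN2] := gP _ d0; pose n := maxn N1 N2.
apply: filterS (BP n).1 => u Bu; rewrite eE l2_norm_lt //.
have h1 := hN2 n (leq_maxr _ _); have h2 := hN1 n (leq_maxl _ _).
have h3 := (BP n).2 _ _ (fP n n (leqnn n)) Bu.
have h4 : l2_sq (g - f n) = l2_sq (f n - g) by rewrite -l2_sqN opprB.
have := l2_sqD (g - f n) (f n - u); rewrite addrA subrK h4.
move: h1 h2 h3 (exprn_gt0 2 e0'); rewrite /= /d.
move: (_ ^+ 2) (l2_sq (f n - g)) (l2_sq (f n - u)) (l2_sq (g - u)) (n.+1%:R^-1).
by move=> a b c' d' k; lra.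
Qed.

HB.instance Definition _ := Uniform_isComplete.Build l2 l2_complete.

HB.instance Definition _ :=
  hasInner.Build R l2 (inner := @l2_dot_form R I s) l2_normE.

Definition l2_hilbert : hilbertType R := Hilbert.clone R l2 _.

End L2Complete.

(** * The twisted regular representation *)

Lemma isometry_bounded (R : realType) (H : hilbertType R) (T : H -> H) :
  linear T -> (forall u, `|T u| = `|u|) -> bounded_op T.
Proof.
move=> lin iso; split => // u.
have linB (v w : H) : T (v - w) = T v - T w.
  by rewrite addrC -scaleN1r lin scaleN1r addrC.
apply/cvgrPdist_lt => e e0.
apply/nbhs_ballP; exists e => //= v; rewrite -ball_normE /= => uv.
by rewrite -linB iso.
Qed.

Section WeightedShift.
Variables (R : realType) (I : choiceType) (s : exhaustion I).
Local Notation H := (l2_hilbert R s).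

(** [shift_stable] makes partial sums along the exhaustion invariant under reindexing from some
    stage on, so that no rearrangement of infinite sums is involved. *)
Record shift := Shift {
  shift_fun :> I -> I;
  shift_inv : I -> I;
  shift_funK : cancel shift_fun shift_inv;
  shift_invK : cancel shift_inv shift_fun;
  shift_stable : exists N, forall n, (N <= n)%N ->
    perm_eq (map shift_fun (s n)) (s n)
}.

Lemma partial_sum_shift (sg : shift) (V : nmodType) : exists N, forall n (F : I -> V),
  (N <= n)%N -> \sum_(x <- s n) F (sg x) = \sum_(x <- s n) F x.
Proof.
have [N hN] := shift_stable sg; exists N => n F Nn.
by rewrite -(big_map sg xpredT F); apply: perm_big; exact: hN.
Qed.

Lemma shift_inv_stable (sg : shift) : exists N, forall n, (N <= n)%N ->
  perm_eq (map (shift_inv sg) (s n)) (s n).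
Proof.
have [N hN] := shift_stable sg; exists N => n /hN; rewrite perm_sym => h.
have := perm_map (shift_inv sg) h.
by rewrite -map_comp (eq_map (shift_funK sg)) map_id.
Qed.

Definition inv_shift (sg : shift) : shift :=
  Shift (shift_invK sg) (shift_funK sg) (shift_inv_stable sg).

Fact wshift_l2 (w : I -> R[i]) (sg : shift) (u : H) (w1 : forall x, normc (w x) = 1) :
  (fun x => w x * (u : l2 R s) (sg x)) \in l2_pred s.
Proof.
have [M hM] := l2P u; have [N hN] := partial_sum_shift sg R.
apply/asboolP; exists M => n.
apply: le_trans (hM (maxn n N)); apply: le_trans (sqsum_mono _ _ (leq_maxl n N)) _.
rewrite /sqsum -(hN _ (fun x => normc (u x) ^+ 2)) ?leq_maxr //.
by apply: ler_sum => x _; rewrite normcM w1 mul1r.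
Qed.

Definition wshift (w : I -> R[i]) (w1 : forall x, normc (w x) = 1) (sg : shift)
  (u : H) : H := Mkl2 (wshift_l2 sg u w1) : l2 R s.

Lemma wshiftE w w1 sg u x :
  (@wshift w w1 sg u : l2 R s) x = w x * (u : l2 R s) (sg x).
Proof. by []. Qed.

Lemma l2_ext (u v : H) : (u : l2 R s) =1 (v : l2 R s) -> u = v.
Proof. by move=> uv; apply: val_inj; apply/funext. Qed.

Lemma wshift_linear w w1 sg : linear (@wshift w w1 sg).
Proof.
move=> t u v; apply: l2_ext => x.
rewrite wshiftE -[(t *: u + v : l2 R s) (sg x)]/(t * (u : l2 R s) (sg x) + (v : l2 R s) (sg x)).
rewrite mulrDr mulrCA.
by [].
Qed.

Lemma wshift_adjoint w w1 sg v v1 :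
  (forall x, v x = (w (inv_shift sg x))^*) ->
  adjoint_op (@wshift w w1 sg) (@wshift v v1 (inv_shift sg)).
Proof.
move=> vE f g; apply: (@is_sum_unique _ _ s (fun x => (wshift w1 sg f : l2 R s) x * ((g : l2 R s) x)^*)).
  exact: l2_dotP.
have [N hN] := partial_sum_shift sg R[i].
move=> e /(l2_dotP (f : l2 R s) (wshift v1 (inv_shift sg) g)) [M hM].
exists (maxn N M) => n; rewrite geq_max => /andP[Nn Mn]; have := hM _ Mn.
congr (normc (_ - _) < _); rewrite /partial_sum -hN //; apply: eq_bigr => x _.
by rewrite !wshiftE vE rmorphM /= conjCK shift_funK mulrCA mulrA.
Qed.

Lemma wshift_K w w1 sg v v1 :
  (forall x, v x = (w (inv_shift sg x))^*) ->
  cancel (@wshift w w1 sg) (@wshift v v1 (inv_shift sg)) /\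
  cancel (@wshift v v1 (inv_shift sg)) (@wshift w w1 sg).
Proof.
move=> vE; split=> u; apply: l2_ext => x; rewrite !wshiftE vE /=.
  by rewrite shift_invK mulrA conj_unit ?mul1r // w1.
by rewrite shift_funK mulrA (mulrC (w x)) conj_unit ?mul1r.
Qed.

(** The adjoint is the inverse weighted shift, so the inner product of T u with itself is that of
    u. *)
Lemma wshift_norm w w1 sg u : `|@wshift w w1 sg u| = `|u|.
Proof.
apply/eqP; rewrite -(@eqrXn2 _ 2) ?normr_ge0 //; apply/eqP.
rewrite !inner_normE.
have v1 x : normc ((w (inv_shift sg x))^*) = 1 by rewrite normc_conj.
rewrite (wshift_adjoint w1 v1) //.
by have [-> // _] := wshift_K w1 v1 (fun=> erefl).
Qed.

Lemma wshift_bounded w w1 sg : bounded_op (@wshift w w1 sg).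
Proof.
apply: isometry_bounded; [exact: wshift_linear|exact: wshift_norm].
Qed.

Lemma wshift_unitary w w1 sg : unitary_op (@wshift w w1 sg).
Proof.
have v1 x : normc ((w (inv_shift sg x))^*) = 1 by rewrite normc_conj.
split; first exact: wshift_bounded.
have [c1 c2] := wshift_K w1 v1 (fun=> erefl).
exists (wshift v1 (inv_shift sg)); split => //; first exact: wshift_bounded.
exact: wshift_adjoint.
Qed.

End WeightedShift.

Section PolyExhaustion.
Variable p : nat.
Local Notation F := 'F_p.

Definition poly_seq n : seq {poly F} := [seq rVpoly v | v : 'rV[F]_n].

Lemma mem_poly_seq n (x : {poly F}) : (x \in poly_seq n) = (size x <= n)%N.
Proof.
apply/mapP/idP => [[v _ ->]|xn]; first exact: size_poly.
by exists (poly_rV x); rewrite ?mem_enum // poly_rV_K.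
Qed.

Fact poly_seq_uniq n : uniq (poly_seq n).
Proof. by rewrite map_inj_uniq ?enum_uniq //; exact: can_inj (@rVpolyK _ _). Qed.

Fact poly_seq_mono m n : (m <= n)%N -> {subset poly_seq m <= poly_seq n}.
Proof. by move=> mn x; rewrite !mem_poly_seq => /leq_trans; apply. Qed.

Fact poly_seq_cover x : exists n, x \in poly_seq n.
Proof. by exists (size x); rewrite mem_poly_seq. Qed.

Definition poly_exhaustion : exhaustion {poly F} :=
  Exhaustion poly_seq_uniq poly_seq_mono poly_seq_cover.

Fact poly_shift_stable (y : {poly F}) : exists N, forall n, (N <= n)%N ->
  perm_eq (map (fun x => x - y) (poly_exhaustion n)) (poly_exhaustion n).
Proof.
exists (size y) => n yn; apply: uniq_perm; rewrite ?poly_seq_uniq //.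
  by rewrite map_inj_uniq ?poly_seq_uniq //; exact: addIr.
move=> x; rewrite /= mem_poly_seq; apply/mapP/idP => [[z]|xn].
  rewrite mem_poly_seq => zn ->; apply: leq_trans (size_polyD _ _) _.
  by rewrite size_polyN geq_max zn.
exists (x + y); last by rewrite addrK.
rewrite mem_poly_seq; apply: leq_trans (size_polyD _ _) _.
by rewrite geq_max xn.
Qed.

Definition poly_shift (y : {poly F}) : shift poly_exhaustion :=
  @Shift _ poly_exhaustion (fun x => x - y) (fun x => x + y)
    (fun x => subrK y x) (fun x => addrK y x) (poly_shift_stable y).

End PolyExhaustion.

Section RegularRep.
Variables (R : realType) (p : nat).
Hypothesis p_prime : prime p.
Local Notation F := 'F_p.
Variable c : nat -> nat -> F.
Hypothesis c_skew : skew_symmetric c.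
Local Notation H := (l2_hilbert R (poly_exhaustion p)).

(* [beta i 'X^j - beta j 'X^i = c i j]. *)
Definition beta k (x : {poly F}) : F := \sum_(j < size x | (k < j)%N) c k j * x`_j.

Lemma beta_widen k (x : {poly F}) n : (size x <= n)%N ->
  beta k x = \sum_(j < n | (k < j)%N) c k j * x`_j.
Proof.
move=> xn; rewrite /beta (big_ord_widen_cond n (fun j => (k < j)%N) (fun j => c k j * x`_j)) //.
rewrite big_mkcond [RHS]big_mkcond; apply: eq_bigr => j _ /=.
case: (leqP (size x) j) => h /=; last by rewrite andbT.
by rewrite andbF; case: ifP => // _; rewrite nth_default // mulr0.
Qed.

Lemma betaB k x y : beta k (x - y) = beta k x - beta k y.
Proof.
pose n := maxn (size x) (size y).
rewrite !(@beta_widen k _ n) ?leq_maxl ?leq_maxr //; last first.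
  by apply: leq_trans (size_polyD _ _) _; rewrite size_polyN.
rewrite -sumrB; apply: eq_bigr => j _; by rewrite coefB mulrBr.
Qed.

Lemma betaX k j : beta k 'X^j = if (k < j)%N then c k j else 0.
Proof.
rewrite /beta size_polyXn; case: ifP => kj.
  rewrite (bigD1 ord_max) //= coefXn eqxx mulr1 big1 ?addr0 // => i /andP[_].
  rewrite coefXn -val_eqE /= => /negbTE ->; by rewrite mulr0.
rewrite big1 // => i ki; rewrite coefXn; case: eqP => [ij|]; last by rewrite mulr0.
by move: ki; rewrite ij kj.
Qed.

Definition reg_weight (l : nat -> F) k x : R[i] := chi R (l k + beta k x).

Lemma reg_weight1 l k x : normc (reg_weight l k x) = 1.
Proof. exact: chi_unit. Qed.

Definition reg_op l k : H -> H := wshift (reg_weight1 l k) (poly_shift 'X^k).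

Lemma reg_opE l k u x :
  (reg_op l k u : l2 R _) x = chi R (l k + beta k x) * (u : l2 R _) (x - 'X^k).
Proof. by []. Qed.

(** The strict inequality in [beta] makes the weight of the k-th shift constant along its orbits,
    hence its p-th power trivial. Antisymmetrizing the strict upper triangle of c gives back c,
    where the full matrix would give 2 c, which is 0 for p = 2. The parameter [l] cancels from both
    relations. *)
Lemma reg_op_relations l : op_relations c (reg_op l).
Proof.
split=> [k|k h|i j h]; first exact: wshift_unitary.
- have it n x : (iter n (reg_op l k) h : l2 R _) x =
      chi R ((l k + beta k x) *+ n) * (h : l2 R _) (x - 'X^k *+ n).
    elim: n x => [|n IH] x; first by rewrite !mulr0n chi0 mul1r subr0.
    rewrite iterS reg_opE IH betaB betaX ltnn subr0 mulrA -chiD // -mulrS.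
    by rewrite (mulrS 'X^k) opprD addrA.
  by apply: l2_ext => x; rewrite it (Fp_mulrp p_prime) subr0 chiMn // chi_order // mul1r.
- apply: l2_ext => x.
  rewrite -[RHS]/(chi R (c i j) * (reg_op l j (reg_op l i h) : l2 R _) x) !reg_opE.
  rewrite !mulrA -!chiD // !betaB !betaX (addrAC x).
  congr (chi R _ * _); have [h1 h2] := c_skew i j.
  case: (ltngtP i j) => ij; last by rewrite ij in h2 *; rewrite h2; ring.
    by ring.
  by rewrite h1; ring.
Qed.

Definition delta0 : H.
Proof.
refine (Mkl2 (l2_val := fun x : {poly F} => (x == 0)%:R : R[i]) _ : l2 R (poly_exhaustion p)).
apply/asboolP; exists 1 => n; rewrite /sqsum.
case: (boolP (0 \in poly_exhaustion p n)) => h0.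
  rewrite (bigD1_seq 0) ?ex_uniq //= eqxx normc1 expr1n big1 ?addr0 // => x /negbTE ->.
  by rewrite normc0 expr0n.
rewrite big_seq big1 // => x xn; case: eqP => [x0|]; last by rewrite normc0 expr0n.
by rewrite x0 (negbTE h0) in xn.
Defined.

Lemma delta0_neq0 : delta0 <> 0.
Proof.
move=> /(congr1 (fun u : l2 R (poly_exhaustion p) => u 0)) /= /eqP.
by rewrite eqxx oner_eq0.
Qed.

End RegularRep.

(** * Main theorem *)

Section Decomposition.
Variables (R : realType) (p : nat) (c : nat -> nat -> 'F_p).
Hypotheses (p_prime : prime p) (c_skew : skew_symmetric c).
Variables (A : cstarAlgType R) (u : nat -> A).
Hypothesis rel : relations c u.
Hypothesis gen : forall a, closed_span (words u (fun _ : {poly 'F_p} => True)) a.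
Local Notation om := (omega c).
Local Notation K := (ker_omega c).
Local Notation w := (@word R p A u).
Local Notation Gp := {poly 'F_p}.

Lemma scalars_closed : closed ([set t *: 1 | t in [set: R[i]]] : set (topo A)).
Proof.
apply: closedP => f a hf fa; have [|t ->] := @line_closed R A 1 a f _ fa; last by exists t.
by move=> n; have [t _ <-] := hf n; exists t.
Qed.

Lemma center_trivial_of_scalars : (forall x, K x -> exists t : R[i], w x = t *: 1) ->
  trivial_center A.
Proof.
move=> h; rewrite /trivial_center (centerE p_prime c_skew rel gen).
apply/seteqP; split.
  apply: (closed_span_min scalars_closed); apply: lin_span_ind.
  - by exists 0 => //; rewrite scale0r.
  - move=> t _ _ [s _ <-] [s' _ <-]; exists (t * s + s') => //.
    by rewrite scalerDl scalerA.
  - by move=> _ [x /h [t ->] <-]; exists t.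
move=> _ [t _ <-]; apply: sub_closed_span; apply: lin_spanZ; apply: sub_lin_span.
by exists 0; [exact: ker_omega0|rewrite word0].
Qed.

Lemma trivial_of_symplectic : symplectic c -> trivial_center A.
Proof.
move=> sy; apply: center_trivial_of_scalars => x; rewrite sy => ->.
by exists 1; rewrite word0 scale1r.
Qed.

(** The spectral projections q of a normalized central word are central, so the elements with q a =
    a form a closed ideal: each q is 0 or 1. They sum to 1, so one of them is 1 and the word is the
    corresponding scalar. *)
Lemma trivial_of_simple : simple_cstar A -> trivial_center A.
Proof.
move=> simple; apply: center_trivial_of_scalars => x Kx.
have [t t1 vp] := word_normalize p_prime rel x.
set v := t *: w x in vp; have t0 : t != 0.
  by apply/eqP => t0; move: t1; rewrite t0 normc0 => /esym/eqP; rewrite oner_eq0.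
have vc a : v * a = a * v.
  by rewrite -scalerAl -scalerAr (word_central p_prime c_skew rel gen Kx).
pose q (i : 'F_p) := eproj v i.
have qc i a : a * q i = q i * a by apply: eproj_comm => //; exact/esym/vc.
have q01 i : q i = 0 \/ q i = 1.
  pose J : set A := [set a | q i * a = a].
  have qi : J (q i) by rewrite /J /= eproj_idem.
  have hJ : closed_ideal J.
    split; rewrite /J /=.
    - apply: closedP => f a hf fa; apply: (nlim_unique (nlimMl (q i) fa)).
      by apply: nlim_near fa; exists 0%N => n _; rewrite hf.
    - by rewrite mulr0.
    - by move=> s a b ha hb; rewrite mulrDr -scalerAr ha hb.
    - by move=> a b ha; rewrite mulrA -qc -mulrA ha mulrA ha.
  have [J0|JT] := simple J hJ; first by left; rewrite J0 in qi.
  have : J 1 by rewrite JT.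
  by rewrite /J /= mulr1; right.
have [i qi] : exists i, q i = 1.
  apply: contrapT => h; have /eqP := sum_eproj p_prime v.
  rewrite big1 ?(eq_sym 0) ?oner_eq0 // => i _.
  by have [//|qi] := q01 i; case: h; exists i.
have := eproj_shift p_prime vp (1 : 'F_p) i; rewrite -/(q i) qi !mulr1 => h.
exists (t^-1 * chi R i); rewrite -scalerA -h.
have -> : v ^+ nat_of_ord (1 : 'F_p) = v by rewrite -[RHS]expr1.
by rewrite scalerA mulVf // scale1r.
Qed.

Variables (e f : nat -> Gp) (r : option nat).
Hypothesis ef_default : forall k, ~~ below r k -> e k = 0 /\ f k = 0.
Hypothesis ef_hyp : forall i j,
  [/\ om (e i) (e j) = 0, om (f i) (f j) = 0 &
      om (e i) (f j) = ((i == j) && below r i)%:R].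
Hypothesis ef_span : forall x, exists n a b, K (x - pcomb e f n a b).

Lemma simple_symplectic : symplectic c -> simple_cstar A.
Proof.
move=> sy; apply: (simple_of_symplectic p_prime c_skew rel ef_default ef_hyp) => // x.
have [n [a [b]]] := ef_span x; rewrite sy => /eqP; rewrite subr_eq0 => /eqP ->.
by exists n, a, b.
Qed.

(* All of the kernel is enumerated, with repetitions: no basis is needed. *)
Definition ker_enum n : Gp :=
  if unpickle n is Some x then if `[< K x >] then x else 0 else 0.

Lemma ker_enum_ker n : K (ker_enum n).
Proof.
rewrite /ker_enum; case: unpickle => [x|]; last exact: ker_omega0.
by case: asboolP => // _; exact: ker_omega0.
Qed.

Lemma ker_enum_onto x : K x -> exists n, ker_enum n = x.
Proof.
by move=> Kx; exists (pickle x); rewrite /ker_enum pickleK asboolT.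
Qed.

Local Notation B := (generated_alg (ef_words u e f)).

Lemma tensor_decomposition :
  exists (X : pseudoPMetricType R) (i1 : Cfun R X -> A),
  [/\ [/\ compact [set: X], hausdorff_space X & totally_disconnected [set: X]],
      is_tensor i1 (fun b : B => gval b) &
      cstar_center A = [set i1 g | g in [set: Cfun R X]]].
Proof.
have [t ht] := choice (fun n => let: ex_intro2 s h1 h2 := word_normalize p_prime rel (ker_enum n)
  in ex_intro (fun s => normc s = 1 /\ (s *: w (ker_enum n)) ^+ p = 1) s (conj h1 h2)).
pose v n := t n *: w (ker_enum n).
have v_unit n : unitary_elt (v n) by apply: unitaryZ; [exact: (ht n).1|exact: (word_unitary rel)].
have v_p n : v n ^+ p = 1 := (ht n).2.
have wc x : K x -> cstar_center A (w x) := @word_central _ _ _ p_prime c_skew _ _ rel gen x.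
have v_c n : cstar_center A (v n).
  by move=> a; rewrite -scalerAl -scalerAr wc //; exact: ker_enum_ker.
have [y yS] := spectrum_point p_prime v.
pose x0 : seqspace (spectrum v) := SeqSpace yS.
pose X := seq_space R x0.
pose i1 : Cfun R X -> A := gelfand p_prime v_unit v_p v_c (x0 := x0).
have i1_hom : star_hom i1 := gelfand_hom p_prime v_unit v_p v_c x0.
have wK x : K x -> exists g, i1 g = w x.
  move=> /ker_enum_onto [n <-].
  have [g hg] := gelfand_coord p_prime v_unit v_p v_c x0 n.
  exists ((t n)^-1 *: g + 0); rewrite (star_hom_linear i1_hom).
  have -> : i1 0 = 0.
    by have := star_hom_linear i1_hom (-1) 0 0; rewrite scaler0 addr0 scaleN1r addNr.
  rewrite addr0 -[X in _ *: X = _]/(gelfand p_prime v_unit v_p v_c g) hg scalerA mulVf ?scale1r //.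
  by apply/eqP => t0; have := (ht n).1; rewrite t0 normc0 => /esym/eqP; rewrite oner_eq0.
have center_range : cstar_center A = [set i1 g | g in [set: Cfun R X]].
  apply/seteqP; split=> [z|_ [g _ <-]]; last exact: gelfand_central.
  rewrite (centerE p_prime c_skew rel gen) => /closure_nlim [h hS hz].
  have [|g hg] := @gelfand_range_closed R p p_prime A v v_unit v_p v_c x0 z h _ hz; last by exists g.
  move=> n; move: (h n) (hS n); apply: lin_span_ind.
  - exists 0; rewrite -/i1; have := star_hom_linear i1_hom (-1) 0 0.
    by rewrite scaler0 addr0 scaleN1r addNr.
  - by move=> s _ _ [g <-] [g' <-]; exists (s *: g + g'); exact: (star_hom_linear i1_hom).
  - by move=> _ [x /wK hx <-].
exists X, i1; split => //.
  split.
  - exact: (seq_space_compact (@spectrum_closed _ _ _ _)).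
  - exact: seq_space_hausdorff.
  - exact: seq_space_totally_disconnected.
have i1_central g : cstar_center A (i1 g) by rewrite center_range; exists g.
have i1_sum (I : finType) (s : I -> R[i]) (g : I -> Cfun R X) :
    i1 (\sum_i s i *: g i) = \sum_i s i *: i1 (g i).
  elim/big_rec2: _ => [|i y1 y2 _ <-]; last exact: (star_hom_linear i1_hom).
  by have := star_hom_linear i1_hom (-1) 0 0; rewrite scaler0 addr0 scaleN1r addNr.
have sub := words_subalgebra p_prime rel (pspan_all_subgroup e f).
split.
- exact: i1_hom.
- exact: gval_hom.
- by move=> g b; exact: i1_central.
- move=> I J a b ha hb s s0.
  pose d i := \sum_j s (i, j) *: gval (b j).
  have d0 : \sum_i i1 (a i) * d i = 0.
    transitivity (\sum_i \sum_j s (i, j) *: (i1 (a i) * gval (b j))).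
      by apply: eq_bigr => i _; rewrite mulr_sumr; apply: eq_bigr => j _; rewrite scalerAr.
    by rewrite pair_bigA -[RHS]s0; apply: eq_bigr => -[i j].
  have dW i : closed_span (words u (pspan_all e f)) (d i).
    apply: closed_span_sum => j; have [_ _ sl _ _] := sub.
    rewrite -[_ *: _]addr0; apply: sl; first exact: (gval_closed_span p_prime rel).
    exact/sub_closed_span/lin_span0.
  (* The relation is multiplied by [w x] and averaged. The central [i1 (a i)] pass through the
     averages, and the limit is a relation among the [i1 (a i)] with the traces [tau i] as
     coefficients. Injectivity of the Gelfand map and independence of the [a i] make these traces
     vanish, so [faithful] applies. *)
  have d_eq0 i : d i = 0.
    apply: (faithful p_prime c_skew rel ef_default ef_hyp (dW i)) => x hx.
    have dxW i' : closed_span (words u (pspan_all e f)) (d i' * w x).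
      have [_ _ _ sm _] := sub; apply: sm; first exact: dW.
      by apply/sub_closed_span/sub_lin_span; exists x.
    have [tau htau] := choice (fun i' => scalar_limit p_prime c_skew rel ef_default ef_hyp (dxW i')).
    suff -> : 0 = tau i *: 1 :> A by exact: htau.
    have tau0 : \sum_i tau i *: a i = 0.
      apply: (gelfand0_eq0 (p_prime := p_prime) (v_unit := v_unit) (v_p := v_p) (v_central := v_c)).
      rewrite -/i1 i1_sum.
      have := nlim_sum (index_enum I) (fun i' => nlimMl (i1 (a i')) (htau i')).
      under [X in nlim _ X]eq_bigr do rewrite -scalerAr mulr1.
      move=> /nlim_unique; apply; apply: nlim_near (nlim_cst _).
      exists 0%N => m _; under eq_bigr do rewrite -avgs_central //.
      rewrite -avgs_sum //; under eq_bigr do rewrite mulrA.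
      by rewrite -mulr_suml d0 mul0r avgs0.
    by rewrite (ha _ tau0) scale0r.
  move=> [i j]; apply: (hb (fun j => s (i, j))); apply: gval_inj.
  by rewrite gval_sum -[RHS](d_eq0 i).
- apply/seteqP; split => // z _; have gz := @gen z.
  have [_ hB] := symplectic_part p_prime c_skew rel ef_default ef_hyp.
  apply: (closed_span_min (closed_closure (A := _)) _ gz).
  move=> y' hy; apply: sub_closed_span; move: y' hy; apply: lin_span_ind.
  + exact: lin_span0.
  + by move=> s a b; exact: lin_span_lin.
  (* Up to a phase, the word of x is the product of the word of its kernel component, which lies in
     the range of [i1], and of the word of its symplectic component, which lies in B. *)
  + move=> _ [x _ <-]; have [n [a [b hx]]] := ef_span x.
    have [g hg] := wK _ hx; have [|b' hb'] := hB (pcomb e f n a b).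
      by exists n, a, b.
    have [q hq] := word_add p_prime rel (x - pcomb e f n a b) (pcomb e f n a b).
    rewrite subrK in hq; rewrite hq; apply: lin_spanZ; apply: sub_lin_span.
    by exists g, b'; rewrite hg hb'.
Qed.

End Decomposition.

(** * Separating nontrivial words from the scalars *)

Section Nonscalar.
Variables (R : realType) (p : nat) (c : nat -> nat -> 'F_p).
Hypotheses (p_prime : prime p) (c_skew : skew_symmetric c).
Variables (E : cstarAlgType R) (u : nat -> E).
Hypothesis u_univ : universal c u.
Local Notation A := (cstar_seq u).
Local Notation g := (generator u : nat -> A).
Local Notation H := (l2_hilbert R (poly_exhaustion p)).

Lemma universal_word_nonscalar (x : {poly 'F_p}) (t : R[i]) :
  word g x = t *: 1 -> x = 0.
Proof.
move=> xt; apply/eqP; apply: contraT => x0.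
have k0 : lead_coef x != 0 by rewrite lead_coef_eq0.
(* The representations with weights 0 and l differ on the word of x by the
   factor [chi (lead_coef x)]. *)
pose l k : 'F_p := (k == (size x).-1)%:R.
have [_ univ] := u_univ.
have [pi0 [rep0 pi0E]] := univ H _ (reg_op_relations R p_prime c_skew (fun=> 0)).
have [pi1 [rep1 pi1E]] := univ H _ (reg_op_relations R p_prime c_skew l).
(* A representation is not assumed unital, but [pi 1] fixes the range of [pi (g 0)], which is
   everything because that operator is unitary. *)
have one (pi : A -> H -> H) (l' : nat -> 'F_p) : representation pi ->
    (forall k h, pi (g k) h = reg_op c l' k h) -> forall h, pi 1 h = h.
  move=> rep piE h; have [_ [V [_ _ _ UK]]] : unitary_op (reg_op c l' 0 : H -> H).
    by have [uop _ _] := reg_op_relations R p_prime c_skew l'; exact: uop.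
  by rewrite -{1}(UK h) -piE -(rep_mul rep) mul1r piE UK.
have piM (pi : A -> H -> H) : representation pi -> forall (a : A) (s : R[i]) h,
    pi a (s *: h) = s *: pi a h.
  move=> rep a s h; have [lin _] := rep_bounded rep a.
  have z : pi a 0 = 0.
    by have := lin (-1) 0 0; rewrite scaler0 addr0 scaleN1r addNr.
  by have := lin s h 0; rewrite !addr0 z addr0.
have genE k n h : pi1 (g k ^+ n) h = chi R (l k *+ n) *: pi0 (g k ^+ n) h.
  elim: n h => [|n IH] h.
    by rewrite !expr0 (one _ _ rep0 pi0E) (one _ _ rep1 pi1E) mulr0n chi0 scale1r.
  rewrite !exprSr (rep_mul rep1) (rep_mul rep0) IH pi1E pi0E.
  have -> : reg_op c l k h = chi R (l k) *: reg_op c (fun=> 0) k h.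
    apply: l2_ext => y; rewrite -[RHS]/(chi R (l k) * (reg_op c (fun=> 0) k h : l2 R _) y).
    by rewrite !reg_opE add0r chiD // mulrA.
  by rewrite piM // scalerA -chiD // mulrSr.
have wE n h : pi1 (\prod_(k < n) g k ^+ nat_of_ord x`_k) h =
    chi R (\sum_(k < n) l k *+ nat_of_ord x`_k) *:
    pi0 (\prod_(k < n) g k ^+ nat_of_ord x`_k) h.
  elim: n h => [|n IH] h.
    by rewrite !big_ord0 (one _ _ rep0 pi0E) (one _ _ rep1 pi1E) chi0 scale1r.
  rewrite !big_ord_recr /= (rep_mul rep1) (rep_mul rep0) IH genE piM // scalerA.
  by rewrite chiD.
have piS (pi : A -> H -> H) (l' : nat -> 'F_p) : representation pi ->
    (forall k h, pi (g k) h = reg_op c l' k h) -> forall s h, pi (s *: 1) h = s *: h.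
  move=> rep piE s h; have z : pi 0 h = 0.
    by have := rep_linear rep (-1) 0 0 h; rewrite scaler0 addr0 scaleN1r addNr.
  by have := rep_linear rep s 1 0 h; rewrite addr0 z addr0 (one _ _ rep piE).
have := wE (size x) (delta0 R p); rewrite -/(word g x) xt.
rewrite (piS _ _ rep0 pi0E) (piS _ _ rep1 pi1E) scalerA => /eqP.
have xs : (0 < size x)%N by rewrite lt0n size_poly_eq0.
have -> : \sum_(k < size x) l k *+ nat_of_ord x`_k = lead_coef x.
  have hl : ((size x).-1 < size x)%N by rewrite prednK.
  rewrite (bigD1 (Ordinal hl)) //= /l eqxx [X in _ + X]big1 ?addr0 => [|k].
    by rewrite natr_Zp lead_coefE.
  by rewrite -val_eqE /= => /negbTE ->; rewrite mul0rn.
rewrite -subr_eq0 -scalerBl scaler_eq0 => /orP[|/eqP /delta0_neq0 //].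
rewrite -{1}[t]mul1r -mulrBl mulf_eq0 => /orP[|/eqP t0].
  by rewrite subr_eq0 eq_sym => /eqP /(chi_eq1 p_prime) h; rewrite h eqxx in k0.
have rel := generator_relations (proj1 u_univ).
by have := unitary_neq0 (word_unitary rel x); rewrite xt t0 scale0r eqxx.
Qed.

End Nonscalar.

Theorem theoremB (R : realType) (p : nat) (p_prime : prime p)
    (c : nat -> nat -> 'F_p) (c_skew : skew_symmetric c)
    (E : cstarAlgType R) (u : nat -> E) (u_univ : universal c u)
    (r : option nat) (r_neq0 : r <> Some 0%N) (rank_c : half_rank c r) :
  let A := cstar_seq u in
  (exists (X : pseudoPMetricType R) (B T : cstarAlgType R)
      (i1 : Cfun R X -> T) (i2 : B -> T) (phi : A -> T),
    [/\ [/\ compact [set: X], hausdorff_space X &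
            totally_disconnected [set: X]],
        match r with
        | Some m => exists f : B -> Mat R (p ^ m)%N, star_iso f
        | None => uhf_type p B
        end,
        is_tensor i1 i2,
        star_iso phi &
        [set phi a | a in cstar_center A] = [set i1 g * i2 1 | g in [set: Cfun R X]]])
  /\ cstar_center A = closed_span [set word (generator u) x | x in ker_omega c]
  /\ (simple_cstar A <-> trivial_center A)
  /\ (trivial_center A <-> symplectic c).
Proof.
move=> A; have rel : relations c (generator u : nat -> A) := generator_relations (proj1 u_univ).
have gen (a : A) := @words_dense R p c p_prime E u (proj1 u_univ) a.
have [e [f [ef_default ef_hyp ef_span]]] := symplectic_basis c_skew rank_c.
have sympl : trivial_center A -> symplectic c.
  move=> triv; apply/seteqP; split=> [x kx|_ ->]; last exact: ker_omega0.
  have := word_central p_prime c_skew rel gen kx; rewrite triv => -[t _ /esym].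
  exact: (universal_word_nonscalar p_prime c_skew u_univ).
split; last split; last split.
- have [hB _] := symplectic_part p_prime c_skew rel ef_default ef_hyp.
  have [X [i1 [hX hT hZ]]] := tensor_decomposition p_prime c_skew rel gen ef_default ef_hyp ef_span.
  (* The tensor product is internal: [T] is the algebra itself and [phi] the identity. *)
  exists X, (generated_alg (ef_words (generator u : nat -> A) e f)), A, i1, (fun b => gval b), id.
  split => //; first by split; [split|exists id].
  rewrite image_id hZ; apply/seteqP; split=> _ [g _ <-]; exists g => //;
    by rewrite (star_hom_one (gval_hom _)) mulr1.
- exact: centerE.
(* The converse passes through the form being symplectic, and thus depends on universality. *)
- split; first exact: (trivial_of_simple p_prime c_skew rel gen).
  by move=> /sympl; exact: (simple_symplectic p_prime c_skew rel gen ef_default ef_hyp ef_span).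
- by split => //; exact: (trivial_of_symplectic p_prime c_skew rel gen).
Qed.
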